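(* Let $\mathcal T=\{s_0,s_1,\dots,s_K\}$ with $0=s_0\le s_1\le\dots\le s_K=T$. Let $(x_{s,t})_{s,t\in\mathcal T}$ be a time-consistent system of operators of type $(\star)$ on $(L_t)_{t\in\mathcal T}$ satisfying the sandwich condition with respect to a family $(m_{s,t},M_{s,t})_{s,t\in\mathcal T}$ fulfilling the mM1-condition. For $i<j$ define $$\hat x_{s_i,s_j}(X):=\operatorname*{ess\,sup}_{f\in\mathcal Q_{i,j}}\{E[fX|\mathcal F_{s_i}]-\alpha_{s_i,s_j}(f)\},\qquad X\in L_p(\mathcal F_{s_j}),$$ where $$\mathcal Q_{i,j}:=\Big\{f\in L_q(\mathcal F_{s_j})^+:\ f=\prod_{l=i}^{j-1}g_{l+1},\ g_{l+1}\in\mathbb D^{S,e}_{s_l,s_{l+1}}\Big\},$$ and, for $f=\prod_{l=i}^{j-1}g_{l+1}\in\mathcal Q_{i,j}$, the penalty is $$\alpha_{s_i,s_j}(f):=\sum_{l=i}^{j-1}E\big[\alpha_{s_l,s_{l+1}}(g_{l+1})\,\big|\,\mathcal F_{s_i}\big],\qquad \alpha_{s_l,s_{l+1}}(g_{l+1}):=\operatorname*{ess\,sup}_{X\in L_{s_{l+1}}}\{E[g_{l+1}X|\mathcal F_{s_l}]-x_{s_l,s_{l+1}}(X)\}.$$ Then for all $s\le t$ in $\mathcal T$ the operator $\hat x_{s,t}$ extends $x_{s,t}$ to $L_p(\mathcal F_t)$, and the family $(\hat x_{s,t})_{s,t\in\mathcal T}$ is a time-consistent sandwich preserving extension of $(x_{s,t})_{s,t\in\mathcal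 T}$. Moreover $(\hat x_{s,t})_{s,t\in\mathcal T}$ is maximal, in the sense that if $(\bar x_{s,t})_{s,t\in\mathcal T}$ is another such family, then for all $i<j$, $$\hat x_{s_i,s_j}(X)\ge\bar x_{s_i,s_j}(X),\qquad X\in L_p(\mathcal F_{s_j}).$$
   Context: $(\Omega,\mathcal B,P)$ is a complete probability space with a right-continuous $P$-augmented filtration $(\mathcal F_t)_{t\in[0,T]}$, $T>0$, $\mathcal F_t\subseteq\mathcal B$, each $\mathcal F_t$ being the smallest $\sigma$-algebra containing some countable family of events and all $P$-null events. $E$ denotes expectation under $P$. Fix $p\in[1,\infty]$ and $q=p/(p-1)$ ($q=\infty$ if $p=1$, $q=1$ if $p=\infty$). $L_p$ spaces carry the norm topology if $p<\infty$ and the weak* topology $\sigma(L_\infty,L_1)$ if $p=\infty$; superscript $+$ denotes non-negative elements. $\mathcal T\subseteq[0,T]$ is an index set with $0,T\in\mathcal T$. For each $t$, $L_t\subseteq L_p(\mathcal F_t)$ is a linear subspace, $L_t\subseteq L_T$. A system of operators of type $(\star)$ consists of $x_{s,t}:L_t\to L_s$, $s\le t$ in $\mathcal T$, such that $1\in L_t$; $1_AX\in L_t$ for $A\in\mathcal F_s$, $X\in L_t$; $L_t$ is closed under $P$-a.s. limits of $L_p$-norm-bounded sequences; and $x_{s,t}$ is monotone, convex, has the Fatou property (if $(X_n)\subset L_t$ is $L_p$-bounded and $X_n\to X$ $P$-a.s. then $\liminf_n x_{s,t}(X_n)\ge x_{s,t}(X)$), is weak $\mathcal F_s$-homogeneous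 ($x_{s,t}(1_AX)=1_Ax_{s,t}(X)$ for $A\in\mathcal F_s$) and has the projection property ($x_{s,t}(f)=f$ for $f\in L_p(\mathcal F_s)\cap L_t$). The system is time-consistent if $x_{s,u}(X)=x_{s,t}(x_{t,u}(X))$ for all $s\le t\le u$ in $\mathcal T$, $X\in L_u$. mM1-condition: for $s\le t$ in $\mathcal T$, $m_{s,t},M_{s,t}:L_p(\mathcal F_t)^+\to L_p(\mathcal F_s)^+$ are weak $\mathcal F_s$-homogeneous; $m_{s,t}$ is superlinear (superadditive and positively homogeneous) and $M_{s,t}$ sublinear (subadditive and positively homogeneous); they are weak time-consistent, i.e. $m_{r,s}(m_{s,t}(X))\ge m_{r,t}(X)$ and $M_{r,s}(M_{s,t}(X))\le M_{r,t}(X)$ for $r\le s\le t$, $X\in L_p(\mathcal F_t)^+$; $m_{0,T}$ is non degenerate, i.e. $E[m_{0,T}(1_B)]>0$ whenever $B\in\mathcal F_T$, $P(B)>0$; and if $p=\infty$ each $M_{s,t}$ is regular, i.e. $M_{s,t}(X_n)\to0$ $P$-a.s. whenever $(X_n)$ is a decreasing sequence in $L_\infty(\mathcal F_t)$ with $X_n\downarrow0$ $P$-a.s. Sandwich condition: $m_{s,t}(Z)+x_{s,t}(X)\le M_{s,t}(Y)$ for all $s\le t$, $X\in L_t$, $Y,Z\in L_p(\mathcal F_t)^+$ with $Z+X\le Y$. A time-consistent sandwich preserving extension of $(x_{s,t})_{s,t\in\mathcal T}$ is a family of operators $\bar x_{s,t}:L_p(\mathcal F_t)\to L_p(\mathcal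 F_s)$, $s\le t$ in $\mathcal T$, with $\bar x_{s,t}=x_{s,t}$ on $L_t$, each convex, monotone, lower semicontinuous, weak $\mathcal F_s$-homogeneous, with the projection property, satisfying the sandwich condition for all $X\in L_p(\mathcal F_t)$, and time-consistent: $\bar x_{s,u}=\bar x_{s,t}\circ\bar x_{t,u}$ for $s\le t\le u$ in $\mathcal T$. For $s=t$, $\hat x_{t,t}$ is understood as the identity. $\mathbb D^{S,e}_{s,t}$ is the set of $f\in L_q(\mathcal F_t)$ with $f>0$ $P$-a.s., $E[f|\mathcal F_s]=1$ and $m_{s,t}(X)\le E[fX|\mathcal F_s]\le M_{s,t}(X)$ for all $X\in L_p(\mathcal F_t)^+$.
   Formalization: The penalty is corrected to the sum of E[f·α_{s_l,s_{l+1}}(g_{l+1})|F_{s_i}], i.e. conditional expectation under the probability with density f; with the printed unweighted expectation under P, the extension claim already fails for K=2. *)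

(* Defs.v *)
From HB Require Import structures.
From mathcomp Require Import all_boot all_order all_algebra.
From mathcomp Require Import all_classical all_reals all_analysis.
From mathcomp Require Import measurable_realfun.

Set Implicit Arguments.
Unset Strict Implicit.
Unset Printing Implicit Defensive.

Import Order.TTheory GRing.Theory Num.Theory.
Import numFieldNormedType.Exports.

Local Open Scope classical_set_scope.
Local Open Scope ring_scope.

(* Elements of L_p are represented by functions Omega -> R. Operators on L_p
   act on representatives, are required to respect almost sure equality, and
   all (in)equalities between random variables hold P-almost surely.
   Sub-sigma-algebras are sets of sets G; measurability with respect to G is
   measurability on g_sigma_algebraType G. *)

Section random_variables.
Context d (Omega : measurableType d) (R : realType) (P : probability Omega R).
Implicit Types (G : set (set Omega)) (p : \bar R).

Definition Lp p G : set (Omega -> R) :=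
  [set f | measurable_fun [set: g_sigma_algebraType G]
             (f : g_sigma_algebraType G -> R) /\ finite_norm P p f].

Definition Lp_ge0 p G : set (Omega -> R) :=
  [set f | Lp p G f /\ {ae P, forall w, 0 <= f w}].

(* For p < +oo, the neighborhoods of X in the norm topology of Lp p G; for
   p = +oo, those in the weak* topology sigma(L_oo, L_1). *)
Definition Lp_nbhs p G (X : Omega -> R) : set_system (Omega -> R) :=
  [set U | if p == +oo%E then
      exists n (h : 'I_n -> Omega -> R) (e : R),
        [/\ forall i, Lp 1%E G (h i), 0 < e &
            forall Y, Lp p G Y ->
              (forall i, `|'E_P[(h i \* (Y \- X))%R]| < e%:E)%E -> U Y]
    else
      exists2 e : R, 0 < e &
        forall Y, Lp p G Y -> ('N[P]_p[EFin \o (Y \- X)%R] < e%:E)%E -> U Y].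

(* Z is a version of E[Y | G]. This characterizes Z almost surely when Y is
   integrable and also when Y is almost surely nonnegative, possibly with
   value +oo; both cases occur below. *)
Definition is_cond_exp G (Y Z : Omega -> \bar R) : Prop :=
  measurable_fun [set: g_sigma_algebraType G]
    (Z : g_sigma_algebraType G -> \bar R) /\
  (forall A, G A -> \int[P]_(w in A) Z w = \int[P]_(w in A) Y w)%E.

Definition cond_exp G (Y : Omega -> \bar R) : Omega -> \bar R :=
  xget (cst 0%E) [set Z | is_cond_exp G Y Z].

(* Essential supremum of a family of random variables, as opposed to the
   number ess_sup P f attached to a single function. *)
Definition is_ess_sup_family (S : set (Omega -> \bar R))
    (Z : Omega -> \bar R) : Prop :=
  [/\ measurable_fun [set: Omega] Z,
      forall Y, S Y -> {ae P, forall w, (Y w <= Z w)%E} &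
      forall Z' : Omega -> \bar R, measurable_fun [set: Omega] Z' ->
        (forall Y, S Y -> {ae P, forall w, (Y w <= Z' w)%E}) ->
        {ae P, forall w, (Z w <= Z' w)%E}].

Definition ess_sup_family (S : set (Omega -> \bar R)) : Omega -> \bar R :=
  xget (cst -oo%E) [set Z | is_ess_sup_family S Z].

Record augmented_filtration (T : R) (F : R -> set (set Omega)) : Prop := {
  filtration_sigma_algebra : forall t, 0 <= t <= T ->
    sigma_algebra [set: Omega] (F t) ;
  filtration_measurable : forall t, 0 <= t <= T -> F t `<=` measurable ;
  filtration_nondecreasing : forall s t, 0 <= s -> s <= t -> t <= T ->
    F s `<=` F t ;
  filtration_right_continuous : forall s, 0 <= s < T ->
    \bigcap_(t in [set t | s < t <= T]) F t = F s ;
  filtration_generated : forall t, 0 <= t <= T ->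
    exists C : set (set Omega), [/\ countable C, C `<=` measurable &
      F t = <<s C `|` [set N | P.-negligible N] >>] }.

End random_variables.

Section operators.
Context d (Omega : measurableType d) (R : realType) (P : probability Omega R).
Implicit Types (p : \bar R) (G : set (set Omega)) (D : set (Omega -> R)).
Implicit Types (x : (Omega -> R) -> Omega -> R).

(* x is well defined from D to D' as a map on almost sure classes. *)
Definition operator D D' x : Prop :=
  (forall X, D X -> D' (x X)) /\
  (forall X Y, D X -> D Y -> X = Y %[ae P] -> x X = x Y %[ae P]).

Definition op_monotone D x : Prop :=
  forall X Y, D X -> D Y -> {ae P, forall w, X w <= Y w} ->
    {ae P, forall w, x X w <= x Y w}.

Definition op_convex D x : Prop :=
  forall X Y (a : R), D X -> D Y -> 0 <= a <= 1 ->
    {ae P, forall w, x (a *: X + (1 - a) *: Y) w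
                     <= a * x X w + (1 - a) * x Y w}.

(* The guard D (\1_A \* X) is automatic on the domains closed under
   multiplication by indicators of events of G. *)
Definition weak_homogeneous G D x : Prop :=
  forall A X, G A -> D X -> D (\1_A \* X) ->
    x (\1_A \* X) = \1_A \* x X %[ae P].

Definition projection_property p G D x : Prop :=
  forall f, Lp P p G f -> D f -> x f = f %[ae P].

Definition Lp_bounded p (X : nat -> Omega -> R) : Prop :=
  exists C : R, forall n, ('N[P]_p[EFin \o X n] <= C%:E)%E.

Definition fatou_property p D x : Prop :=
  forall (X : nat -> Omega -> R) (Y : Omega -> R),
    (forall n, D (X n)) -> D Y -> Lp_bounded p X ->
    {ae P, forall w, X n w @[n --> \oo] --> Y w} ->
    {ae P, forall w, ((x Y w)%:E <= limn_einf (fun n => (x (X n) w)%:E))%E}.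

(* Lower semicontinuity of x : Lp p Gt -> Lp p Gs: the epigraph
   {(X, Z) | x X <= Z} is closed in Lp p Gt * Lp p Gs. *)
Definition op_lower_semicontinuous p Gt Gs x : Prop :=
  forall X Z, Lp P p Gt X -> Lp P p Gs Z ->
    (forall U V, Lp_nbhs P p Gt X U -> Lp_nbhs P p Gs Z V ->
      exists X' Z', [/\ Lp P p Gt X' /\ U X', Lp P p Gs Z' /\ V Z' &
        {ae P, forall w, x X' w <= Z' w}]) ->
    {ae P, forall w, x X w <= Z w}.

Definition positively_homogeneous D x : Prop :=
  forall X (c : R), D X -> 0 <= c -> x (c *: X) = c *: x X %[ae P].

Definition superlinear D x : Prop :=
  (forall X Y, D X -> D Y -> {ae P, forall w, x X w + x Y w <= x (X + Y) w}) /\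
  positively_homogeneous D x.

Definition sublinear D x : Prop :=
  (forall X Y, D X -> D Y -> {ae P, forall w, x (X + Y) w <= x X w + x Y w}) /\
  positively_homogeneous D x.

Definition sandwich p Gt D x (m M : (Omega -> R) -> Omega -> R) : Prop :=
  forall X Y Z, D X -> Lp_ge0 P p Gt Y -> Lp_ge0 P p Gt Z ->
    {ae P, forall w, Z w + X w <= Y w} ->
    {ae P, forall w, m Z w + x X w <= M Y w}.

End operators.

Section systems.
Context d (Omega : measurableType d) (R : realType) (P : probability Omega R).
Variables (p : \bar R) (T : R) (F : R -> set (set Omega)) (TT : set R).
(* Families of operators: x s t goes from time t to time s. *)
Implicit Types (x m M : R -> R -> (Omega -> R) -> Omega -> R).
Implicit Types (L : R -> set (Omega -> R)).

Definition time_consistent L x : Prop :=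
  forall s t u X, TT s -> TT t -> TT u -> s <= t -> t <= u -> L u X ->
    x s u X = x s t (x t u X) %[ae P].

(* Systems of type (star). In star_indic only s < t is required: with s = t
   allowed, the other clauses would force L t = Lp p (F t), so there would be
   nothing to extend. *)
Record star_system L x : Prop := {
  star_Lp : forall t, TT t -> L t `<=` Lp P p (F t) ;
  star_ae : forall t X Y, TT t -> L t X -> X = Y %[ae P] -> L t Y ;
  star_zero : forall t, TT t -> L t (cst 0) ;
  star_linear : forall t (a : R) X Y, TT t -> L t X -> L t Y ->
    L t (a *: X + Y) ;
  star_sub_T : forall t, TT t -> L t `<=` L T ;
  star_one : forall t, TT t -> L t (cst 1) ;
  star_indic : forall s t A X, TT s -> TT t -> s < t -> F s A -> L t X ->
    L t (\1_A \* X) ;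
  star_closed : forall t (X : nat -> Omega -> R) (Y : Omega -> R), TT t ->
    (forall n, L t (X n)) -> Lp_bounded P p X ->
    {ae P, forall w, X n w @[n --> \oo] --> Y w} -> L t Y ;
  star_operator : forall s t, TT s -> TT t -> s <= t ->
    operator P (L t) (L s) (x s t) ;
  star_monotone : forall s t, TT s -> TT t -> s <= t ->
    op_monotone P (L t) (x s t) ;
  star_convex : forall s t, TT s -> TT t -> s <= t ->
    op_convex P (L t) (x s t) ;
  star_fatou : forall s t, TT s -> TT t -> s <= t ->
    fatou_property P p (L t) (x s t) ;
  star_weak_homogeneous : forall s t, TT s -> TT t -> s <= t ->
    weak_homogeneous P (F s) (L t) (x s t) ;
  star_projection : forall s t, TT s -> TT t -> s <= t ->
    projection_property P p (F s) (L t) (x s t) }.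

Record mM_condition m M : Prop := {
  mM_operator_m : forall s t, TT s -> TT t -> s <= t ->
    operator P (Lp_ge0 P p (F t)) (Lp_ge0 P p (F s)) (m s t) ;
  mM_operator_M : forall s t, TT s -> TT t -> s <= t ->
    operator P (Lp_ge0 P p (F t)) (Lp_ge0 P p (F s)) (M s t) ;
  mM_weak_homogeneous_m : forall s t, TT s -> TT t -> s <= t ->
    weak_homogeneous P (F s) (Lp_ge0 P p (F t)) (m s t) ;
  mM_weak_homogeneous_M : forall s t, TT s -> TT t -> s <= t ->
    weak_homogeneous P (F s) (Lp_ge0 P p (F t)) (M s t) ;
  mM_superlinear : forall s t, TT s -> TT t -> s <= t ->
    superlinear P (Lp_ge0 P p (F t)) (m s t) ;
  mM_sublinear : forall s t, TT s -> TT t -> s <= t ->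
    sublinear P (Lp_ge0 P p (F t)) (M s t) ;
  mM_weak_time_consistent_m : forall r s t X, TT r -> TT s -> TT t ->
    r <= s -> s <= t -> Lp_ge0 P p (F t) X ->
    {ae P, forall w, m r t X w <= m r s (m s t X) w} ;
  mM_weak_time_consistent_M : forall r s t X, TT r -> TT s -> TT t ->
    r <= s -> s <= t -> Lp_ge0 P p (F t) X ->
    {ae P, forall w, M r s (M s t X) w <= M r t X w} ;
  mM_non_degenerate : forall B, F T B -> (0 < P B)%E ->
    (0 < 'E_P[m 0%R T \1_B])%E ;
  mM_regular : p = +oo%E -> forall s t, TT s -> TT t -> s <= t ->
    forall X : nat -> Omega -> R, (forall n, Lp P p (F t) (X n)) ->
      (forall n, {ae P, forall w, X n.+1 w <= X n w}) ->
      {ae P, forall w, X n w @[n --> \oo] --> (0 : R)} ->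
      {ae P, forall w, M s t (X n) w @[n --> \oo] --> (0 : R)} }.

Definition sandwich_condition L x m M : Prop :=
  forall s t, TT s -> TT t -> s <= t ->
    sandwich P p (F t) (L t) (x s t) (m s t) (M s t).

Record sandwich_extension L x m M
    (xbar : R -> R -> (Omega -> R) -> Omega -> R) : Prop := {
  ext_operator : forall s t, TT s -> TT t -> s <= t ->
    operator P (Lp P p (F t)) (Lp P p (F s)) (xbar s t) ;
  ext_extends : forall s t X, TT s -> TT t -> s <= t -> L t X ->
    xbar s t X = x s t X %[ae P] ;
  ext_convex : forall s t, TT s -> TT t -> s <= t ->
    op_convex P (Lp P p (F t)) (xbar s t) ;
  ext_monotone : forall s t, TT s -> TT t -> s <= t ->
    op_monotone P (Lp P p (F t)) (xbar s t) ;
  ext_lower_semicontinuous : forall s t, TT s -> TT t -> s <= t ->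
    op_lower_semicontinuous P p (F t) (F s) (xbar s t) ;
  ext_weak_homogeneous : forall s t, TT s -> TT t -> s <= t ->
    weak_homogeneous P (F s) (Lp P p (F t)) (xbar s t) ;
  ext_projection : forall s t, TT s -> TT t -> s <= t ->
    projection_property P p (F s) (Lp P p (F t)) (xbar s t) ;
  ext_sandwich : sandwich_condition (fun t => Lp P p (F t)) xbar m M ;
  ext_time_consistent : time_consistent (fun t => Lp P p (F t)) xbar }.

End systems.

Section maximal_extension.
Context d (Omega : measurableType d) (R : realType) (P : probability Omega R).
Variables (p : \bar R) (F : R -> set (set Omega)).
Variables (L : R -> set (Omega -> R)).
Variables (x m M : R -> R -> (Omega -> R) -> Omega -> R).
(* The time grid tau 0 <= tau 1 <= ... <= tau K. *)
Variables (K : nat) (tau : nat -> R).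
Implicit Types (i j l : nat) (f X : Omega -> R) (g : nat -> Omega -> R).
Let q := hoelder_conjugate p.

Definition grid : set R := [set t | exists2 k, (k <= K)%N & t = tau k].

Definition DSe (s t : R) : set (Omega -> R) :=
  [set f | [/\ Lp P q (F t) f,
               {ae P, forall w, 0 < f w},
               cond_exp P (F s) (EFin \o f) = cst 1%E %[ae P] &
               forall X, Lp_ge0 P p (F t) X ->
                 {ae P, forall w,
                   ((m s t X w)%:E <= cond_exp P (F s) (EFin \o (f \* X)%R) w
                                   <= (M s t X w)%:E)%E}]].

Definition min_penalty (s t : R) f : Omega -> \bar R :=
  ess_sup_family P [set Y | exists2 X, L t X &
    Y = (fun w => cond_exp P (F s) (EFin \o (f \* X)%R) w - (x s t X w)%:E)%E].

Definition factorization i j f g : Prop :=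
  (forall l, (i <= l < j)%N -> DSe (tau l) (tau l.+1) (g l.+1)) /\
  f = (fun w => \prod_(i <= l < j) g l.+1 w) %[ae P].

Definition Q i j : set (Omega -> R) :=
  [set f | Lp_ge0 P q (F (tau j)) f /\ exists g, factorization i j f g].

(* Penalty of f, factored by g. The factors are determined almost surely by f.
   The conditional expectation of the one-step penalties is taken under the
   probability of density f, i.e. E_f[Y | F_s] = E[f Y | F_s]: this is the
   cocycle rule. Without the weight f the resulting family would in general be
   neither time-consistent nor an extension of x once there are two steps. *)
Definition penalty i j f g : Omega -> \bar R :=
  (fun w => \sum_(i <= l < j)
    cond_exp P (F (tau i))
      (fun w' => (f w')%:E * min_penalty (tau l) (tau l.+1) (g l.+1) w') w)%E.

Definition xhat_idx i j X : Omega -> \bar R :=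
  ess_sup_family P [set Y | exists f g, [/\ Q i j f, factorization i j f g &
    Y = (fun w => cond_exp P (F (tau i)) (EFin \o (f \* X)%R) w
                  - penalty i j f g w)%E]].

Definition grid_index (t : R) : nat :=
  find (fun k => tau k == t) (iota 0 K.+1).

(* The family indexed by the times themselves. *)
Definition xhat (s t : R) X : Omega -> R :=
  if s == t then X else fine \o xhat_idx (grid_index s) (grid_index t) X.

End maximal_extension.

(* Main.v *)
(* One step s < t. For X0 in L_p(F_t) let phi(X0) be the infimum of
   E[x(X') + M(Y) - m(Z)] over X' in L_t and Y, Z >= 0 with Z + X0 <= Y + X'.
   It is convex, and a Hahn-Banach subgradient at X0 is a positive functional
   between E m and E M, hence has a density f in L_q; non-degeneracy and
   locality put f in D^{S,e}, and comparing f with phi on L_t shows that the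
   dual supremum at X0 is attained at f. The dual value extends x and dominates
   every other extension because convexity together with positive homogeneity of
   m and M upgrades the sandwich condition to
   m(Z) + x(X) <= M(Y) + x(X') whenever Z + X <= Y + X'.
   Several steps. Composing the one-step values backwards along the grid gives a
   family whose properties, and whose maximality, follow one step at a time. The
   product of the one-step maximizers is again in L_q (converse of Hoelder,
   since E[f X] <= E[M(X)]), and telescoping E[N_l V_l] along the partial
   products N_l identifies the composition with the essential supremum that
   defines xhat. Lower semicontinuity is read off the attained dual
   representation. *)
Require Import Defs.
From HB Require Import structures.
From mathcomp Require Import all_boot all_order all_algebra.
From mathcomp Require Import all_classical all_reals all_analysis.
From mathcomp Require Import measurable_realfun ess_sup_inf ring lra.

Set Implicit Arguments.
Unset Strict Implicit.
Unset Printing Implicit Defensive.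

Import Order.TTheory GRing.Theory Num.Theory.
Import numFieldNormedType.Exports.

Local Open Scope classical_set_scope.
Local Open Scope ring_scope.

(** * Subgradients of convex functions *)

(** A subgradient is a scalar object, while every requirement on a density is conditional on F_s.
    The passage rests on locality: weak homogeneity of m, M and x turns inequalities between
    expectations, tested on 1_A X for all A in F_s, into conditional ones. Likewise the family
    defining the penalty is directed, because variables of L_t can be pasted along events of F_s;
    this gives E[alpha(f)] <= l(X0) - phi(X0), and equality in weak duality then holds almost surely
    and not only in mean. A density exists only if the functional is countably additive. For p
    finite, a positive functional on L_p is automatically bounded, which suffices; for p = oo,
    regularity of M excludes a purely finitely additive part. Pasting needs s < t, whereas
    consecutive grid points may coincide; such a step is treated apart, with density 1. Penalties
    take values in [0, +oo], so over several steps they are compared through integrals over events.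
    Topology enters only through the continuity of X -> E[h X] for h in L_q. *)

Section subgradient.
Context (R : realType) (V : lmodType R).
Variables (D : set V) (psi : V -> R).
Hypothesis D0 : D 0.
Hypothesis DZ : forall (a : R) u v, D u -> D v -> D (a *: u + v).
Hypothesis psi_convex : forall (a : R) u v, 0 < a < 1 -> D u -> D v ->
  psi (a *: u + (1 - a) *: v) <= a * psi u + (1 - a) * psi v.
Hypothesis psi0 : psi 0 = 0.

(* Graphs of linear functions on subspaces of D dominated by psi; since
   psi 0 = 0, linearity and domination force the graph to be functional. *)
Let dominated (G : set (V * R)) :=
  (forall (k : R) u a v b, G (u, a) -> G (v, b) -> G (k *: u + v, k * a + b)) /\
  (forall u a, G (u, a) -> D u /\ a <= psi u).

Let dominated_scale G k u a : dominated G -> G (0, 0) -> G (u, a) ->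
  G (k *: u, k * a).
Proof. by move=> [GL _] G0 Gu; have := GL k _ _ _ _ Gu G0; rewrite !addr0. Qed.

(** The one-dimensional extension step of Hahn-Banach, for a convex rather than sublinear bound.
    Convexity puts every slope [(a - psi (m - t v)) / t] below every slope
    [(psi (m' + t' v) - a') / t'], and [c] is the supremum of the former. *)
Let separating_value G v : dominated G -> G (0, 0) -> D v ->
  exists c, forall m a t, G (m, a) -> a + t * c <= psi (m + t *: v).
Proof.
move=> dG G0 Dv; have [GL GD] := dG.
have key m a t m' a' t' : 0 < t -> 0 < t' -> G (m, a) -> G (m', a') ->
    (a - psi (m - t *: v)) / t <= (psi (m' + t' *: v) - a') / t'.
  move=> t0 t'0 Gm Gm'.
  have s0 : 0 < t + t' by rewrite addr_gt0.
  have [Dm _] := GD _ _ Gm; have [Dm' _] := GD _ _ Gm'.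
  have Dmt : D (m - t *: v).
    by rewrite addrC -scaleNr; exact: DZ.
  have Dmt' : D (m' + t' *: v) by rewrite addrC; exact: DZ.
  (* The weight for which the multiples of [v] cancel in the convex combination of [m - t v] and
     [m' + t' v]. *)
  pose l := t' / (t + t').
  have l1 : 1 - l = t / (t + t').
    by rewrite /l; field; rewrite gt_eqF.
  have l01 : 0 < l < 1.
    rewrite /l divr_gt0//= ltr_pdivrMr// mul1r; lra.
  have := psi_convex l01 Dmt Dmt'.
  have -> : l *: (m - t *: v) + (1 - l) *: (m' + t' *: v) =
            l *: m + (1 - l) *: m'.
    rewrite scalerBr scalerDr !scalerA addrACA -scaleNr -scalerDl.
    have -> : - (l * t) + (1 - l) * t' = 0.
      by rewrite l1 /l; field; rewrite gt_eqF.
    by rewrite scale0r addr0.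
  have [_] := GD _ _ (GL l _ _ _ _ Gm (dominated_scale (1 - l) dG G0 Gm')).
  move=> h1 h2; have := le_trans h1 h2.
  rewrite l1 /l => h.
  rewrite ler_pdivrMr// mulrAC ler_pdivlMr//.
  have : (t' / (t + t') * a + t / (t + t') * a') * (t + t') <=
    (t' / (t + t') * psi (m - t *: v) + t / (t + t') * psi (m' + t' *: v)) *
      (t + t') by rewrite ler_pM2r.
  have e (x y : R) : (t' / (t + t') * x + t / (t + t') * y) * (t + t') = t' * x + t * y.
    by field; rewrite gt_eqF.
  rewrite !e; lra.
pose S := [set (z.1.2 - psi (z.1.1 - z.2 *: v)) / z.2 | z in
  [set z : V * R * R | 0 < z.2 /\ G z.1]].
have G01 : [set z : V * R * R | 0 < z.2 /\ G z.1] ((0, 0), 1) by split => /=.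
have S0 : S !=set0 by exists ((0 - psi (0 - 1 *: v)) / 1); exists ((0, 0), 1).
have ubS m' a' t' : 0 < t' -> G (m', a') -> ubound S ((psi (m' + t' *: v) - a') / t').
  by move=> t'0 Gm' _ [[[m a] t] /= [t0 Gm] <-]; exact: key.
exists (sup S) => m a t Gm.
have [t0|t0|->] := ltgtP t 0; last first.
- by rewrite mul0r scale0r !addr0; have [] := GD _ _ Gm.
- have : sup S <= (psi (m + t *: v) - a) / t.
    by apply: ge_sup => //; exact: ubS.
  rewrite ler_pdivlMr//; lra.
- have : (a - psi (m - (- t) *: v)) / (- t) <= sup S.
    apply: ub_le_sup; first by eexists; exact: (ubS 0 0 1 ltr01 G0).
    by exists ((m, a), - t) => //=; split => //=; rewrite oppr_gt0.
  rewrite ler_pdivrMr ?oppr_gt0// scaleNr opprK; lra.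
Qed.

Lemma linear_minorant : exists l : V -> R,
  (forall (a : R) u v, D u -> D v -> l (a *: u + v) = a * l u + l v) /\
  (forall v, D v -> l v <= psi v).
Proof.
have [G [dG Gmax]] : exists G, dominated G /\
    forall B, G `<` B -> ~ dominated B.
  apply: (@Zorn_bigcup _ dominated) => F FP Ftot; split.
    move=> k u a v b [X FX Xu] [Y FY Yv].
    have [XY|YX] := Ftot _ _ FX FY.
      by exists Y => //; apply: (FP _ FY).1 => //; exact: XY.
    by exists X => //; apply: (FP _ FX).1 => //; exact: YX.
  by move=> u a [X FX Xu]; exact: (FP _ FX).2.
have [GL GD] := dG.
have G0 : G (0, 0).
  have [[[u a] Gu]|/nonemptyPn G0] := pselect (G !=set0).
    by have := GL (-1) _ _ _ _ Gu Gu; rewrite scaleN1r mulN1r !addNr.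
  (* The empty graph is dominated too, so a maximal graph has to be shown nonempty: otherwise the
     graph of the zero function on {0} would be larger. *)
  exfalso; apply: (Gmax [set (0, 0)]).
    by rewrite G0; split => // /(_ (0, 0)); apply.
  split => [k u a v b [-> ->] [-> ->]|u a [-> ->]].
    by rewrite scaler0 mulr0 !addr0.
  by rewrite psi0.
have Gfun u a b : G (u, a) -> G (u, b) -> a = b.
  move=> Ga Gb.
  have G0ab : G (0, a - b).
    have := GL (-1) _ _ _ _ Gb Ga.
    by rewrite scaleN1r mulN1r addNr addrC.
  have h k : k * (a - b) <= 0.
    have := dominated_scale k dG G0 G0ab; rewrite scaler0 => /GD[_].
    by rewrite psi0.
  apply/eqP; rewrite -subr_eq0 eq_le; have := h 1; have := h (-1); lra.
have Gdom v : D v -> exists a, G (v, a).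
  move=> Dv; apply: contrapT => /forallNP nG.
  have [c hc] := separating_value dG G0 Dv.
  pose B := [set z : V * R | exists u a t, G (u, a) /\ z = (u + t *: v, a + t * c)].
  apply: (Gmax B).
    split => [[u a] Gu|BG].
      by exists u, a, 0; split => //; rewrite scale0r mul0r !addr0.
    apply: (nG c); apply: BG; exists 0, 0, 1.
    by rewrite scale1r mul1r !add0r.
  split => [k _ _ _ _ [u [a [t [Gu [-> ->]]]]] [u' [a' [t' [Gu' [-> ->]]]]]|].
    exists (k *: u + u'), (k * a + a'), (k * t + t'); split; first exact: GL.
    congr (_, _); last by ring.
    by rewrite scalerDr scalerA scalerDl addrACA.
  move=> _ _ [u [a [t [Gu [-> ->]]]]]; split; last exact: hc.
  by rewrite addrC; apply: DZ => //; have [] := GD _ _ Gu.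
have [l Gl] : exists l : V -> R, forall v, D v -> G (v, l v).
  have /choice[l hl] : forall v, exists a, D v -> G (v, a).
    move=> v; have [Dv|nDv] := pselect (D v); last by exists 0.
    by have [a Ga] := Gdom v Dv; exists a.
  by exists l.
exists l; split => [a u v Du Dv|v Dv].
  by apply: (Gfun (a *: u + v)); [apply: Gl; exact: DZ | apply: GL; exact: Gl].
by have [] := GD _ _ (Gl v Dv).
Qed.

End subgradient.

Lemma convex_subgradient (R : realType) (V : lmodType R) (D : set V)
    (phi : V -> R) (x0 : V) :
  D 0 -> (forall (a : R) u v, D u -> D v -> D (a *: u + v)) ->
  (forall (a : R) u v, 0 < a < 1 -> D u -> D v ->
    phi (a *: u + (1 - a) *: v) <= a * phi u + (1 - a) * phi v) ->
  D x0 -> exists l : V -> R,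
  (forall (a : R) u v, D u -> D v -> l (a *: u + v) = a * l u + l v) /\
  (forall v, D v -> l v <= phi (x0 + v) - phi x0).
Proof.
move=> D0 DZ phi_convex Dx0.
have Dadd v : D v -> D (x0 + v).
  by move=> Dv; rewrite -[x0]scale1r; exact: DZ.
apply: (@linear_minorant _ _ D (fun v => phi (x0 + v) - phi x0)) => //.
- move=> a u v a01 Du Dv.
  have -> : x0 + (a *: u + (1 - a) *: v) = a *: (x0 + u) + (1 - a) *: (x0 + v).
    by rewrite !scalerDr addrACA -scalerDl (addrC a) subrK scale1r.
  have := phi_convex a _ _ a01 (Dadd _ Du) (Dadd _ Dv); lra.
- by rewrite addr0 subrr.
Qed.

(** * Sub-sigma-algebras and conditional expectation *)

Section sub_sigma_algebra.
Context d (Omega : measurableType d) (R : realType) (P : probability Omega R).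
Implicit Types (G H : set (set Omega)).

Lemma aeTP (T : Type) (f g : Omega -> T) :
  f = g %[ae P] <-> {ae P, forall w, f w = g w}.
Proof. by split; apply: filterS => w //; apply. Qed.

(** Containing all negligible sets makes measurability for [G] stable under almost sure
    modification, so versions can be exchanged freely. *)
Record subsigma G : Prop := {
  subsigma_sigma_algebra : sigma_algebra [set: Omega] G ;
  subsigma_measurable : G `<=` measurable ;
  subsigma_negligible : forall N, P.-negligible N -> G N }.

Section one.
Variable G : set (set Omega).
Hypothesis sG : subsigma G.

Lemma gmeasurableE : G.-sigma.-measurable = G.
Proof. by rewrite measurable_g_measurableTypeE//; case: sG. Qed.

Lemma gmeasurableP A : G.-sigma.-measurable A <-> G A.
Proof. by rewrite gmeasurableE. Qed.

Lemma gsetT : G setT.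
Proof. by rewrite -gmeasurableE; exact: measurableT. Qed.

Lemma gset0 : G set0.
Proof. by rewrite -gmeasurableE; exact: measurable0. Qed.

Lemma gsetC A : G A -> G (~` A).
Proof. by rewrite -gmeasurableE; exact: measurableC. Qed.

Lemma gsetI A B : G A -> G B -> G (A `&` B).
Proof. by rewrite -gmeasurableE; exact: measurableI. Qed.

Lemma gsetU A B : G A -> G B -> G (A `|` B).
Proof. by rewrite -gmeasurableE; exact: measurableU. Qed.

Lemma gsetD A B : G A -> G B -> G (A `\` B).
Proof. by rewrite -gmeasurableE; exact: measurableD. Qed.

Lemma gsetM A : G A -> measurable A.
Proof. exact: (subsigma_measurable sG). Qed.

Lemma gfun_preimage d' (T : measurableType d') (f : Omega -> T) B :
  measurable_fun [set: g_sigma_algebraType G] f -> measurable B -> G (f @^-1` B).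
Proof.
move=> mf mB; rewrite -gmeasurableE -[X in _ X]setTI.
exact: (mf measurableT).
Qed.

Lemma gfun_measurable d' (T : measurableType d') (f : Omega -> T) :
  measurable_fun [set: g_sigma_algebraType G] f -> measurable_fun [set: Omega] f.
Proof.
by move=> mf _ B mB; rewrite setTI; apply: gsetM; exact: gfun_preimage.
Qed.

Lemma gfun_ae d' (T : measurableType d') (f g : Omega -> T) :
  {ae P, forall w, f w = g w} ->
  measurable_fun [set: g_sigma_algebraType G] f ->
  measurable_fun [set: g_sigma_algebraType G] g.
Proof.
move=> fg mf _ B mB; rewrite setTI gmeasurableE.
pose N := [set w | f w <> g w].
have nN : P.-negligible N by exact: fg.
have -> : g @^-1` B = (f @^-1` B `\` N) `|` (g @^-1` B `&` N).
  apply/seteqP; split => w.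
    by move=> gB; have [fgw|] := pselect (f w = g w); [left; split => //; rewrite /= fgw|right].
  move=> [[/= fB]|[]//]; rewrite /N /=.
  by move/contrapT => <-.
apply: gsetU; first apply: gsetD.
- exact: gfun_preimage.
- exact: subsigma_negligible.
- by apply: subsigma_negligible => //; apply: negligibleS nN => w [].
Qed.

Lemma gid_measurable : measurable_fun [set: Omega] (idfun : Omega -> g_sigma_algebraType G).
Proof. by move=> _ B; rewrite gmeasurableE setTI => /gsetM. Qed.

Lemma gindic A : G A -> measurable_fun [set: g_sigma_algebraType G] (\1_A : Omega -> R).
Proof. by move=> GA; apply: measurable_indic; rewrite gmeasurableE. Qed.

(** The Radon-Nikodym theorem on the measurable space carried by [G], with [P] restricted to it as
    its image under the identity map; change of variables brings the density back to [Omega].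
    Additivity of [nu] is asked only on [G]. *)
Lemma radon_nikodym_sub (nu : set Omega -> \bar R) :
  (forall A, 0 <= nu A)%E -> nu set0 = 0%E ->
  (forall F : (set Omega)^nat, (forall n, G (F n)) -> trivIset setT F ->
    (fun n => \sum_(0 <= i < n) nu (F i))%E @ \oo --> nu (\bigcup_n F n)) ->
  (nu setT < +oo)%E -> (forall A, G A -> P A = 0%E -> nu A = 0%E) ->
  exists f : Omega -> R, [/\ measurable_fun [set: g_sigma_algebraType G] f,
    forall w, 0 <= f w, P.-integrable setT (EFin \o f) &
    forall A, G A -> nu A = (\int[P]_(w in A) (f w)%:E)%E].
Proof.
move=> nu0 nuset0 nuadd nufin nuP.
pose T := g_sigma_algebraType G.
have nuadd' : semi_sigma_additive (nu : set T -> \bar R).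
  by move=> F mF tF _; apply: nuadd => // n; have := mF n; rewrite gmeasurableE.
pose Nu : {measure set T -> \bar R} := HB.pack (nu : set T -> \bar R)
  (isMeasure.Build _ _ _ (nu : set T -> \bar R) nuset0 nu0 nuadd').
have Nufin : fin_num_fun (nu : set T -> \bar R).
  move=> A mA; rewrite ge0_fin_numE//.
  apply: le_lt_trans nufin; apply: (@le_measure _ _ _ Nu); rewrite ?inE;
    [exact: mA|exact: measurableT|exact: subsetT].
pose Nu' : {finite_measure set T -> \bar R} := HB.pack (Measure.sort Nu)
  (Measure_isFinite.Build _ _ _ (Measure.sort Nu) Nufin).
pose phi : {mfun Omega >-> T} := HB.pack (idfun : Omega -> T)
  (isMeasurableFun.Build _ _ _ _ _ gid_measurable).
pose Q0' : {measure set T -> \bar R} := pushforward P phi.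
pose Q0 := Q0' gid_measurable.
have Q0fin : fin_num_fun (pushforward P phi : set T -> \bar R).
  by move=> A mA; apply: fin_num_measure; apply: gsetM; apply/gmeasurableP.
pose Q : {finite_measure set T -> \bar R} := HB.pack (Measure.sort Q0)
  (Measure_isFinite.Build _ _ _ (Measure.sort Q0) Q0fin).
have dom : (Nu' : set T -> \bar R) `<< (Q : set T -> \bar R).
  apply/null_content_dominatesP => A mA QA0; apply: nuP => //.
  exact/gmeasurableP.
have [f [f0 ffin fi fE]] := radon_nikodym_sigma_finite dom.
have mf : measurable_fun [set: T] f by exact: (measurable_int Q).
have pE A : G A -> (\int[Q]_(w in A) f w = \int[P]_(w in A) f w)%E.
  move=> GA; rewrite (ge0_integral_pushforward gid_measurable) //.
    exact/gmeasurableP.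
  exact: measurable_funTS.
exists (fine \o f); split.
- exact: measurableT_comp.
- by move=> w; rewrite /= fine_ge0.
- rewrite (_ : _ \o _ = f); last by apply/funext => w; rewrite /= fineK.
  have mfO := gfun_measurable mf.
  apply/integrableP; split => //.
  under eq_integral do rewrite gee0_abs//.
  by rewrite -pE -?fE//; exact: gsetT.
- move=> A GA; under eq_integral do rewrite /= fineK//.
  by rewrite -pE// -fE//; exact/gmeasurableP.
Qed.
End one.
End sub_sigma_algebra.

(** * Integrals with weights measurable for a sub-sigma-algebra *)

Section weighted.
Context d (Omega : measurableType d) (R : realType) (P : probability Omega R).
Variable G : set (set Omega).
Hypothesis sG : subsigma P G.
Import HBNNSimple.

Let nnsfun_weighted (g : {nnsfun (g_sigma_algebraType G) >-> R}) (U : Omega -> R) :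
  measurable_fun setT U -> (forall w, 0 <= U w) ->
  (\int[P]_w ((g w)%:E * (U w)%:E) =
   \sum_(y \in range g) (y%:E * \int[P]_(w in g @^-1` [set y]) (U w)%:E))%E.
Proof.
move=> mU U0.
have mg y : measurable ((g : Omega -> R) @^-1` [set y]).
  by apply: (gsetM sG); apply/(gmeasurableP sG); exact: measurable_funPTI.
under eq_integral => w _.
  rewrite fimfunE -fsumEFin// ge0_mule_fsuml; last first.
    by move=> y; rewrite nnfun_muleindic_ge0.
  over.
rewrite ge0_integral_fsum//; last 2 first.
- move=> y; apply: emeasurable_funM; last exact/measurable_EFinP.
  by apply/measurable_EFinP/measurable_funM => //.
- by move=> y w _; rewrite mule_ge0 ?lee_fin// -lee_fin nnfun_muleindic_ge0.
apply: eq_fsbigr => y; rewrite inE => -[w0 _ <-].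
under eq_integral => w _ do rewrite EFinM -muleA.
rewrite ge0_integralZl//=.
- congr (_ * _)%E; rewrite [RHS]integral_mkcond; apply: eq_integral => w _.
  rewrite /patch indicE; case: ifP; rewrite ?mul1e ?mul0e//.
- apply: emeasurable_funM; last exact/measurable_EFinP.
  exact/measurable_EFinP/measurable_indic.
- by move=> w _; rewrite mule_ge0 ?lee_fin.
- by rewrite lee_fin.
Qed.

(** The level sets of the simple functions approximating [N] belong to [G], so the hypothesis
    applies to each of them; monotone convergence concludes. No pointwise comparison of [U] and [V]
    is available. *)
Lemma ge0_weighted_le (U V : Omega -> R) (N : Omega -> \bar R) :
  measurable_fun setT U -> measurable_fun setT V ->
  (forall w, 0 <= U w) -> (forall w, 0 <= V w) ->
  (forall A, G A -> (\int[P]_(w in A) (U w)%:E <= \int[P]_(w in A) (V w)%:E)%E) ->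
  measurable_fun [set: g_sigma_algebraType G] N -> (forall w, 0 <= N w)%E ->
  (\int[P]_w (N w * (U w)%:E) <= \int[P]_w (N w * (V w)%:E))%E.
Proof.
move=> mU mV U0 V0 UV mN N0.
pose g := nnsfun_approx (@measurableT _ (g_sigma_algebraType G)) mN.
have mg n : measurable_fun setT (fun w : Omega => g n w : R).
  exact: (gfun_measurable sG).
have lim (W : Omega -> R) : measurable_fun setT W -> (forall w, 0 <= W w) ->
  (\int[P]_w ((g n w)%:E * (W w)%:E) @[n --> \oo] --> \int[P]_w (N w * (W w)%:E))%E.
  move=> mW W0.
  have gN w : ((g n w)%:E * (W w)%:E @[n --> \oo] --> N w * (W w)%:E)%E.
    apply: cvgeZr => //; have h := @cvg_nnsfun_approx _ _ _ _ _ _ mN (fun w _ => N0 w) w Logic.I. exact: h.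
  rewrite (_ : (fun w => N w * (W w)%:E)%E = fun w => limn (fun n => (g n w)%:E * (W w)%:E)%E); last first.
    by apply/funext => w; apply/esym/cvg_lim => //; exact: gN.
  apply: (@cvg_monotone_convergence _ _ _ P setT measurableT (fun n w => ((g n w)%:E * (W w)%:E)%E)) => //.
  - by move=> n; apply: emeasurable_funM; exact/measurable_EFinP.
  - by move=> n w _; rewrite mule_ge0// lee_fin.
  - move=> w _ m n mn; apply: lee_wpmul2r; rewrite lee_fin//.
    by have /lefP := nd_nnsfun_approx (@measurableT _ (g_sigma_algebraType G)) mN mn; exact.
apply: (lee_cvg_to (lim _ mU U0) (lim _ mV V0)).
apply: nearW => n; rewrite !nnsfun_weighted//.
apply: lee_fsum => // _ [w0 _ <-]; apply: lee_wpmul2l; first by rewrite lee_fin.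
by apply: UV; apply/(gmeasurableP sG); exact: measurable_funPTI.
Qed.

Lemma ge0_weighted_eq (U V : Omega -> R) (N : Omega -> \bar R) :
  measurable_fun setT U -> measurable_fun setT V ->
  (forall w, 0 <= U w) -> (forall w, 0 <= V w) ->
  (forall A, G A -> (\int[P]_(w in A) (U w)%:E = \int[P]_(w in A) (V w)%:E)%E) ->
  measurable_fun [set: g_sigma_algebraType G] N -> (forall w, 0 <= N w)%E ->
  (\int[P]_w (N w * (U w)%:E) = \int[P]_w (N w * (V w)%:E))%E.
Proof.
move=> mU mV U0 V0 UV mN N0.
by apply/eqP; rewrite eq_le; apply/andP; split;
  apply: ge0_weighted_le => // A GA; rewrite UV.
Qed.

(* On the sets [V < U, V <= n] of G, the inequality forces U = V. *)
Lemma ge0_ae_le_integral (U V : Omega -> \bar R) :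
  measurable_fun [set: g_sigma_algebraType G] U ->
  measurable_fun [set: g_sigma_algebraType G] V ->
  (forall w, 0 <= U w)%E -> (forall w, 0 <= V w)%E ->
  (forall A, G A -> \int[P]_(w in A) U w <= \int[P]_(w in A) V w)%E ->
  {ae P, forall w, U w <= V w}%E.
Proof.
move=> mU mV U0 V0 UV.
have mU' := gfun_measurable sG mU; have mV' := gfun_measurable sG mV.
pose A n := [set w | V w < U w]%E `&` [set w | V w <= n%:R%:E]%E.
have GA n : G (A n).
  apply/(gmeasurableP sG)/measurableI; rewrite -[X in measurable X]setTI.
    by apply: emeasurable_fun_lt.
  by apply: emeasurable_fun_le.
have A0 n : P (A n) = 0%E.
  have mA := gsetM sG (GA n).
  have mVA := measurable_funS measurableT (@subsetT _ (A n)) mV'.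
  have mUA := measurable_funS measurableT (@subsetT _ (A n)) mU'.
  have iV : P.-integrable (A n) V.
    apply/integrableP; split => //; under eq_integral do rewrite gee0_abs//.
    apply: (@le_lt_trans _ _ (\int[P]_(w in A n) n%:R%:E)%E).
      by apply: ge0_le_integral => // w [].
    rewrite integral_cst//= ltey_eq; apply/orP; left.
    by rewrite fin_numM// fin_num_measure.
  have VU w : A n w -> (V w + (U w - V w) = U w)%E.
    move=> [_ /= Vn]; have Vf : V w \is a fin_num.
      by rewrite ge0_fin_numE//; exact: le_lt_trans Vn (ltry _).
    by rewrite addeC subeK.
  have W0 w : A n w -> (0 <= U w - V w)%E.
    by move=> Aw; have [/= h _] := Aw; rewrite leeBrDr ?add0e ?ltW// ge0_fin_numE//; exact: lt_le_trans h (leey _).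
  have := UV _ (GA n).
  rewrite -(eq_integral _ _ (fun w wA => VU w (set_mem wA))).
  have mW : measurable_fun (A n) (fun w => U w - V w)%E by exact: emeasurable_funB.
  rewrite ge0_integralD//.
  have fV : (\int[P]_(w in A n) V w)%E \is a fin_num by exact: integrable_fin_num.
  rewrite -[leRHS]adde0 leeD2lE// => W_le0.
  have W00 : (\int[P]_(w in A n) `|U w - V w|)%E = 0%E.
    apply/eqP; rewrite eq_le integral_ge0// andbT; apply: le_trans W_le0.
    by apply: ge0_le_integral => //; [exact: measurableT_comp|move=> w Aw; rewrite gee0_abs// W0].
  have [N [mN N0 sub]] := (ae_eq_integral_abs P mA mW).1 W00.
  apply: (subset_measure0 mA mN _ N0) => w Aw; apply: sub => /= /(_ Aw) h.
  by have := VU _ Aw; rewrite h adde0 => e; have [/=] := Aw; rewrite e ltxx.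
apply: (@negligibleS _ _ _ _ (\bigcup_n A n)); last first.
  apply: negligible_bigcup => n; apply/negligibleP; [exact: (gsetM sG)|exact: A0].
move=> w /= /negP; rewrite -ltNge => VUw.
have Vf : V w \is a fin_num.
  by rewrite ge0_fin_numE//; exact: lt_le_trans VUw (leey _).
have [n Vn] : exists n : nat, fine (V w) <= n%:R.
  by exists (Num.truncn (fine (V w))).+1; exact/ltW/truncnS_gt.
by exists n => //; split => //=; rewrite -(fineK Vf) lee_fin.
Qed.
End weighted.

(** * Real-valued integrals and conditional expectations of integrable variables *)

Section real_integrals.
Context d (Omega : measurableType d) (R : realType) (P : probability Omega R).
Implicit Types (f g h : Omega -> R) (A B : set Omega).

Definition itg f := P.-integrable setT (EFin \o f).

Lemma itg_measurable f : itg f -> measurable_fun setT f.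
Proof. by move=> /measurable_int/measurable_EFinP. Qed.

Lemma itgS A f : measurable A -> itg f -> P.-integrable A (EFin \o f).
Proof. by move=> mA; exact: integrableS. Qed.

Lemma itg_ae_le f g : measurable_fun setT g ->
  {ae P, forall w, `|g w| <= f w} -> itg f -> itg g.
Proof.
move=> mg gf fi; have mf := itg_measurable fi.
apply/integrableP; split; first exact/measurable_EFinP.
case/integrableP: fi => _; apply: le_lt_trans.
apply: ae_ge0_le_integral => //.
- by apply: measurableT_comp => //; exact/measurable_EFinP.
- by apply: measurableT_comp => //; exact/measurable_EFinP.
by apply: filterS gf => w h _ /=; rewrite lee_fin (le_trans h)// ler_norm.
Qed.

Lemma itg_ae_eq f g : measurable_fun setT g ->
  {ae P, forall w, f w = g w} -> itg f -> itg g.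
Proof.
move=> mg fg fi; apply: (@itg_ae_le (fun w => `|f w|)) => //.
  by apply: filterS fg => w ->.
by have := integrable_abse fi.
Qed.

Lemma itgD f g : itg f -> itg g -> itg (fun w => f w + g w).
Proof. by move=> fi gi; have := integrableD measurableT fi gi. Qed.

Lemma itgN f : itg f -> itg (fun w => - f w).
Proof. by move=> fi; have := integrableN fi. Qed.

Lemma itgB f g : itg f -> itg g -> itg (fun w => f w - g w).
Proof. by move=> fi gi; apply: itgD => //; exact: itgN. Qed.

Lemma itgZ c f : itg f -> itg (fun w => c * f w).
Proof. by move=> fi; have := integrableZl measurableT c fi. Qed.

Lemma itg_cst c : itg (cst c).
Proof. exact: finite_measure_integrable_cst. Qed.

Lemma itg_norm f : itg f -> itg (fun w => `|f w|).
Proof. by move=> fi; have := integrable_abse fi. Qed.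

Lemma itg_indicM A f : measurable A -> itg f -> itg (\1_A \* f).
Proof.
move=> mA fi; apply: (@itg_ae_le (fun w => `|f w|)); last exact: itg_norm.
  by apply: measurable_funM; [exact: measurable_indic|exact: itg_measurable].
apply: aeW => w; rewrite /= normrM indicE.
by case: (_ \in _); rewrite ?normr1 ?mul1r// normr0 mul0r.
Qed.

Lemma itg_indic A : measurable A -> itg \1_A.
Proof.
move=> mA; have := itg_indicM mA (itg_cst 1).
by congr (integrable _ _ _); apply/funext => w /=; rewrite mulr1.
Qed.

Lemma itg_max f g : itg f -> itg g -> itg (fun w => Num.max (f w) (g w)).
Proof.
move=> fi gi; apply: (@itg_ae_le (fun w => `|f w| + `|g w|)).
- by apply: measurable_maxr; exact: itg_measurable.
- apply: aeW => w; rewrite /Num.max; by case: ifP => _; rewrite ?lerDr ?lerDl.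
- by apply: itgD; exact: itg_norm.
Qed.

(** E[1_A f] as a real number, so that linear arithmetic applies. Meaningful for integrable [f]
    only: an infinite integral is sent to 0. *)
Definition Eon A f : R := (\int[P]_(w in A) f w)%R.

Lemma EonE A f : measurable A -> itg f ->
  (Eon A f)%:E = (\int[P]_(w in A) (f w)%:E)%E.
Proof.
move=> mA fi; rewrite /Eon /Rintegral fineK//.
by apply: integrable_fin_num => //; exact: itgS.
Qed.

Lemma EonD A f g : measurable A -> itg f -> itg g ->
  Eon A (fun w => f w + g w) = Eon A f + Eon A g.
Proof. by move=> mA fi gi; apply: RintegralD => //; exact: itgS. Qed.

Lemma EonB A f g : measurable A -> itg f -> itg g ->
  Eon A (fun w => f w - g w) = Eon A f - Eon A g.
Proof. by move=> mA fi gi; apply: RintegralB => //; exact: itgS. Qed.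

Lemma EonZ A c f : measurable A -> itg f ->
  Eon A (fun w => c * f w) = c * Eon A f.
Proof. by move=> mA fi; apply: RintegralZl => //; exact: itgS. Qed.

Lemma EonN A f : measurable A -> itg f ->
  Eon A (fun w => - f w) = - Eon A f.
Proof.
move=> mA fi; rewrite -mulN1r -EonZ//; apply: eq_Rintegral => w _.
by rewrite mulN1r.
Qed.

Lemma Eon_ge0 A f : measurable A -> measurable_fun setT f ->
  {ae P, forall w, 0 <= f w} -> 0 <= Eon A f.
Proof.
move=> mA mf f0; rewrite /Eon /Rintegral.
rewrite (@ae_eq_integral _ _ _ P A (fun w => `|f w|%:E)%E)//.
- by apply: fine_ge0; apply: integral_ge0 => w _; rewrite lee_fin.
- by apply: measurable_funTS; exact/measurable_EFinP.
- by apply: measurable_funTS; apply/measurable_EFinP/measurableT_comp.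
by apply: filterS f0 => w f0 _; rewrite ger0_norm.
Qed.

Lemma Eon_ae_le A f g : measurable A -> itg f -> itg g ->
  {ae P, forall w, f w <= g w} -> Eon A f <= Eon A g.
Proof.
move=> mA fi gi fg; rewrite -subr_ge0 -EonB//; apply: Eon_ge0 => //.
  by apply: itg_measurable; exact: itgB.
by apply: filterS fg => w; rewrite subr_ge0.
Qed.

Lemma Eon_ae_eq A f g : measurable A -> measurable_fun setT f ->
  measurable_fun setT g -> {ae P, forall w, f w = g w} -> Eon A f = Eon A g.
Proof.
move=> mA mf mg fg; rewrite /Eon /Rintegral; congr fine.
apply: ae_eq_integral => //.
- by apply: measurable_funTS; exact/measurable_EFinP.
- by apply: measurable_funTS; exact/measurable_EFinP.
by apply: filterS fg => w -> .
Qed.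

Lemma Eon_indic A B f : Eon B (\1_A \* f) = Eon (B `&` A) f.
Proof.
rewrite /Eon Rintegral_mkcondr; apply: eq_Rintegral => w _.
by rewrite /patch /= indicE; case: ifP; rewrite ?mul1r ?mul0r.
Qed.

Lemma EonT_indic A f : Eon setT (\1_A \* f) = Eon A f.
Proof. by rewrite Eon_indic setTI. Qed.

Lemma Eon_cst A c : measurable A -> Eon A (cst c) = c * fine (P A).
Proof. by move=> mA; rewrite /Eon Rintegral_cst. Qed.

Lemma Eon_setC A f : measurable A -> itg f ->
  Eon A f + Eon (~` A) f = Eon setT f.
Proof.
move=> mA fi; rewrite -(setUv A) /Eon Rintegral_setU//.
- exact: measurableC.
- by rewrite setUv.
- by apply/disj_setPS => w [].
Qed.

Lemma Eon_setUI A B f : measurable A -> measurable B -> itg f ->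
  Eon A f = Eon (A `&` B) f + Eon (A `&` ~` B) f.
Proof.
move=> mA mB fi.
rewrite -{1}(setIT A) -(setUv B) setIUr /Eon Rintegral_setU//.
- exact: measurableI.
- by apply: measurableI => //; exact: measurableC.
- apply: itgS => //; apply: measurableU; apply: measurableI => //.
  exact: measurableC.
- by apply/disj_setPS => w [[_ Bw] [_]].
Qed.

Lemma Eon_le0_ae_le0 A f : measurable A -> itg f -> (forall w, A w -> 0 <= f w) ->
  Eon A f <= 0 -> {ae P, forall w, A w -> f w = 0}.
Proof.
move=> mA fi f0 Ef.
have mf : measurable_fun A (EFin \o f).
  by apply: measurable_funTS; apply/measurable_EFinP; exact: itg_measurable.
have : (\int[P]_(w in A) `|(EFin \o f) w| = 0)%E.
  rewrite (eq_integral (EFin \o f)); last first.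
    by move=> w /set_mem Aw; rewrite gee0_abs// lee_fin f0.
  rewrite -[LHS]EonE//; congr EFin; apply/eqP; rewrite eq_le Ef.
  by apply: Rintegral_ge0.
move/(ae_eq_integral_abs P mA mf).1; apply: filterS => w h Aw.
by have [] := h Aw.
Qed.

Lemma integral_ae_abs A (W : Omega -> \bar R) : measurable A ->
  measurable_fun setT W -> {ae P, forall w, 0 <= W w}%E ->
  (\int[P]_(w in A) `|W w| = \int[P]_(w in A) W w)%E.
Proof.
move=> mA mW W0; apply: ae_eq_integral => //.
- by apply: measurable_funTS; exact: measurableT_comp.
- exact: measurable_funTS.
- by apply: filterS W0 => w h _; rewrite gee0_abs.
Qed.

Lemma integrable_fine (Z : Omega -> \bar R) : P.-integrable setT Z ->
  itg (fine \o Z) /\ {ae P, forall w, Z w = (fine (Z w))%:E}.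
Proof.
move=> Zi; have mZ := measurable_int P Zi.
have Zfin : {ae P, forall w, Z w = (fine (Z w))%:E}.
  have := integrable_ae measurableT Zi; apply: filterS => w /(_ Logic.I).
  by move=> /fineK.
have mf : measurable_fun setT (fine \o Z) by exact: measurableT_comp.
split => //; apply/integrableP; split; first exact/measurable_EFinP.
case/integrableP: Zi => _; apply: le_lt_trans; apply: ae_ge0_le_integral => //.
- by apply: measurableT_comp => //; exact/measurable_EFinP.
- exact: measurableT_comp.
by apply: filterS Zfin => w e _ /=; rewrite {2}e.
Qed.

(** Dominated convergence with bound |g|. It serves for shrinking events and for events on which an
    almost surely convergent sequence is still far from its limit. *)
Lemma Eon_vanish (A : nat -> set Omega) g : itg g -> (forall n, measurable (A n)) ->
  {ae P, forall w, \forall n \near \oo, ~ A n w} -> Eon (A n) g @[n --> \oo] --> 0.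
Proof.
move=> gi mA A0; have mg := itg_measurable gi.
have [] := @dominated_convergence _ _ _ P setT measurableT
  (fun n w => (\1_(A n) w * g w)%:E) (cst 0%E) (fun w => `|(g w)%:E|%E).
- by move=> n; apply/measurable_EFinP/measurable_funM => //; exact: measurable_indic.
- exact: measurable_cst.
- apply: filterS A0 => w Aw _; apply: cvg_near_cst.
  by apply: filterS Aw => n Anw; rewrite indicE memNset ?mul0r.
- by have := integrable_abse gi.
- apply: aeW => w n _; rewrite lee_fin normrM indicE.
  by case: (_ \in _); rewrite ?normr1 ?mul1r// normr0 mul0r.
move=> _ _; rewrite integral0 => h.
have -> : (fun n => Eon (A n) g) = fun n => fine (\int[P]_w (\1_(A n) w * g w)%:E)%E.
  by apply/funext => n; rewrite -EonT_indic.
exact: fine_cvg.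
Qed.

Section sub.
Variable G : set (set Omega).
Hypothesis sG : subsigma P G.

Notation gmf := (measurable_fun [set: g_sigma_algebraType G]).

(** The event where [g < f] belongs to [G] and is itself the test event. *)
Lemma ae_le_Eon f g : gmf f -> gmf g -> itg f -> itg g ->
  (forall A, G A -> Eon A f <= Eon A g) -> {ae P, forall w, f w <= g w}.
Proof.
move=> mf mg fi gi fg.
pose A := [set w | g w < f w].
have GA : G A.
  apply/(gmeasurableP sG); rewrite -[X in measurable X]setTI.
  exact: measurable_fun_ltr.
have mA := gsetM sG GA.
have h : Eon A (fun w => f w - g w) <= 0 by rewrite EonB// subr_le0; exact: fg.
have := @Eon_le0_ae_le0 A (fun w => f w - g w) mA (itgB fi gi) _ h.
have h0 w : A w -> 0 <= f w - g w by move=> /ltW; rewrite subr_ge0.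
move=> /(_ h0); apply: filterS => w; rewrite leNgt => hA; apply/negP => gf.
by have := hA gf => /eqP; rewrite subr_eq0 => /eqP e; rewrite e ltxx in gf.
Qed.

Lemma ae_le_Eon_on B f g : G B -> gmf f -> gmf g -> itg f -> itg g ->
  (forall A, G A -> A `<=` B -> Eon A f <= Eon A g) ->
  {ae P, forall w, B w -> f w <= g w}.
Proof.
move=> GB mf mg fi gi fg; have mB := gsetM sG GB.
have : {ae P, forall w, (\1_B \* f) w <= (\1_B \* g) w}.
  apply: ae_le_Eon.
  - by apply: measurable_funM => //; exact: (gindic sG).
  - by apply: measurable_funM => //; exact: (gindic sG).
  - exact: itg_indicM.
  - exact: itg_indicM.
  by move=> A GA; rewrite !Eon_indic; apply: fg; [exact: (gsetI sG)|exact: subIsetr].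
by apply: filterS => w /= + Bw; rewrite indicE mem_set// !mul1r.
Qed.

Lemma ae_eq_Eon f g : gmf f -> gmf g -> itg f -> itg g ->
  (forall A, G A -> Eon A f = Eon A g) -> {ae P, forall w, f w = g w}.
Proof.
move=> mf mg fi gi fg.
have h1 : {ae P, forall w, f w <= g w} by apply: ae_le_Eon => // A GA; rewrite fg.
have h2 : {ae P, forall w, g w <= f w} by apply: ae_le_Eon => // A GA; rewrite fg.
by apply: filterS2 h1 h2 => w a b; apply/eqP; rewrite eq_le a b.
Qed.

Lemma ge0_rce_exists f : itg f -> (forall w, 0 <= f w) -> exists Z : Omega -> R,
  [/\ gmf Z, itg Z, forall w, 0 <= Z w & forall A, G A -> Eon A Z = Eon A f].
Proof.
move=> fi f0.
have mf : measurable_fun setT (EFin \o f) by exact: (measurable_int P).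
have [|||||Z [mZ Z0 Zi ZE]] := @radon_nikodym_sub _ _ _ P G sG
  (fun A => \int[P]_(w in A) (f w)%:E)%E.
- by move=> A; apply: integral_ge0 => w _; rewrite lee_fin.
- exact: integral_set0.
- move=> F GF tF; rewrite ge0_integral_bigcup//.
  + by apply: is_cvg_ereal_nneg_natsum => n _; apply: integral_ge0 => w _; rewrite lee_fin.
  + by move=> k; exact: (gsetM sG).
  + exact: measurable_funTS.
  + by move=> w _; rewrite lee_fin.
- by rewrite -[ltLHS]EonE// ltry.
- move=> A GA PA; apply: null_set_integral => //; first exact: (gsetM sG).
  exact: measurable_funTS.
exists Z; split => // A GA; apply/eqP; rewrite -eqe; apply/eqP.
by rewrite !EonE ?ZE//; exact: (gsetM sG).
Qed.

Lemma rce_exists f : itg f -> exists Z : Omega -> R,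
  [/\ gmf Z, itg Z & forall A, G A -> Eon A Z = Eon A f].
Proof.
move=> fi.
have pi : itg (f^\+)%R.
  by have := integrable_funrpos measurableT fi.
have ni : itg (f^\-)%R.
  by have := integrable_funrneg measurableT fi.
have [Zp [mp ip _ Ep]] := ge0_rce_exists pi (@funrpos_ge0 _ _ _).
have [Zn [mn in_ _ En]] := ge0_rce_exists ni (@funrneg_ge0 _ _ _).
exists (fun w => Zp w - Zn w); split.
- exact: measurable_funB.
- exact: itgB.
- move=> A GA; have mA := gsetM sG GA.
  rewrite EonB// Ep// En// -EonB//; apply: eq_Rintegral => w _.
  by rewrite -[in RHS](funrposBneg f).
Qed.

(** A finite-valued representative of the conditional expectation, which keeps the computations in
    the reals. For integrable [f] it differs from [cond_exp] on a null set only. *)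
Definition rce f := fine \o cond_exp P G (EFin \o f).

Let is_cond_exp_fin f (Z : Omega -> \bar R) : itg f ->
  is_cond_exp P G (EFin \o f) Z -> [/\ gmf (fine \o Z), itg (fine \o Z),
    forall A, G A -> Eon A (fine \o Z) = Eon A f &
    {ae P, forall w, Z w = (fine (Z w))%:E}].
Proof.
move=> fi [mZ ZE].
have mZ' := gfun_measurable sG mZ.
have Zi : P.-integrable setT Z.
  apply/integrableP; split => //; apply/abse_integralP => //.
  rewrite ZE; last by exact: (gsetT sG).
  by rewrite -[X in `|X|%E]EonE//= ltry.
have [fZi Zfin] := integrable_fine Zi.
have mfZ : gmf (fine \o Z) by exact: measurableT_comp.
split => // A GA; have mA := gsetM sG GA.
apply/eqP; rewrite -eqe; apply/eqP; rewrite !EonE// -[RHS]ZE//.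
apply: ae_eq_integral => //.
- by apply: measurable_funTS; exact: (measurable_int P fZi).
- exact: measurable_funTS.
by apply: filterS Zfin => w -> _.
Qed.

Lemma rceP f : itg f -> [/\ gmf (rce f), itg (rce f),
    forall A, G A -> Eon A (rce f) = Eon A f &
    {ae P, forall w, cond_exp P G (EFin \o f) w = (rce f w)%:E}].
Proof.
move=> fi; apply: is_cond_exp_fin => //; rewrite /cond_exp.
have [Z [mZ Zi ZE]] := rce_exists fi.
apply: (@xgetPex _ _ [set Z | is_cond_exp P G (EFin \o f) Z]).
exists (EFin \o Z); split; first exact/measurable_EFinP.
by move=> A GA; have mA := gsetM sG GA; rewrite -[LHS]EonE// ZE// EonE.
Qed.

Lemma rce_measurable f : itg f -> gmf (rce f). Proof. by case/rceP. Qed.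
Lemma rce_itg f : itg f -> itg (rce f). Proof. by case/rceP. Qed.
Lemma rceE f A : itg f -> G A -> Eon A (rce f) = Eon A f.
Proof. by case/rceP => _ _ h _; exact: h. Qed.
Lemma cond_exp_rce f : itg f ->
  {ae P, forall w, cond_exp P G (EFin \o f) w = (rce f w)%:E}.
Proof. by case/rceP. Qed.

Lemma rce_le f g : itg f -> itg g -> gmf g ->
  (forall A, G A -> Eon A f <= Eon A g) -> {ae P, forall w, rce f w <= g w}.
Proof.
move=> fi gi mg fg; apply: ae_le_Eon => //; [exact: rce_measurable|exact: rce_itg|].
by move=> A GA; rewrite rceE//; exact: fg.
Qed.

Lemma rce_ge f g : itg f -> itg g -> gmf g ->
  (forall A, G A -> Eon A g <= Eon A f) -> {ae P, forall w, g w <= rce f w}.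
Proof.
move=> fi gi mg fg; apply: ae_le_Eon => //; [exact: rce_measurable|exact: rce_itg|].
by move=> A GA; rewrite rceE//; exact: fg.
Qed.

Lemma rce_unique f g : itg f -> itg g -> gmf g ->
  (forall A, G A -> Eon A f = Eon A g) -> {ae P, forall w, rce f w = g w}.
Proof.
move=> fi gi mg fg; apply: ae_eq_Eon => //; [exact: rce_measurable|exact: rce_itg|].
by move=> A GA; rewrite rceE//; exact: fg.
Qed.

Lemma rce_id f : itg f -> gmf f -> {ae P, forall w, rce f w = f w}.
Proof. by move=> fi mf; exact: rce_unique. Qed.

Lemma rce_ae_le f g : itg f -> itg g -> {ae P, forall w, f w <= g w} ->
  {ae P, forall w, rce f w <= rce g w}.
Proof.
move=> fi gi fg; apply: rce_le => //; [exact: rce_itg|exact: rce_measurable|].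
by move=> A GA; rewrite rceE//; apply: Eon_ae_le => //; exact: (gsetM sG).
Qed.

Lemma rce_ae_eq f g : itg f -> itg g -> {ae P, forall w, f w = g w} ->
  {ae P, forall w, rce f w = rce g w}.
Proof.
move=> fi gi fg.
have h1 : {ae P, forall w, rce f w <= rce g w}.
  by apply: rce_ae_le => //; apply: filterS fg => w ->.
have h2 : {ae P, forall w, rce g w <= rce f w}.
  by apply: rce_ae_le => //; apply: filterS fg => w ->.
by apply: filterS2 h1 h2 => w a b; apply/eqP; rewrite eq_le a b.
Qed.

Lemma rceD f g : itg f -> itg g ->
  {ae P, forall w, rce (fun w => f w + g w) w = rce f w + rce g w}.
Proof.
move=> fi gi; have rf := rce_itg fi; have rg := rce_itg gi.
apply: rce_unique; [exact: itgD|exact: itgD| |].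
  by apply: measurable_funD; exact: rce_measurable.
by move=> A GA; have mA := gsetM sG GA; rewrite !EonD// !rceE.
Qed.

Lemma rceZ c f : itg f -> {ae P, forall w, rce (fun w => c * f w) w = c * rce f w}.
Proof.
move=> fi; have rf := rce_itg fi.
apply: rce_unique; [exact: itgZ|exact: itgZ| |].
  by apply: measurable_funM => //; exact: rce_measurable.
by move=> A GA; have mA := gsetM sG GA; rewrite !EonZ// rceE.
Qed.

(** Integrability of [N U] is part of the conclusion: it comes from the comparison of means with the
    whole weight [N], and the inequality on [A] from the weight [1_A N]. *)
Lemma ge0_weighted_le_Eon U V (N : Omega -> R) : itg U -> itg V ->
  (forall w, 0 <= U w) -> (forall w, 0 <= V w) ->
  (forall A, G A -> Eon A U <= Eon A V) ->
  gmf N -> (forall w, 0 <= N w) -> itg (fun w => N w * V w) ->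
  itg (fun w => N w * U w) /\
  (forall A, G A -> Eon A (fun w => N w * U w) <= Eon A (fun w => N w * V w)).
Proof.
move=> Ui Vi U0 V0 UV mN N0 NVi.
have mU := itg_measurable Ui; have mV := itg_measurable Vi.
have UV' A : G A -> (\int[P]_(w in A) (U w)%:E <= \int[P]_(w in A) (V w)%:E)%E.
  by move=> GA; have mA := gsetM sG GA; rewrite -!EonE// lee_fin; exact: UV.
have key (M : Omega -> R) : gmf M -> (forall w, 0 <= M w) ->
    (\int[P]_w (M w * U w)%:E <= \int[P]_w (M w * V w)%:E)%E.
  move=> mM M0; under eq_integral do rewrite EFinM.
  under [leRHS]eq_integral do rewrite EFinM.
  apply: (ge0_weighted_le sG) => //.
  exact/measurable_EFinP.
have NUi : itg (fun w => N w * U w).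
  apply/integrableP; split.
    by apply/measurable_EFinP/measurable_funM => //; exact: (gfun_measurable sG).
  under eq_integral do rewrite gee0_abs ?lee_fin ?mulr_ge0//.
  apply: le_lt_trans (key _ mN N0) _.
  by rewrite -[ltLHS]EonE// ltry.
split=> // A GA; have mA := gsetM sG GA.
rewrite -EonT_indic -[leRHS]EonT_indic -lee_fin !EonE//; [|exact: itg_indicM..].
have := key (\1_A \* N); rewrite /=.
under eq_integral do rewrite -mulrA.
under [X in (_ <= X)%E]eq_integral do rewrite -mulrA.
apply => [|w]; last by rewrite mulr_ge0// indicE.
by apply: measurable_funM => //; exact: (gindic sG).
Qed.

(* |rce Y| and |Y| dominate each other only in conditional mean, which is all
   that the weighted comparison needs. *)
Lemma rce_pull_out f (N : Omega -> R) : itg f -> gmf N -> (forall w, 0 <= N w) ->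
  itg (fun w => N w * f w) ->
  itg (fun w => N w * rce f w) /\
  (forall A, G A -> Eon A (fun w => N w * rce f w) = Eon A (fun w => N w * f w)).
Proof.
move=> fi mN N0 Nfi; have ri := rce_itg fi.
have mNO := gfun_measurable sG mN.
have Nabs : itg (fun w => N w * `|f w|).
  apply: itg_ae_le (itg_norm Nfi).
    by apply: measurable_funM => //; exact/measurableT_comp/itg_measurable.
  by apply: aeW => w; rewrite !normrM normr_id.
have mr := rce_measurable fi.
(* Conditional Jensen for the absolute value, by splitting [A] along the sign of [rce f]. *)
have le_abs A : G A -> Eon A (fun w => `|rce f w|) <= Eon A (fun w => `|f w|).
  move=> GA; have mA := gsetM sG GA.
  pose B := [set w | 0 <= rce f w].
  have GB : G B.
    apply/(gmeasurableP sG); rewrite -[X in measurable X]setTI.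
    by apply: measurable_fun_ler.
  have mB := gsetM sG GB; have mCB := measurableC mB.
  rewrite (@Eon_setUI A B)//; last exact: itg_norm.
  rewrite [leRHS](@Eon_setUI A B)//; last exact: itg_norm.
  apply: lerD.
    rewrite (_ : Eon _ (fun w => `|rce f w|) = Eon (A `&` B) (rce f)); last first.
      by apply: eq_Rintegral => w /set_mem[_ /= ?]; rewrite ger0_norm.
    rewrite rceE//; last exact: (gsetI sG).
    apply: Eon_ae_le => //; [exact: measurableI|exact: itg_norm|].
    by apply: aeW => w; exact: ler_norm.
  have mACB : measurable (A `&` ~` B) by exact: measurableI.
  rewrite (_ : Eon _ (fun w => `|rce f w|) = - Eon (A `&` ~` B) (rce f)); last first.
    rewrite -EonN//.
    apply: eq_Rintegral => w /set_mem[_ /= /negP]; rewrite -ltNge => /ltW ?.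
    by rewrite ler0_norm.
  rewrite rceE//; last by apply: (gsetI sG) => //; exact: (gsetC sG).
  rewrite -EonN//; apply: Eon_ae_le => //; [exact: itgN|exact: itg_norm|].
  by apply: aeW => w; rewrite -normrN ler_norm.
have [Nrabs _] := ge0_weighted_le_Eon (itg_norm ri) (itg_norm fi)
  (fun w => normr_ge0 _) (fun w => normr_ge0 _) le_abs mN N0 Nabs.
have Nri : itg (fun w => N w * rce f w).
  apply: itg_ae_le Nrabs.
    by apply: measurable_funM => //; exact/itg_measurable.
  by apply: aeW => w; rewrite normrM (ger0_norm (N0 w)).
split => // A GA; have mA := gsetM sG GA.
(* Adding |rce f| + |f| to [rce f] and to [f] makes both nonnegative without disturbing the equality
   of their integrals over events of [G]. The weighted comparison then applies in both directions
   and the common term cancels. *)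
pose U := fun w => `|rce f w| + `|f w| + rce f w.
pose V := fun w => `|rce f w| + `|f w| + f w.
have abi : itg (fun w => `|rce f w| + `|f w|) by apply: itgD; exact: itg_norm.
have Ui : itg U by exact: itgD.
have Vi : itg V by exact: itgD.
have U0 w : 0 <= U w.
  rewrite /U; have := ler_norm (- rce f w); rewrite normrN; have := normr_ge0 (f w); lra.
have V0 w : 0 <= V w.
  rewrite /V; have := ler_norm (- f w); rewrite normrN; have := normr_ge0 (rce f w); lra.
have UVE B : G B -> Eon B U = Eon B V.
  by move=> GB; have mB := gsetM sG GB; rewrite !EonD// ?rceE//; exact: itg_norm.
have NS : itg (fun w => N w * (`|rce f w| + `|f w|)).
  have := itgD Nrabs Nabs; congr itg; apply/funext => w; by rewrite mulrDr.
have NU : (fun w => N w * U w) = (fun w => N w * (`|rce f w| + `|f w|) + N w * rce f w).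
  by apply/funext => w; rewrite /U mulrDr.
have NV : (fun w => N w * V w) = (fun w => N w * (`|rce f w| + `|f w|) + N w * f w).
  by apply/funext => w; rewrite /V mulrDr.
have NUi : itg (fun w => N w * U w) by rewrite NU; exact: itgD.
have NVi : itg (fun w => N w * V w) by rewrite NV; exact: itgD.
have [_ h1] := ge0_weighted_le_Eon Ui Vi U0 V0
  (fun B GB => eq_ind_r (fun x => x <= _) (lexx _) (UVE B GB)) mN N0 NVi.
have [_ h2] := ge0_weighted_le_Eon Vi Ui V0 U0
  (fun B GB => eq_ind (Eon B U) (fun x => x <= _) (lexx _) _ (UVE B GB)) mN N0 NUi.
have := h1 A GA; have := h2 A GA; rewrite NU NV !EonD//.
by rewrite !lerD2l => a b; apply/eqP; rewrite eq_le a b.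
Qed.

End sub.
End real_integrals.

(** * Essential suprema of families *)

Section countable_sup.
Context d (T : measurableType d) (R : realType).
Implicit Types (Y : nat -> T -> \bar R).

Definition csup Y (w : T) : \bar R := esups (Y ^~ w) 0%N.

Lemma csup_ub Y n w : (Y n w <= csup Y w)%E.
Proof. by apply: ereal_sup_ubound; exists n. Qed.

Lemma csup_le Y w z : (forall n, Y n w <= z)%E -> (csup Y w <= z)%E.
Proof. by move=> h; apply: ge_ereal_sup => _ [n _ <-]. Qed.

Lemma csup_measurable Y : (forall n, measurable_fun setT (Y n)) ->
  measurable_fun setT (csup Y).
Proof. by move=> mY; have := measurable_fun_esups mY 0%N. Qed.

(** [contract] maps the extended line increasingly and injectively into [-1, 1]; composed with it,
    possibly infinite suprema have a finite mean and can be maximized. *)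
Lemma measurable_contract : measurable_fun setT (@contract R).
Proof.
rewrite (_ : @contract R = fun x => if x == +oo%E then 1 else
  if x == -oo%E then -1 else fine x / (1 + `|fine x|)); last first.
  by apply/funext => -[].
have ic : measurable_fun setT (fun x : R => x / (1 + `|x|)).
  apply: continuous_measurable_fun => x; apply: cvgM; first exact: cvg_id.
  apply: cvgV; first by rewrite gt_eqF// ltr_pwDl.
  by apply: cvgD; [exact: cvg_cst|apply: cvg_norm; exact: cvg_id].
apply: measurable_fun_ifT => //; first exact: measurable_fun_eqe.
apply: measurable_fun_ifT => //; first exact: measurable_fun_eqe.
by apply: (measurableT_comp ic).
Qed.

End countable_sup.

Section ess_sup_family.
Context d (Omega : measurableType d) (R : realType) (P : probability Omega R).
Implicit Types (S : set (Omega -> \bar R)).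

Lemma is_ess_sup_family_unique S (Z Z' : Omega -> \bar R) :
  is_ess_sup_family P S Z -> is_ess_sup_family P S Z' ->
  {ae P, forall w, Z w = Z' w}.
Proof.
move=> [mZ uZ lZ] [mZ' uZ' lZ'].
have h1 := lZ _ mZ' uZ'; have h2 := lZ' _ mZ uZ.
by apply: filterS2 h1 h2 => w a b; apply/eqP; rewrite eq_le a b.
Qed.

Section sub.
Variable G : set (set Omega).
Hypothesis sG : subsigma P G.
Notation gmf := (measurable_fun [set: g_sigma_algebraType G]).

(* A countable subfamily maximizing the mean of a bounded increasing function
   of its supremum has the essential supremum as its supremum. *)
Lemma ess_sup_family_countable S : S !=set0 -> (forall Y, S Y -> gmf Y) ->
  exists Y : nat -> Omega -> \bar R, (forall n, S (Y n)) /\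
    is_ess_sup_family P S (csup Y).
Proof.
move=> [Y0 SY0] mS.
have mSO Y : S Y -> measurable_fun setT Y.
  by move=> /mS; exact: (gfun_measurable sG).
pose Phi Y := Eon P setT (fun w => contract (csup Y w)).
have ci (Y : nat -> Omega -> \bar R) : (forall n, S (Y n)) ->
    itg P (fun w => contract (csup Y w)).
  move=> SY; apply: (@itg_ae_le _ _ _ _ (cst 1)); last exact: itg_cst.
    apply: (measurableT_comp (@measurable_contract R)).
    by apply: csup_measurable => n; exact: mSO.
  by apply: aeW => w; exact: contract_le1.
pose E := [set Phi Y | Y in [set Y : nat -> Omega -> \bar R | forall n, S (Y n)]].
have E1 : ubound E 1.
  move=> _ [Y SY <-].
  have -> : 1 = Eon P setT (cst 1).
    by rewrite Eon_cst// probability_setT/= mulr1.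
  apply: Eon_ae_le => //; [exact: ci|exact: itg_cst|].
  by apply: aeW => w; have := contract_le1 (csup Y w); rewrite ler_norml => /andP[].
have hE : has_sup E.
  by split; [exists (Phi (fun=> Y0)); exists (fun=> Y0)|exists 1].
have /choice[Yk Yk_] : forall k : nat, exists Y : nat -> Omega -> \bar R,
    (forall n, S (Y n)) /\ sup E - k.+1%:R^-1 < Phi Y.
  move=> k; have k0 : (0 : R) < k.+1%:R^-1 by rewrite invr_gt0.
  have [_ [Y SY <-] h] := sup_adherent k0 hE.
  by exists Y.
(* A single sequence running through all the [Yk k n]; the default (0, 0) is used only for numbers
   that code no pair. *)
pose pair (n : nat) : nat * nat := odflt (0, 0)%N (unpickle n).
pose Y n := Yk (pair n).1 (pair n).2.
have SY n : S (Y n) by have [h _] := Yk_ (pair n).1; exact: h.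
have mY n := mSO _ (SY n).
have Yge k w : (csup (Yk k) w <= csup Y w)%E.
  apply: csup_le => n; have -> : Yk k n w = Y (pickle (k, n)) w.
    by rewrite /Y /pair pickleK.
  exact: csup_ub.
have supE : sup E <= Phi Y.
  apply/ler_addgt0Pl => e e0.
  have [k ke] : exists k : nat, k.+1%:R^-1 < e.
    exists (Num.truncn e^-1).
    by rewrite invf_plt ?posrE//; exact: truncnS_gt.
  have [SYk /ltW h] := Yk_ k.
  have : Phi (Yk k) <= Phi Y.
    apply: Eon_ae_le => //; [exact: ci|exact: ci|].
    by apply: aeW => w; rewrite le_contract.
  move: h ke; move: (sup E) (Phi (Yk k)) (Phi Y) (k.+1%:R^-1) => a b c x; lra.
exists Y; split=> //; split.
- exact: csup_measurable.
- move=> W SW.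
  (* Adjoining [W] to the maximizing sequence cannot raise the mean, hence leaves the contracted
     supremum unchanged almost surely; injectivity of [contract] then puts [W] below [csup Y]. *)
  pose V n := if n is n'.+1 then Y n' else W.
  have SV n : S (V n) by case: n => [|n] /=.
  have VY w : (csup Y w <= csup V w)%E.
    by apply: csup_le => n; exact: (@csup_ub _ _ _ V n.+1).
  have VW w : (W w <= csup V w)%E by exact: (@csup_ub _ _ _ V 0%N).
  have PV : Phi V <= Phi Y.
    by apply: le_trans supE; apply: ub_le_sup; [exists 1|exists V].
  have h0 w : setT w -> 0 <= contract (csup V w) - contract (csup Y w).
    by move=> _; rewrite subr_ge0 le_contract.
  have hE0 : Eon P setT (fun w => contract (csup V w) - contract (csup Y w)) <= 0.
    by rewrite EonB//; [rewrite subr_le0|exact: ci|exact: ci].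
  have := Eon_le0_ae_le0 measurableT (itgB (ci _ SV) (ci _ SY)) h0 hE0.
  apply: filterS => w /(_ Logic.I) /eqP; rewrite subr_eq0 => /eqP.
  by move=> /contract_inj e; rewrite -e.
- move=> Z' mZ' hZ'.
  have /ae_foralln := fun n => hZ' _ (SY n).
  by apply: filterS => w h; exact: csup_le.
Qed.

Lemma ess_sup_familyP S : S !=set0 -> (forall Y, S Y -> gmf Y) ->
  is_ess_sup_family P S (ess_sup_family P S).
Proof.
move=> S0 mS; have [Y [SY hY]] := ess_sup_family_countable S0 mS.
by apply: (@xgetPex _ _ [set Z | is_ess_sup_family P S Z]); exists (csup Y).
Qed.

(** Almost surely equal to a countable supremum of measurable functions; the null sets of [G] absorb
    the difference. *)
Lemma ess_sup_family_gmf S : S !=set0 -> (forall Y, S Y -> gmf Y) ->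
  gmf (ess_sup_family P S).
Proof.
move=> S0 mS; have [Y [SY hY]] := ess_sup_family_countable S0 mS.
have h := is_ess_sup_family_unique hY (ess_sup_familyP S0 mS).
by apply: (gfun_ae sG h); apply: csup_measurable => n; exact: mS.
Qed.

(** Directedness replaces the countable subfamily by an almost surely increasing sequence of
    members, so that the common bound [C] on the means of the members passes to the supremum by
    Fatou and makes it integrable. *)
Lemma ess_sup_family_directed S (C : R) : (forall Y, S Y -> gmf Y) ->
  (exists2 Y, S Y & {ae P, forall w, 0 <= Y w}%E) ->
  (forall Y1 Y2, S Y1 -> S Y2 -> exists2 Y, S Y &
    {ae P, forall w, Y1 w <= Y w /\ Y2 w <= Y w}%E) ->
  (forall Y, S Y -> exists y, [/\ itg P y, {ae P, forall w, Y w = (y w)%:E} &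
    Eon P setT y <= C]) ->
  exists z, [/\ gmf z, itg P z,
    {ae P, forall w, ess_sup_family P S w = (z w)%:E} & Eon P setT z <= C].
Proof.
move=> mS [U SU U0] dirS yS.
have S0 : S !=set0 by exists U.
set Z := ess_sup_family P S.
have mZ : gmf Z by exact: ess_sup_family_gmf.
have [_ Zub _] := ess_sup_familyP S0 mS.
have [Y [SY hY]] := ess_sup_family_countable S0 mS.
have ZY := is_ess_sup_family_unique hY (ess_sup_familyP S0 mS).
have /choice[dir dirP] : forall Y12 : (Omega -> \bar R) * (Omega -> \bar R),
  exists Y, S Y12.1 -> S Y12.2 -> S Y /\
    {ae P, forall w, Y12.1 w <= Y w /\ Y12.2 w <= Y w}%E.
  move=> [Y1 Y2]; have [[SY1 SY2]|h] := pselect (S Y1 /\ S Y2); last first.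
    by exists Y1 => /= ? ?; exfalso; apply: h.
  by have [V SV hV] := dirS _ _ SY1 SY2; exists V.
(* Running upper bounds, started at the nonnegative member [U] so that the whole sequence is almost
   surely nonnegative. *)
pose W := fix W n := if n is n'.+1 then dir (W n', Y n') else U.
have SW n : S (W n).
  by elim: n => //= n ih; have [] := dirP (W n, Y n) ih (SY n).
have Wae n : {ae P, forall w, W n w <= W n.+1 w /\ Y n w <= W n.+1 w}%E.
  by have [] := dirP (W n, Y n) (SW n) (SY n).
pose V n w := maxe 0%E (W n w).
have V0 n w : (0 <= V n w)%E by rewrite /V le_max lexx.
have mV n : measurable_fun setT (V n).
  apply: (gfun_measurable sG); apply: measurable_maxe => //; exact: mS.
have good : {ae P, forall w, [/\ (Z w = csup Y w)%E, (0 <= U w)%E &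
    forall n, (W n w <= W n.+1 w /\ Y n w <= W n.+1 w)%E]}.
  have /ae_foralln h := Wae.
  near=> w; split; near: w => //.
  by apply: filterS ZY => w ->.
have Vint n : (\int[P]_w V n w <= C%:E)%E.
  have [y [yi yW yC]] := yS _ (SW n).
  have -> : (\int[P]_w V n w = \int[P]_w (y w)%:E)%E.
    apply: ae_eq_integral => //.
      exact: measurable_int yi.
    apply: filterS2 good yW => w [_ U0w hw] yw _.
    rewrite -yw /V; apply/max_idPr.
    have W0 k : (0 <= W k w)%E.
      by elim: k => // k ih; apply: (le_trans ih); have [] := hw k.
    exact: W0.
  by rewrite -EonE// lee_fin.
(* [W] increases only almost surely; the lower limit of its positive parts is measurable and
   nonnegative everywhere, and dominates the essential supremum almost surely. *)
pose L w := limn_einf (V ^~ w).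
have L0 w : (0 <= L w)%E.
  rewrite /L limn_einf_lim; apply: lime_ge; first exact: is_cvg_einfs.
  by apply: nearW => n; apply: le_ereal_inf_tmp => _ [k _ <-].
have mL : measurable_fun setT L.
  rewrite (_ : L = csup (fun n w => einfs (V ^~ w) n)).
    by apply: csup_measurable => n; exact: measurable_fun_einfs.
  apply/funext => w; rewrite /L limn_einf_lim (cvg_lim _ (@cvg_einfs_sup _ (V ^~ w)))//.
  by congr ereal_sup; apply/seteqP; split => _ [n _ <-]; exists n.
have LC : (\int[P]_w L w <= C%:E)%E.
  apply: le_trans (fatou P measurableT mV (fun n w _ => V0 n w)) _.
  rewrite limn_einf_lim; apply: lime_le; first exact: is_cvg_einfs.
  apply: nearW => n; apply: le_trans (Vint n).
  by apply: ereal_inf_lbound; exists n => //=.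
have ZL : {ae P, forall w, 0 <= Z w /\ Z w <= L w}%E.
  have ZU := Zub _ SU.
  apply: filterS2 good ZU => w [ZE U0w hw] UZ; rewrite ZE; split.
    by rewrite -ZE; exact: le_trans U0w UZ.
  apply: csup_le => n.
  have incr i j : (i <= j)%N -> (W i w <= W j w)%E.
    elim: j => [|j ih]; first by rewrite leqn0 => /eqP ->.
    rewrite leq_eqVlt => /predU1P[->//|/ih h]; apply: le_trans h _.
    by have [] := hw j.
  apply: (@le_trans _ _ (einfs (V ^~ w) n.+1)).
    apply: le_ereal_inf_tmp => _ [k /= nk <-].
    have [_ h] := hw n; apply: (le_trans h); apply: (le_trans (incr _ _ nk)).
    by rewrite /V le_max lexx orbT.
  rewrite /L limn_einf_lim (cvg_lim _ (@cvg_einfs_sup _ (V ^~ w)))//.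
  by apply: ereal_sup_ubound; exists n.+1.
have Li : P.-integrable setT L.
  apply/integrableP; split => //; under eq_integral do rewrite gee0_abs//.
  by apply: le_lt_trans LC _; rewrite ltry.
have Zi : P.-integrable setT Z.
  apply/integrableP; split; first exact: (gfun_measurable sG).
  have /integrableP[_] := Li; apply: le_lt_trans; apply: ae_ge0_le_integral => //.
  - by apply: measurableT_comp => //; exact: (gfun_measurable sG).
  - exact: measurableT_comp.
  by apply: filterS ZL => w [h1 h2] _; rewrite !gee0_abs.
have [zi Zfin] := integrable_fine Zi.
have mz : gmf (fine \o Z) by exact: measurableT_comp.
have zE : (\int[P]_w (fine (Z w))%:E = \int[P]_w Z w)%E.
  apply: ae_eq_integral => //.
  - exact: (measurable_int P zi).
  - exact: (gfun_measurable sG).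
  - by apply: filterS Zfin => w <-.
exists (fine \o Z); split => //.
rewrite -lee_fin EonE// zE; apply: le_trans LC.
rewrite -(integral_ae_abs measurableT (gfun_measurable sG mZ)); last by apply: filterS ZL => w [].
apply: ae_ge0_le_integral => //.
  by apply: measurableT_comp => //; exact: (gfun_measurable sG).
by apply: filterS ZL => w [h1 h2] _; rewrite gee0_abs.
Unshelve. all: by end_near. Qed.

End sub.
End ess_sup_family.

(** * Conditional expectation of nonnegative extended variables *)

Section ge0_cond_exp.
Context d (Omega : measurableType d) (R : realType) (P : probability Omega R).
Variable G : set (set Omega).
Hypothesis sG : subsigma P G.
Notation gmf := (measurable_fun [set: g_sigma_algebraType G]).

(** [Y] is the sum of the increments of its truncations min(Y, n). Each increment is bounded, hence
    has a finite conditional expectation, and integrals commute with the nonnegative series. *)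
Let ge0_cond_exp_exists (Y : Omega -> \bar R) : measurable_fun setT Y ->
  (forall w, 0 <= Y w)%E -> exists Z, is_cond_exp P G Y Z.
Proof.
move=> mY Y0.
pose f (n : nat) w : R := fine (mine (Y w) n%:R%:E).
have minfin n w : mine (Y w) n%:R%:E \is a fin_num.
  by rewrite ge0_fin_numE ?le_min ?Y0 ?lee_fin//= gt_min ltry orbT.
have mf n : measurable_fun setT (f n).
  by apply: measurableT_comp => //; exact: measurable_mine.
have f0 n w : 0 <= f n w by rewrite /f fine_ge0// le_min Y0 lee_fin/=.
have fle n w : f n w <= n%:R by rewrite /f -lee_fin fineK// ge_min lexx orbT.
have fincr n w : f n w <= f n.+1 w.
  by rewrite /f fine_le// le_min ge_min lexx/= ge_min lee_fin ler_nat leqnSn orbT.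
pose D n w := f n.+1 w - f n w.
have D0 n w : 0 <= D n w by rewrite /D subr_ge0.
have fi n : itg P (f n).
  apply: (@itg_ae_le _ _ _ _ (cst n%:R)) => //; last exact: itg_cst.
  by apply: aeW => w; rewrite ger0_norm.
have Di n : itg P (D n) by exact: itgB.
have /choice[Z ZP] := fun n => ge0_rce_exists sG (Di n) (D0 n).
have f0E w : f 0%N w = 0.
  by apply/eqP; rewrite eq_le f0 andbT -[leRHS](@mulr0n _ 1) fle.
have YE w : Y w = (\sum_(0 <= n <oo) (D n w)%:E)%E.
  apply/esym/cvg_lim => //.
  rewrite (_ : (fun n => _) = fun n => (f n w)%:E); last first.
    apply/funext => n; rewrite sumEFin telescope_sumr//.
    by rewrite f0E subr0.
  rewrite (_ : (fun n => _) = fun n => mine (Y w) n%:R%:E); last first.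
    by apply/funext => n; rewrite fineK.
  have := Y0 w; case: (Y w) => [r r0|_|//].
    apply: cvg_near_cst; near=> n.
    apply/min_idPl; rewrite lee_fin; near: n; exact: nbhs_infty_ger.
  rewrite (_ : (fun n => _) = fun n => (n%:R : R)%:E); last first.
    by apply/funext => n; apply/min_idPr; exact: leey.
  by apply/cvgenyP.
exists (fun w => \sum_(0 <= n <oo) (Z n w)%:E)%E; split.
  apply: ge0_emeasurable_sum => [n w _ _|n _].
    by have [_ _ h _] := ZP n; rewrite lee_fin.
  by have [h _ _ _] := ZP n; exact/measurable_EFinP.
move=> A GA; have mA := gsetM sG GA.
under [RHS]eq_integral do rewrite YE.
rewrite !integral_nneseries//.
- apply: eq_eseriesr => n _; have [_ Zi _ ZE] := ZP n.
  by rewrite -[LHS]EonE// -[RHS]EonE// ZE.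
- move=> n; have [_ Zi _ _] := ZP n.
  by apply: measurable_funTS; apply/measurable_EFinP; exact: (itg_measurable Zi).
- by move=> n w _; have [_ _ h _] := ZP n; rewrite lee_fin.
- by move=> n; apply: measurable_funTS; apply/measurable_EFinP; exact: (itg_measurable (Di n)).
- by move=> n w _; rewrite lee_fin.
Unshelve. all: by end_near. Qed.

Lemma ge0_cond_expP (Y : Omega -> \bar R) : measurable_fun setT Y ->
  {ae P, forall w, 0 <= Y w}%E ->
  [/\ gmf (cond_exp P G Y), {ae P, forall w, 0 <= cond_exp P G Y w}%E &
    forall A, G A -> (\int[P]_(w in A) cond_exp P G Y w = \int[P]_(w in A) Y w)%E].
Proof.
move=> mY Y0.
have mYA : measurable_fun setT (fun w => `|Y w|)%E by exact: measurableT_comp.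
have absE A : G A -> (\int[P]_(w in A) `|Y w| = \int[P]_(w in A) Y w)%E.
  by move=> GA; apply: integral_ae_abs => //; exact: (gsetM sG).
have [mC CE] : is_cond_exp P G Y (cond_exp P G Y).
  apply: (@xgetPex _ _ [set Z | is_cond_exp P G Y Z]).
  have [Z [mZ ZE]] := ge0_cond_exp_exists mYA (fun w => abse_ge0 _).
  by exists Z; split => // A GA; rewrite ZE// absE.
have mC' := gfun_measurable sG mC.
split => //.
set Z := cond_exp P G Y in mC CE mC' *.
(* On this event of [G] the integral of [Z] is minus that of |Z|, but it also equals the integral of
   [Y], which is nonnegative; so |Z| vanishes almost surely there. *)
pose A := [set w | Z w < 0]%E.
have GA : G A.
  apply/(gmeasurableP sG); rewrite -[X in measurable X]setTI.
  exact: emeasurable_fun_lt.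
have mA := gsetM sG GA.
have mZA : measurable_fun A Z by exact: measurable_funTS.
have Z0 : (\int[P]_(w in A) `|Z w| = 0)%E.
  have e : (\int[P]_(w in A) Z w = - \int[P]_(w in A) `|Z w|)%E.
    rewrite -integral_ge0N//; apply: eq_integral => w /set_mem/ltW Zw.
    by rewrite lee0_abs// oppeK.
  have := CE _ GA; rewrite e -absE// => h.
  apply/eqP; rewrite eq_le integral_ge0// andbT -leeN2 oppe0 h.
  exact: integral_ge0.
have := (ae_eq_integral_abs P mA mZA).1 Z0; apply: filterS => w h.
by rewrite leNgt; apply/negP => Aw; move: (Aw); rewrite (h Aw) ltxx.
Qed.
End ge0_cond_exp.

(** * Duality in L_p *)

Section Lp_spaces.
Context d (Omega : measurableType d) (R : realType) (P : probability Omega R).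
Implicit Types (f g h : Omega -> R).

Lemma finite_norm_itg (r : R) f : 1 <= r -> measurable_fun setT f ->
  finite_norm P r%:E f <-> itg P (fun w => `|f w| `^ r).
Proof.
move=> r1 mf; have r0 : r != 0 by rewrite gt_eqF// (lt_le_trans ltr01).
have mfr : measurable_fun setT (fun w => `|f w| `^ r).
  by apply: (measurableT_comp (measurable_powR _)) => //; exact: measurableT_comp.
have e : (\int[P]_w `|(`|f w| `^ r)%:E| = \int[P]_w (`|EFin (f w)| `^ r))%E.
  by apply: eq_integral => w _; rewrite gee0_abs ?lee_fin ?powR_ge0// poweR_EFin.
split=> [ff|/integrableP[_ h]].
  apply/integrableP; split; first exact/measurable_EFinP.
  rewrite e; have := poweR_lty r ff; by rewrite poweR_Lnorm.
rewrite /finite_norm; apply: (@lty_poweRy _ _ r) => //.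
by rewrite poweR_Lnorm// -e.
Qed.

Lemma finite_norm_bounded f :
  finite_norm P +oo f <-> exists C, {ae P, forall w, `|f w| <= C}.
Proof.
have P1 : (0 < P setT)%E by rewrite probability_setT.
rewrite /finite_norm unlock P1; split.
  move=> h; have /ess_supr_bounded[C hC] : (ess_sup P (EFin \o (fun w => `|f w|)%R) < +oo)%E by [].
  by exists C.
move=> [C hC]; apply: (@le_lt_trans _ _ C%:E); last exact: ltry.
by apply/ess_supP; apply: filterS hC => w /=; rewrite lee_fin.
Qed.

Lemma finite_norm_ae_le p f g : (1 <= p)%E ->
  measurable_fun setT f -> measurable_fun setT g ->
  {ae P, forall w, `|g w| <= `|f w|} -> finite_norm P p f -> finite_norm P p g.
Proof.
case: p => [r|_|//].
  rewrite lee_fin => r1 mf mg gf.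
  rewrite !finite_norm_itg//; apply: itg_ae_le.
    by apply: (measurableT_comp (measurable_powR _)) => //; exact: measurableT_comp.
  apply: filterS gf => w h; rewrite ger0_norm ?powR_ge0//.
  by apply: ge0_ler_powR => //; exact: le_trans r1.
move=> mf mg gf; rewrite !finite_norm_bounded => -[C hC]; exists C.
by apply: filterS2 gf hC => w; exact: le_trans.
Qed.

Lemma holder_1y f g : measurable_fun setT f -> measurable_fun setT g ->
  finite_norm P +oo g ->
  ('N[P]_1[EFin \o (f \* g)%R] <= 'N[P]_1[EFin \o f] * 'N[P]_+oo[EFin \o g])%E.
Proof.
move=> mf mg gfin; rewrite !Lnorm1.
have P1 : (0 < P setT)%E by rewrite probability_setT.
have cfin : 'N[P]_+oo[EFin \o g]%E \is a fin_num.
  by rewrite ge0_fin_numE; [exact: gfin|exact: Lnorm_ge0].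
have gc : {ae P, forall w, `|(g w)%:E| <= 'N[P]_+oo[EFin \o g]}%E.
  have -> : ('N[P]_+oo[EFin \o g] = ess_sup P (abse \o (EFin \o g)))%E.
    by rewrite unlock P1.
  exact: ess_sup_ge.
rewrite -(fineK cfin) -ge0_integralZr//; last first.
  - by rewrite lee_fin fine_ge0//; exact: Lnorm_ge0.
  - by apply: measurableT_comp => //; exact/measurable_EFinP.
apply: ae_ge0_le_integral => //.
- by apply: measurableT_comp => //; apply/measurable_EFinP; exact: measurable_funM.
- by move=> w _; rewrite mule_ge0// lee_fin fine_ge0//; exact: Lnorm_ge0.
- by apply: emeasurable_funM => //; apply: measurableT_comp => //; exact/measurable_EFinP.
- apply: filterS gc => w h _ /=; rewrite fineK//.
  by rewrite normrM EFinM; apply: lee_wpmul2l.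
Qed.

Lemma holder_conj p f g : (1 <= p)%E ->
  measurable_fun setT f -> measurable_fun setT g ->
  finite_norm P p f -> finite_norm P (hoelder_conjugate p) g ->
  ('N[P]_1[EFin \o (f \* g)%R] <=
   'N[P]_p[EFin \o f] * 'N[P]_(hoelder_conjugate p)[EFin \o g])%E.
Proof.
move=> p1 mf mg ff gf; have [p_1|pN1] := eqVneq p 1%E.
  by rewrite p_1 hoelder_conjugate1 in ff gf *; exact: holder_1y.
have [p_oo|pNoo] := eqVneq p +oo%E.
  rewrite p_oo hoelder_conjugatey in ff gf *.
  rewrite muleC (_ : (f \* g) = (g \* f)); last by apply/funext => w /=; rewrite mulrC.
  exact: holder_1y.
case: p p1 pN1 pNoo ff gf => [r r1 rN1 _ ff|//|//].
have r1' : 1 < r by rewrite lt_neqAle eq_sym -eqe rN1.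
have r0 : 0 < r by exact: lt_trans r1'.
have -> : hoelder_conjugate r%:E = (r / (r - 1))%:E.
  rewrite /hoelder_conjugate/= eqe gt_eqF// -EFinB inver subr_eq0 gt_eqF//.
move=> gf; apply: hoelder => //; first by rewrite divr_gt0// subr_gt0.
by rewrite invf_div; field; rewrite gt_eqF.
Qed.

Lemma holder_itg p f g : (1 <= p)%E ->
  measurable_fun setT f -> measurable_fun setT g ->
  finite_norm P p f -> finite_norm P (hoelder_conjugate p) g ->
  itg P (fun w => f w * g w).
Proof.
move=> p1 mf mg ff gf.
have := holder_conj p1 mf mg ff gf; rewrite Lnorm1 => h.
apply/integrableP; split; first by apply/measurable_EFinP; exact: measurable_funM.
apply: le_lt_trans h _.
apply: lte_mul_pinfty; [exact: Lnorm_ge0| |exact: gf].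
by rewrite ge0_fin_numE; [exact: ff|exact: Lnorm_ge0].
Qed.

Section Lp.
Variables (p : \bar R) (G : set (set Omega)).
Hypotheses (p1 : (1 <= p)%E) (sG : subsigma P G).
Notation gmf := (measurable_fun [set: g_sigma_algebraType G]).

Lemma Lp_gmf f : Lp P p G f -> gmf f. Proof. by case. Qed.

Lemma Lp_measurable f : Lp P p G f -> measurable_fun setT f.
Proof. by move=> /Lp_gmf; exact: (gfun_measurable sG). Qed.

Lemma Lp_ae_le f g : Lp P p G f -> gmf g ->
  {ae P, forall w, `|g w| <= `|f w|} -> Lp P p G g.
Proof.
move=> Lf mg gf; split => //; apply: finite_norm_ae_le gf _ => //.
- exact: Lp_measurable.
- exact: (gfun_measurable sG).
- by case: Lf.
Qed.

Lemma Lp_ae_eq f g : Lp P p G f -> {ae P, forall w, f w = g w} -> Lp P p G g.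
Proof.
move=> Lf fg; apply: (Lp_ae_le Lf).
  by apply: (gfun_ae sG fg); exact: Lp_gmf Lf.
by apply: filterS fg => w ->.
Qed.

Lemma Lp_cst c : Lp P p G (cst c).
Proof.
split; first exact: measurable_cst.
move: p1; case: (p) => [r|_|//].
  rewrite lee_fin => r1; rewrite finite_norm_itg//; exact: (itg_cst P (`|c| `^ r)).
by rewrite finite_norm_bounded; exists `|c|; exact: aeW.
Qed.

Lemma Lp_linear (a : R) f g : Lp P p G f -> Lp P p G g -> Lp P p G (a *: f + g).
Proof.
move=> [mf ff] [mg fg]; split.
  by apply: measurable_funD => //; exact: measurable_funM.
have mfO := gfun_measurable sG mf; have mgO := gfun_measurable sG mg.
have fL : f \in Lfun P p by rewrite inE; apply/andP; split; rewrite inE.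
have gL : g \in Lfun P p by rewrite inE; apply/andP; split; rewrite inE.
have := Lfun_submod_closed P p1 => -[_ /(_ a _ _ fL gL)].
by rewrite inE => /andP[_]; rewrite inE.
Qed.

Lemma LpD f g : Lp P p G f -> Lp P p G g -> Lp P p G (fun w => f w + g w).
Proof. by move=> Lf Lg; have := Lp_linear 1 Lf Lg; rewrite scale1r. Qed.

Lemma LpZ a f : Lp P p G f -> Lp P p G (fun w => a * f w).
Proof. by move=> Lf; have := Lp_linear a Lf (Lp_cst 0); congr Lp; apply/funext => w; rewrite /= addr0. Qed.

Lemma LpN f : Lp P p G f -> Lp P p G (fun w => - f w).
Proof. by move=> /(LpZ (-1)); congr Lp; apply/funext => w; rewrite mulN1r. Qed.

Lemma LpB f g : Lp P p G f -> Lp P p G g -> Lp P p G (fun w => f w - g w).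
Proof. by move=> Lf /LpN; exact: LpD. Qed.

Lemma Lp_indicM A f : G A -> Lp P p G f -> Lp P p G (\1_A \* f).
Proof.
move=> GA Lf; apply: (Lp_ae_le Lf).
  by apply: measurable_funM; [exact: (gindic sG)|exact: Lp_gmf].
apply: aeW => w; rewrite /= normrM indicE.
by case: (_ \in _); rewrite ?normr1 ?mul1r// normr0 mul0r.
Qed.

Lemma Lp_indic A : G A -> Lp P p G \1_A.
Proof.
move=> GA; have := Lp_indicM GA (Lp_cst 1).
by congr Lp; apply/funext => w /=; rewrite mulr1.
Qed.

Lemma Lp_pos f : Lp P p G f -> Lp_ge0 P p G (fun w => Num.max (f w) 0).
Proof.
move=> Lf; split; last by apply: aeW => w; rewrite le_max lexx orbT.
apply: (Lp_ae_le Lf).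
  by apply: measurable_maxr => //; exact: Lp_gmf.
apply: aeW => w; rewrite ger0_norm ?le_max ?lexx ?orbT// ge_max ler_norm/=.
exact: normr_ge0.
Qed.

Lemma Lp_ge0_lin (a : R) f g : 0 <= a -> Lp_ge0 P p G f -> Lp_ge0 P p G g ->
  Lp_ge0 P p G (a *: f + g).
Proof.
move=> a0 [Lf f0] [Lg g0]; split; first exact: Lp_linear.
by apply: filterS2 f0 g0 => w fw gw; rewrite addr_ge0// mulr_ge0.
Qed.

Lemma Lp_ge0_cst c : 0 <= c -> Lp_ge0 P p G (cst c).
Proof. by move=> c0; split; [exact: Lp_cst|exact: aeW]. Qed.

Lemma Lp_ge0_indicM A f : G A -> Lp_ge0 P p G f -> Lp_ge0 P p G (\1_A \* f).
Proof.
move=> GA [Lf f0]; split; first exact: Lp_indicM.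
by apply: filterS f0 => w f0; rewrite mulr_ge0// indicE.
Qed.

Lemma Lp_itg f : Lp P p G f -> itg P f.
Proof.
move=> Lf; have := @holder_itg p f (cst 1) p1 (Lp_measurable Lf) (measurable_cst _) Lf.2.
have : finite_norm P (hoelder_conjugate p) (cst 1).
  have q1 := hoelder_conj_ge1 p1.
  move: q1; case: (hoelder_conjugate p) => [r|_|//].
    rewrite lee_fin => r1; rewrite finite_norm_itg//; exact: (itg_cst P (`|1| `^ r)).
  by rewrite finite_norm_bounded; exists 1; apply: aeW => w; rewrite normr1.
by move=> h /(_ h); congr itg; apply/funext => w; rewrite /= mulr1.
Qed.

End Lp.
End Lp_spaces.

(** * Positive functionals on L_p and their densities *)

Section positive_functional.
Context d (Omega : measurableType d) (R : realType) (P : probability Omega R).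
Variables (p : \bar R) (G : set (set Omega)).
Hypotheses (p1 : (1 <= p)%E) (sG : subsigma P G).
Notation gmf := (measurable_fun [set: g_sigma_algebraType G]).
Notation Lp := (Lp P p G).
Notation Lpp := (Lp_ge0 P p G).
Variable l : (Omega -> R) -> R.
Hypothesis l_linear : forall (a : R) u v, Lp u -> Lp v -> l (a *: u + v) = a * l u + l v.
Hypothesis l_ge0 : forall u, Lpp u -> 0 <= l u.

Let Lp0 : Lp 0. Proof. exact: (Lp_cst P G p1 0). Qed.

Let l0 : l 0 = 0.
Proof. by have := l_linear 1 Lp0 Lp0; rewrite scaler0 addr0; lra. Qed.

Let lZ a u : Lp u -> l (a *: u) = a * l u.
Proof. by move=> Lu; have := l_linear a Lu Lp0; rewrite !addr0 l0 addr0. Qed.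

Let lD u v : Lp u -> Lp v -> l (u + v) = l u + l v.
Proof. by move=> Lu Lv; have := l_linear 1 Lu Lv; rewrite scale1r mul1r. Qed.

Let l_le u v : Lp u -> Lp v -> {ae P, forall w, u w <= v w} -> l u <= l v.
Proof.
move=> Lu Lv uv; rewrite -subr_ge0 addrC -mulN1r -l_linear//; apply: l_ge0.
split; first exact: Lp_linear.
by apply: filterS uv => w h; rewrite -[leRHS]/(-1 * u w + v w) mulN1r addrC subr_ge0.
Qed.

Let l_ae u v : Lp u -> {ae P, forall w, u w = v w} -> l u = l v.
Proof.
move=> Lu uv; have Lv := Lp_ae_eq p1 sG Lu uv.
by apply/eqP; rewrite eq_le; apply/andP; split; apply: l_le => //;
  apply: filterS uv => w ->.
Qed.

Let sum_half n : \sum_(0 <= k < n) (2^-1 : R) ^+ k <= 2.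
Proof.
suff -> : \sum_(0 <= k < n) (2^-1 : R) ^+ k = 2 - 2 * 2^-1 ^+ n.
  by rewrite gerBl mulr_ge0// exprn_ge0.
elim: n => [|n ih]; first by rewrite big_nil expr0 mulr1 subrr.
by rewrite big_nat_recr//= ih exprS; field.
Qed.

(* If l were unbounded on nonnegative X_n with E[X_n^r] <= 1, it would be
   infinite at X = (sum_n 2^-n X_n^r)^(1/r), which dominates every 2^-n X_n. *)
Lemma positive_functional_bounded (r : R) : p = r%:E -> exists C, 0 <= C /\
  forall X, Lpp X -> Eon P setT (fun w => `|X w| `^ r) <= 1 -> l X <= C.
Proof.
move=> pr; have r1 : 1 <= r by move: p1; rewrite pr lee_fin.
have r0 : 0 < r by exact: lt_le_trans r1.
apply: contrapT => nC.
(* Growth 4^n outweighs the factors 2^-n of the series below: the values of [l] still exceed 2^n. *)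
have /choice[X XP] : forall n : nat, exists X, [/\ Lpp X,
    Eon P setT (fun w => `|X w| `^ r) <= 1 & 4 ^+ n < l X].
  move=> n; apply: contrapT => nX; apply: nC; exists (4 ^+ n).
  split; first exact: exprn_ge0.
  by move=> X LX EX; rewrite leNgt; apply/negP => h; apply: nX; exists X.
have mX n : gmf (X n) by have [[[]]] := XP n.
pose h n w : R := 2^-1 ^+ n * `|X n w| `^ r.
have h0 n w : 0 <= h n w by rewrite mulr_ge0 ?exprn_ge0 ?powR_ge0.
have mh n : gmf (h n).
  apply: measurable_funM => //.
  by apply: (measurableT_comp (measurable_powR r)) => //; exact: measurableT_comp.
have Xi n : itg P (fun w => `|X n w| `^ r).
  have [[LX _] _ _] := XP n.
  by apply/finite_norm_itg => //; [exact: (Lp_measurable sG LX)|rewrite -pr; case: LX].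
have hi n : itg P (h n) by exact: itgZ.
pose H w := (\sum_(0 <= n <oo) (h n w)%:E)%E.
have H0 w : (0 <= H w)%E by apply: nneseries_ge0 => n _ _; rewrite lee_fin.
have mH : gmf H.
  apply: ge0_emeasurable_sum => [n w _ _|n _]; first by rewrite lee_fin.
  exact/measurable_EFinP.
have mHO := gfun_measurable sG mH.
have H2 : (\int[P]_w H w <= 2%:E)%E.
  rewrite integral_nneseries//; last 2 first.
  - by move=> n; apply/measurable_EFinP; exact: (gfun_measurable sG).
  - by move=> n w _; rewrite lee_fin.
  apply: lime_le.
    by apply: is_cvg_ereal_nneg_natsum => n _; apply: integral_ge0 => w _; rewrite lee_fin.
  apply: nearW => n.
  apply: (@le_trans _ _ (\sum_(0 <= k < n) ((2^-1 : R) ^+ k)%:E)%E); last first.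
    by rewrite sumEFin lee_fin sum_half.
  apply: lee_sum => k _; rewrite -[leLHS]EonE// lee_fin EonZ//.
  have [_ Xk _] := XP k.
  by rewrite -[leRHS]mulr1 ler_wpM2l// exprn_ge0.
have Hi : P.-integrable setT H.
  apply/integrableP; split => //; under eq_integral do rewrite gee0_abs//.
  by apply: le_lt_trans H2 _; rewrite ltry.
have Hfin : {ae P, forall w, H w = (fine (H w))%:E}.
  have := integrable_ae measurableT Hi; apply: filterS => w /(_ Logic.I).
  by move=> /fineK.
pose Y w : R := (fine (H w)) `^ r^-1.
have mY : gmf Y.
  by apply: (measurableT_comp (measurable_powR r^-1)) => //; exact: measurableT_comp.
have Y0 w : 0 <= Y w by exact: powR_ge0.
have YE w : `|Y w| `^ r = fine (H w).
  rewrite ger0_norm// /Y -powRrM mulVf ?gt_eqF// powRr1//; exact: fine_ge0.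
have LY : Lp Y.
  split => //; rewrite pr; apply/finite_norm_itg => //.
    exact: (gfun_measurable sG).
  apply/integrableP; split.
    by apply/measurable_EFinP; under eq_fun do rewrite YE; exact: measurableT_comp.
  have /integrableP[_] := Hi; apply: le_lt_trans; apply: ae_ge0_le_integral => //.
  - apply: measurableT_comp => //; apply/measurable_EFinP.
    by under eq_fun do rewrite YE; exact: measurableT_comp.
  - by apply: measurableT_comp.
  by apply: filterS Hfin => w e _ /=; rewrite YE {2}e.
have YX n : {ae P, forall w, 2^-1 ^+ n * X n w <= Y w}.
  apply: filterS Hfin => w e.
  have hH : h n w <= fine (H w).
    rewrite -lee_fin -e.
    apply: le_trans (nneseries_lim_ge n.+1 _) => //; last first.
      by move=> k _ _; rewrite lee_fin.
    rewrite big_nat_recr//= leeDr// sume_ge0// => k _.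
    by rewrite lee_fin.
  have a0 : 0 < (2^-1 : R) ^+ n by exact: exprn_gt0.
  have a1 : (2^-1 : R) ^+ n <= 1 by rewrite exprn_ile1// invf_le1//; lra.
  apply: (@le_trans _ _ (2^-1 ^+ n * `|X n w|)).
    by rewrite ler_wpM2l ?ler_norm// ltW.
  have b0 : 0 <= 2^-1 ^+ n * `|X n w| by rewrite mulr_ge0// ltW.
  have -> : 2^-1 ^+ n * `|X n w| = (2^-1 ^+ n * `|X n w|) `^ r `^ r^-1.
    by rewrite -powRrM mulfV ?gt_eqF// powRr1.
  apply: ge0_ler_powR; rewrite ?nnegrE ?invr_ge0 ?powR_ge0 ?fine_ge0 ?(ltW r0)//.
  (* As [r >= 1] and 2^-n <= 1, the r-th power of 2^-n is at most 2^-n, the weight in [h]. *)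
  apply: le_trans hH; rewrite powRM ?(ltW a0)// /h ler_wpM2r ?powR_ge0//.
  by apply: ge1r_powR; rewrite ?a0.
have Yn n : 2 ^+ n < l Y.
  have [[LX _] _ lX] := XP n.
  have := l_le (Lp_linear p1 sG (2^-1 ^+ n) LX Lp0) LY.
  rewrite addr0 lZ// => /(_ (YX n)); apply: lt_le_trans.
  have -> : (2 : R) ^+ n = 2^-1 ^+ n * 4 ^+ n.
    by rewrite -exprMn; congr (_ ^+ _); field.
  by rewrite ltr_pM2l// exprn_gt0.
have [n hn] : exists n : nat, l Y <= n%:R.
  by exists (Num.truncn (l Y)).+1; exact/ltW/truncnS_gt.
have := lt_le_trans (Yn n) hn; rewrite -natrX ltr_nat.
by rewrite ltnNge ltnW// ltn_expl.
Qed.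

Hypothesis l_regular : p = +oo%E -> forall A : nat -> set Omega,
  (forall n, G (A n)) -> (forall n, A n.+1 `<=` A n) -> \bigcap_n A n = set0 ->
  l (\1_(A n)) @[n --> \oo] --> 0.

Lemma shrinkS (A : nat -> set Omega) : (forall n, A n.+1 `<=` A n) ->
  forall n m, (n <= m)%N -> A m `<=` A n.
Proof.
move=> decA n; elim=> [|m ih]; first by rewrite leqn0 => /eqP ->.
rewrite leq_eqVlt => /predU1P[->//|/ih]; apply: subset_trans; exact: decA.
Qed.

Lemma shrink_near (A : nat -> set Omega) : (forall n, A n.+1 `<=` A n) ->
  \bigcap_n A n = set0 -> forall w, \forall n \near \oo, ~ A n w.
Proof.
move=> decA capA w.
have [n0 An0] : exists n, ~ A n w.
  apply: contrapT => h; have : (\bigcap_n A n) w.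
    by move=> n _; apply: contrapT => nA; apply: h; exists n.
  by rewrite capA.
near=> n => Anw; apply: An0.
by apply: (shrinkS decA) Anw; near: n; exact: nbhs_infty_ge.
Unshelve. all: by end_near. Qed.

(** Continuity from above. For p = oo, [X] is bounded and [l_regular] suffices; for p finite, the
    tails of [X] tend to 0 in norm and [l] is bounded on the positive part of the unit ball. *)
Let l_shrink (X : Omega -> R) (A : nat -> set Omega) : Lpp X ->
  (forall n, G (A n)) -> (forall n, A n.+1 `<=` A n) ->
  \bigcap_n A n = set0 -> l (\1_(A n) \* X) @[n --> \oo] --> 0.
Proof.
move=> [LX X0] GA decA capA.
have mA n := gsetM sG (GA n).
have LA n := Lp_indicM p1 sG (GA n) LX.
have LA0 n : Lpp (\1_(A n) \* X) by apply: Lp_ge0_indicM.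
have [pN|[r pr]] : p = +oo%E \/ exists r, p = r%:E.
- by move: p1; case: p => [r _|_|//]; [right; exists r|left].
- have [C XC] : exists C, {ae P, forall w, `|X w| <= C}.
    by apply/finite_norm_bounded; rewrite -pN; case: LX.
  have C0 : 0 < `|C| + 1 by rewrite ltr_wpDl.
  apply/cvgrPdist_le => e e0.
  have t0 : 0 < e / (`|C| + 1) by rewrite divr_gt0.
  near=> n.
  rewrite sub0r normrN ger0_norm; last exact: l_ge0.
  have : l (\1_(A n)) <= e / (`|C| + 1).
    near: n; have /cvgrPdist_le /(_ _ t0) := l_regular pN GA decA capA.
    apply: filterS => n; rewrite sub0r normrN; exact: le_trans (ler_norm _).
  rewrite ler_pdivlMr// => h; apply: le_trans h.
  have L1 : Lp \1_(A n) by exact: Lp_indic.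
  rewrite mulrC -lZ//; apply: l_le => //; first exact: LpZ.
  apply: filterS XC => w h.
  rewrite -[leRHS]/((`|C| + 1) * \1_(A n) w) [leRHS]mulrC.
  apply: ler_wpM2l; first by rewrite indicE.
  apply: le_trans (ler_norm _) (le_trans h _).
  by rewrite (le_trans (ler_norm _))// lerDl.
have r1 : 1 <= r by move: p1; rewrite pr lee_fin.
have r0 : 0 < r by exact: lt_le_trans r1.
have [C [C0 lC]] := positive_functional_bounded pr.
have Xi : itg P (fun w => `|X w| `^ r).
  by apply/finite_norm_itg => //; [exact: (Lp_measurable sG LX)|rewrite -pr; case: LX].
have Xto0 := Eon_vanish Xi mA (aeW _ (shrink_near decA capA)).
apply/cvgrPdist_le => e e0.
have C1 : 0 < C + 1 by rewrite ltr_wpDl.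
(* Once the r-th moment of [X] on [A n] is below [t ^ r], the variable [1_(A n) X / t] is in the
   unit ball, so [l (1_(A n) X) <= t C <= e]. The [+ 1] guards against [C = 0]. *)
pose t := e / (C + 1); have t0 : 0 < t by rewrite divr_gt0.
have tr0 : 0 < t `^ r by rewrite powR_gt0.
near=> n.
rewrite sub0r normrN ger0_norm; last exact: l_ge0.
have En : Eon P (A n) (fun w => `|X w| `^ r) <= t `^ r.
  near: n; have /cvgrPdist_le /(_ _ tr0) := Xto0.
  apply: filterS => n; rewrite sub0r normrN; exact: le_trans (ler_norm _).
have := lC (t^-1 *: (\1_(A n) \* X)).
rewrite lZ// ler_pdivrMl// => h.
apply: le_trans (h _ _) _.
- have := Lp_ge0_lin p1 sG (ltW (_ : 0 < t^-1)) (LA0 n) (Lp_ge0_cst P G p1 (lexx 0)).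
  by rewrite invr_gt0 => /(_ t0); congr Lp_ge0; apply/funext => w /=; rewrite addr0.
- rewrite (_ : (fun w => _) = fun w => t^-1 `^ r * (\1_(A n) \* (fun w => `|X w| `^ r)) w); last first.
    apply/funext => w /=.
    rewrite -[(t^-1 *: _) w]/(t^-1 * (\1_(A n) w * X w)) normrM powRM//.
    rewrite ger0_norm ?invr_ge0 ?(ltW t0)//; congr (_ * _).
    rewrite indicE; case: (_ \in _); rewrite ?mul1r//.
    by rewrite !mul0r normr0 powR0// gt_eqF.
  rewrite EonZ//; last exact: itg_indicM.
  rewrite EonT_indic (_ : t^-1 `^ r = (t `^ r)^-1); last first.
    by rewrite -[t^-1](powR_inv1 (ltW t0)) powRAC powR_inv1 ?powR_ge0.
  by rewrite ler_pdivrMl ?powR_gt0// mulr1.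
by rewrite /t mulrAC ler_pdivrMr// ler_wpM2l ?(ltW e0)// lerDl.
Unshelve. all: by end_near. Qed.

Let l_indicU (X : Omega -> R) A B : Lpp X -> G A -> G B -> A `&` B = set0 ->
  l (\1_(A `|` B) \* X) = l (\1_A \* X) + l (\1_B \* X).
Proof.
move=> [LX _] GA GB AB; rewrite -lD; [|exact: Lp_indicM..].
congr l; apply/funext => w.
rewrite -[RHS]/(\1_A w * X w + \1_B w * X w) /= -mulrDl; congr (_ * _).
rewrite !indicE in_setU; case: (boolP (w \in A)) => [/set_mem Aw|_]; last by rewrite add0r.
rewrite memNset ?addr0// => Bw.
by have : (A `&` B) w by []; rewrite AB.
Qed.

(** [A |-> l (1_A X)] is a finite measure on [G], absolutely continuous because [l] respects almost
    sure equality. Its countable additivity is [l_shrink] applied to the tails of a disjoint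
    union. *)
Let l_density (X : Omega -> R) : Lpp X -> exists g : Omega -> R,
  [/\ gmf g, forall w, 0 <= g w, itg P g &
  forall A, G A -> l (\1_A \* X) = Eon P A g].
Proof.
move=> LX; have [LX1 X0] := LX.
have lA0 A : G A -> 0 <= l (\1_A \* X).
  by move=> GA; apply: l_ge0; exact: Lp_ge0_indicM.
(* Off [G] the sign of [l (1_A X)] is unknown; the value 0 keeps [nu] nonnegative on all sets. *)
pose nu A : \bar R := if pselect (G A) then (l (\1_A \* X))%:E else 0%E.
have nuE A : G A -> nu A = (l (\1_A \* X))%:E.
  by rewrite /nu; case: pselect.
have G0 := gset0 sG.
have l_set0 : l (\1_set0 \* X) = 0.
  rewrite -[RHS]l0; congr l; apply/funext => w.
  by rewrite /= indic0 mul0r.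
have [|||||g [mg g0 gi gE]] := @radon_nikodym_sub _ _ _ P G sG nu.
- by move=> A; rewrite /nu; case: pselect => // GA; rewrite lee_fin lA0.
- by rewrite nuE// l_set0.
- move=> F GF tF.
  pose A n := \bigcup_(k in [set k | (n <= k)%N]) F k.
  have GA n : G (A n).
    apply/(gmeasurableP sG); apply: bigcup_measurable => k _.
    exact/(gmeasurableP sG).
  have decA n : A n.+1 `<=` A n.
    by move=> w [k /= nk Fk]; exists k => //=; exact: ltnW.
  have capA : \bigcap_n A n = set0.
    apply/seteqP; split => // w Aw.
    have [k _ Fk] := Aw 0%N Logic.I.
    have [k' /= kk' Fk'] := Aw k.+1 Logic.I.
    have := (trivIsetP.1 tF) k k' Logic.I Logic.I.
    rewrite ltn_eqF// => /(_ isT) FF.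
    by have : (F k `&` F k') w by []; rewrite FF.
  have AS n : A n = F n `|` A n.+1.
    apply/seteqP; split => w.
      move=> [k /=]; rewrite leq_eqVlt => /predU1P[->|nk] Fk; first by left.
      by right; exists k.
    by case=> [Fn|]; [exists n => /=|exact: decA].
  have FA n : F n `&` A n.+1 = set0.
    apply/seteqP; split => // w [Fn [k /= nk Fk]].
    have := (trivIsetP.1 tF) n k Logic.I Logic.I.
    rewrite ltn_eqF// => /(_ isT) FF.
    by have : (F n `&` F k) w by []; rewrite FF.
  have UE : \bigcup_n F n = A 0%N by apply: eq_bigcupl; split.
  have sumE n : \sum_(0 <= i < n) l (\1_(F i) \* X) = l (\1_(A 0%N) \* X) - l (\1_(A n) \* X).
    elim: n => [|n ih]; first by rewrite big_nil subrr.
    rewrite big_nat_recr//= ih (AS n) l_indicU//; lra.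
  rewrite UE nuE//.
  rewrite (_ : (fun n => _) = fun n => (l (\1_(A 0%N) \* X) - l (\1_(A n) \* X))%:E); last first.
    apply/funext => n; rewrite -sumE -sumEFin; apply: eq_bigr => i _.
    by rewrite nuE.
  apply: cvg_EFin; first exact: nearW.
  rewrite -[X in _ --> X]subr0; apply: cvgB; first exact: cvg_cst.
  exact: l_shrink.
- by rewrite nuE ?ltry//; exact: (gsetT sG).
- move=> A GA PA; rewrite nuE// -[0%E]/(0%:E) -l0; congr EFin; apply: l_ae.
    exact: Lp_indicM.
  exists A; split => //; first exact: (gsetM sG).
  by move=> w; apply: contra_notP => nAw; rewrite /= indicE memNset// mul0r.
exists g; split => // A GA; apply/eqP; rewrite -eqe; apply/eqP.
by rewrite EonE// -?gE// ?nuE//; exact: (gsetM sG).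
Qed.

(* Comparing l (1_A X) with a l (1_A) for rational a on the level sets of X
   identifies the density of A |-> l (1_A X) as f X. *)
Lemma positive_functional_density : exists f : Omega -> R,
  [/\ gmf f, forall w, 0 <= f w, itg P f &
  forall X, Lp X -> itg P (fun w => f w * X w) /\
                    l X = Eon P setT (fun w => f w * X w)].
Proof.
have L1 : Lpp (cst 1) by exact: (Lp_ge0_cst P G p1 ler01).
have [f [mf f0 fi fE]] := l_density L1.
have {}fE A : G A -> l (\1_A) = Eon P A f.
  move=> GA; rewrite -fE//; congr l; apply/funext => w /=; by rewrite mulr1.
have mfO := gfun_measurable sG mf.
exists f; split=> //.
have pos X : Lpp X -> itg P (fun w => f w * X w) /\
                      l X = Eon P setT (fun w => f w * X w).
  move=> LX; have [LX1 X0] := LX.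
  have mX := Lp_gmf LX1; have mXO := Lp_measurable sG LX1.
  have [g [mg g0 gi gE]] := l_density LX.
  have GleX (a : R) : G [set w | a <= X w].
    apply/(gmeasurableP sG); rewrite -[X in measurable X]setTI.
    exact: measurable_fun_ler.
  have GgeX (a : R) : G [set w | X w <= a].
    apply/(gmeasurableP sG); rewrite -[X in measurable X]setTI.
    exact: measurable_fun_ler.
  have cmp1 (a : R) : {ae P, forall w, a <= X w -> a * f w <= g w}.
    apply: (ae_le_Eon_on sG (GleX a)) => //; [exact: measurable_funM|exact: itgZ|].
    move=> A GA Aa; have mA := gsetM sG GA.
    rewrite EonZ// -fE// -gE// -lZ; last exact: Lp_indic.
    apply: l_le; [by apply: LpZ => //; exact: Lp_indic|exact: Lp_indicM|].
    apply: aeW => w; rewrite -[leLHS]/(a * \1_A w) /= indicE.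
    case: (boolP (w \in _)) => [/set_mem/Aa h|_]; last by rewrite mulr0 mul0r.
    by rewrite mulr1 mul1r.
  have cmp2 (a : R) : {ae P, forall w, X w <= a -> g w <= a * f w}.
    apply: (ae_le_Eon_on sG (GgeX a)) => //; [exact: measurable_funM|exact: itgZ|].
    move=> A GA Aa; have mA := gsetM sG GA.
    rewrite EonZ// -fE// -gE// -lZ; last exact: Lp_indic.
    apply: l_le; [exact: Lp_indicM|by apply: LpZ => //; exact: Lp_indic|].
    apply: aeW => w; rewrite -[leRHS]/(a * \1_A w) /= indicE.
    case: (boolP (w \in _)) => [/set_mem/Aa h|_]; last by rewrite mulr0 mul0r.
    by rewrite mulr1 mul1r.
  have gfX : {ae P, forall w, g w = f w * X w}.
    have h1 : {ae P, forall w, forall n : nat,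
        let a : R := ratr (odflt 0 (unpickle n)) in a <= X w -> a * f w <= g w}.
      by apply: ae_foralln => n; exact: cmp1.
    have h2 : {ae P, forall w, forall n : nat,
        let a : R := ratr (odflt 0 (unpickle n)) in X w <= a -> g w <= a * f w}.
      by apply: ae_foralln => n; exact: cmp2.
    apply: filterS2 h1 h2 => w h1 h2.
    have {}h1 (a : rat) : ratr a <= X w -> ratr a * f w <= g w.
      by have := h1 (pickle a); rewrite /= pickleK.
    have {}h2 (a : rat) : X w <= ratr a -> g w <= ratr a * f w.
      by have := h2 (pickle a); rewrite /= pickleK.
    (* Where [f] vanishes one cannot divide; any rational above [X w] gives [g w <= 0] instead. *)
    have [fw|fw0] := eqVneq (f w) 0.
      rewrite fw mul0r.
      have [a] : exists a : rat, ratr a \in `]X w, (X w + 1)[.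
        by apply: rat_in_itvoo; rewrite ltrDl.
      rewrite in_itv/= => /andP[/ltW /h2 + _].
      by rewrite fw mulr0 => g_le0; apply/eqP; rewrite eq_le g_le0 g0.
    have fw_gt0 : 0 < f w by rewrite lt_neqAle eq_sym fw0 f0.
    rewrite mulrC; apply/eqP; rewrite -[g w](divfK fw0) (inj_eq (mulIf fw0)).
    have [lt|gt|//] := ltgtP (g w / f w) (X w).
      have [a] := rat_in_itvoo lt.
      rewrite in_itv/= => /andP[h /ltW/h1]; rewrite -ler_pdivlMr// => h'.
      by have := lt_le_trans h h'; rewrite ltxx.
    have [a] := rat_in_itvoo gt.
    rewrite in_itv/= => /andP[/ltW/h2 + h]; rewrite -ler_pdivrMr// => h'.
    by have := lt_le_trans h h'; rewrite ltxx.
  have fXi : itg P (fun w => f w * X w).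
    apply: itg_ae_eq gfX gi; exact: measurable_funM.
  split=> //.
  have := gE _ (gsetT sG); rewrite (_ : \1_setT \* X = X); last first.
    by apply/funext => w /=; rewrite indicE in_setT mul1r.
  move=> ->; apply: Eon_ae_eq => //; first exact: (itg_measurable gi).
  exact: measurable_funM.
move=> X LX.
have [LXp Xp0] := Lp_pos p1 sG LX.
have [LXn Xn0] := Lp_pos p1 sG (LpN p1 sG LX).
have [ip ep] := pos _ (conj LXp Xp0); have [in_ en] := pos _ (conj LXn Xn0).
have XE w : X w = -1 * Num.max (- X w) 0 + Num.max (X w) 0.
  by rewrite mulN1r addrC; exact/esym/(congr1 (@^~ w) (funrposBneg X)).
have fXE : (fun w => f w * X w) =
  fun w => f w * Num.max (X w) 0 - f w * Num.max (- X w) 0.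
  by apply/funext => w; rewrite {1}XE; ring.
split; first by rewrite fXE; exact: itgB.
rewrite fXE EonB// -ep -en.
have E : X = -1 *: (fun w => Num.max (- X w) 0) + (fun w => Num.max (X w) 0).
  by apply/funext => w; exact: XE.
by rewrite [in LHS]E l_linear// mulN1r addrC.
Qed.

End positive_functional.

(** * Converse of Hölder's inequality *)

Section converse_holder.
Context d (Omega : measurableType d) (R : realType) (P : probability Omega R).
Variables (p : \bar R) (G : set (set Omega)).
Hypotheses (p1 : (1 <= p)%E) (sG : subsigma P G).
Notation gmf := (measurable_fun [set: g_sigma_algebraType G]).

(** Integration against [f] is a positive functional, so for p finite it is bounded on the positive
    part of the unit ball by [positive_functional_bounded]; testing it on suitable variables of norm
    1 bounds the L_q norm of [f]. For p = oo, integrability of [f] is all that is claimed. *)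
Lemma converse_holder (f : Omega -> R) : gmf f -> (forall w, 0 <= f w) ->
  (forall X, Lp_ge0 P p G X -> itg P (fun w => f w * X w)) ->
  Lp P (hoelder_conjugate p) G f.
Proof.
move=> mf f0 fi; split => //; have mfO := gfun_measurable sG mf.
have f1i : itg P f.
  have := fi _ (Lp_ge0_cst P G p1 ler01).
  by congr itg; apply/funext => w; rewrite mulr1.
have [pN|[r pr]] : p = +oo%E \/ exists r, p = r%:E.
- by move: p1; case: p => [r _|_|//]; [right; exists r|left].
- rewrite pN hoelder_conjugatey finite_norm_itg//.
  have := itg_norm f1i; congr itg; apply/funext => w.
  by rewrite powRr1.
have r1 : 1 <= r by move: p1; rewrite pr lee_fin.
have r0 : 0 < r by exact: lt_le_trans r1.
pose l (X : Omega -> R) := Eon P setT (fun w => f w * X w).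
have fiL X : Lp P p G X -> itg P (fun w => f w * X w).
  move=> LX; have h1 := fi _ (Lp_pos p1 sG LX).
  have h2 := fi _ (Lp_pos p1 sG (LpN p1 sG LX)).
  apply: (@itg_ae_le _ _ _ _ (fun w => f w * Num.max (X w) 0 + f w * Num.max (- X w) 0)).
  - by apply: measurable_funM => //; exact: Lp_measurable LX.
  - apply: aeW => w; rewrite normrM (ger0_norm (f0 w)) -mulrDr ler_wpM2l//.
    have [h|h] := leP (X w) 0.
      by rewrite (max_idPl (_ : 0 <= - X w)) ?oppr_ge0// ler0_norm// add0r.
    by rewrite (max_idPr (_ : - X w <= 0)) ?oppr_le0 ?(ltW h)// gtr0_norm// addr0.
  exact: itgD.
have l_linear (a : R) u v : Lp P p G u -> Lp P p G v -> l (a *: u + v) = a * l u + l v.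
  move=> Lu Lv; rewrite /l -EonZ//; last exact: fiL.
  rewrite -EonD//; [|by apply: itgZ; exact: fiL|exact: fiL].
  apply: eq_Rintegral => w _.
  by rewrite -[(a *: u + v) w]/(a * u w + v w) mulrDr mulrCA.
have l_ge0 u : Lp_ge0 P p G u -> 0 <= l u.
  move=> [Lu u0]; apply: Eon_ge0 => //; first exact: itg_measurable (fiL _ Lu).
  by apply: filterS u0 => w ?; rewrite mulr_ge0.
have [C [C0 lC]] := positive_functional_bounded p1 sG l_linear l_ge0 pr.
have [r_1|rN1] := eqVneq r 1.
  rewrite pr r_1 hoelder_conjugate1 finite_norm_bounded; exists C.
  pose A := [set w | C < f w].
  have GA : G A.
    apply/(gmeasurableP sG); rewrite -[X in measurable X]setTI.
    exact: measurable_fun_ltr.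
  have mA := gsetM sG GA.
  have PA0 : P A = 0%E.
    apply: contrapT => /eqP PA.
    have PA_gt0 : 0 < fine (P A).
      by rewrite fine_gt0// lt0e PA measure_ge0/= ltey_eq fin_num_measure.
    (* The indicator of the event where [f > C], normalized in L_1. The bound on it makes the mean
       of [f - C] over that event nonpositive. *)
    have LA : Lp_ge0 P p G ((fine (P A))^-1 *: \1_A + cst 0).
      apply: Lp_ge0_lin => //; first by rewrite invr_ge0 ltW.
        split; first exact: Lp_indic.
        by apply: aeW => w; rewrite indicE.
      exact: Lp_ge0_cst.
    have LAE : (fine (P A))^-1 *: \1_A + cst 0 = fun w => (fine (P A))^-1 * \1_A w.
      by apply/funext => w; rewrite -[RHS]addr0.
    have lA : l (fun w => (fine (P A))^-1 * \1_A w) <= C.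
      apply: lC; first by rewrite -LAE.
      rewrite r_1 (_ : (fun w => _) = fun w => (fine (P A))^-1 * \1_A w); last first.
        apply/funext => w; by rewrite powRr1// ger0_norm// mulr_ge0// ?invr_ge0 ?(ltW PA_gt0)// indicE.
      rewrite EonZ//; last exact: itg_indic.
      rewrite (_ : \1_A = \1_A \* cst 1); last by apply/funext => w /=; rewrite mulr1.
      by rewrite EonT_indic Eon_cst// mul1r mulVf// gt_eqF.
    have h : Eon P A (fun w => f w - C) <= 0.
      rewrite EonB//; last exact: itg_cst.
      rewrite Eon_cst// subr_le0.
      move: lA; rewrite /l.
      rewrite (_ : (fun w => _) = fun w => (fine (P A))^-1 * (\1_A \* f) w); last first.
        by apply/funext => w /=; rewrite mulrCA [f w * _]mulrC.
      rewrite EonZ//; last exact: itg_indicM.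
      by rewrite EonT_indic ler_pdivrMl// mulrC.
    have hA w : A w -> 0 <= f w - C by rewrite subr_ge0 => /ltW.
    have := Eon_le0_ae_le0 mA (itgB f1i (itg_cst P C)) hA h.
    move=> [N [mN N0 sub]]; move/eqP: PA; apply.
    apply: (subset_measure0 mA mN _ N0) => w Aw; apply: sub => /= /(_ Aw) e.
    by move: Aw; rewrite /A /= -subr_gt0 e ltxx.
  exists A; split => // w /= /negP; rewrite -ltNge ger0_norm//.
have r1' : 1 < r by rewrite lt_neqAle eq_sym rN1.
pose q := r / (r - 1).
have rB : 0 < r - 1 by rewrite subr_gt0.
have q0 : 0 < q by rewrite divr_gt0.
have q1 : 1 <= q by rewrite ler_pdivlMr// mul1r; lra.
have -> : hoelder_conjugate p = q%:E.
  by rewrite pr /hoelder_conjugate/= eqe gt_eqF// -EFinB inver subr_eq0 gt_eqF.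
(* Truncation makes the q-th moment [K] finite, so that dividing by a power of [K] is legitimate. *)
pose fn (n : nat) w := Num.min (f w) n%:R.
have fn0 n w : 0 <= fn n w by rewrite le_min f0 ler0n.
have mfn n : gmf (fn n) by apply: measurable_minr.
have mpow s n : gmf (fun w => fn n w `^ s).
  by apply: (measurableT_comp (measurable_powR s)).
have Lpow s n : 0 <= s -> Lp P p G (fun w => fn n w `^ s).
  move=> s0; apply: (Lp_ae_le p1 sG (Lp_cst P G p1 (n%:R `^ s))) => //.
  apply: aeW => w; rewrite !ger0_norm ?powR_ge0//.
  by apply: ge0_ler_powR => //; rewrite ?nnegrE// ge_min lexx orbT.
have K_le n : Eon P setT (fun w => fn n w `^ q) <= C `^ q.
  set K := Eon _ _ _.
  have K0 : 0 <= K.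
    by apply: Rintegral_ge0 => w _; exact: powR_ge0.
  have [->|KN0] := eqVneq K 0; first exact: powR_ge0.
  have K_gt0 : 0 < K by rewrite lt_neqAle eq_sym KN0.
  have qi : itg P (fun w => fn n w `^ q) by apply: (Lp_itg p1 sG); apply: Lpow; exact: ltW.
  (* The extremal variable in Hölder's inequality: [(q - 1) r = q] gives it norm 1, and
     [K ^ (1/q) <= l Y <= C]. *)
  pose Y w := K `^ (- r^-1) * fn n w `^ (q - 1).
  have q10 : 0 <= q - 1 by rewrite subr_ge0.
  have LY : Lp_ge0 P p G Y.
    split; first by apply: (LpZ p1 sG); exact: Lpow.
    by apply: aeW => w; rewrite mulr_ge0 ?powR_ge0.
  have lY : l Y <= C.
    apply: lC => //.
    rewrite (_ : (fun w => _) = fun w => K^-1 * fn n w `^ q); last first.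
      apply/funext => w; rewrite ger0_norm ?mulr_ge0 ?powR_ge0// powRM ?powR_ge0//.
      rewrite -!powRrM mulNr mulVf ?gt_eqF// powR_inv1//; congr (_ * _ `^ _).
      by rewrite /q; field; rewrite gt_eqF.
    by rewrite EonZ// mulVf.
  have : K `^ (- r^-1) * K <= l Y.
    rewrite -EonZ//; apply: Eon_ae_le => //; [exact: itgZ|exact: fi|].
    apply: aeW => w; rewrite /Y mulrCA ler_wpM2l ?powR_ge0//.
    rewrite -(mulr_powRB1 (fn0 n w) q0) ler_wpM2r ?powR_ge0//.
    by rewrite ge_min lexx.
  move=> /le_trans/(_ lY).
  have -> : K `^ (- r^-1) * K = K `^ q^-1.
    rewrite -[X in _ * X](powRr1 (ltW K_gt0)) -powRD; last by rewrite KN0 implybT.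
    by congr (_ `^ _); rewrite /q; field; rewrite !gt_eqF.
  move=> h; rewrite -[leLHS](powRr1 K0) -(@mulVf _ q) ?gt_eqF// powRrM.
  by apply: ge0_ler_powR; rewrite ?nnegrE ?powR_ge0// ltW.
rewrite finite_norm_itg//; apply/integrableP.
have mfq : measurable_fun setT (fun w => `|f w| `^ q).
  by apply: (measurableT_comp (measurable_powR q)) => //; exact: measurableT_comp.
split; first exact/measurable_EFinP.
under eq_integral do rewrite gee0_abs ?lee_fin ?powR_ge0//.
have limE w : (`|f w| `^ q)%:E = limn (fun n => (fn n w `^ q)%:E).
  apply/esym/cvg_lim => //; apply: cvg_near_cst; near=> n.
  rewrite ger0_norm// /fn (min_idPl _)//; near: n; exact: nbhs_infty_ger.
rewrite (_ : (fun w => (`|f w| `^ q)%:E) = fun w => limn (fun n => (fn n w `^ q)%:E)); last first.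
  by apply/funext.
rewrite monotone_convergence//; last 3 first.
- by move=> n; apply/measurable_EFinP; apply: (gfun_measurable sG).
- by move=> n w _; rewrite lee_fin powR_ge0.
- move=> w _ m n mn; rewrite lee_fin; apply: ge0_ler_powR; rewrite ?nnegrE ?(ltW q0)//.
  by rewrite /fn le_min ge_min lexx/= ge_min ler_nat mn orbT.
apply: (@le_lt_trans _ _ (C `^ q)%:E); last exact: ltry.
apply: lime_le.
  apply: ereal_nondecreasing_is_cvgn => m n mn.
  apply: ge0_le_integral => //.
  - by move=> w _; rewrite lee_fin powR_ge0.
  - by apply/measurable_EFinP; exact: (gfun_measurable sG).
  - by apply/measurable_EFinP; exact: (gfun_measurable sG).
  - move=> w _; rewrite lee_fin; apply: ge0_ler_powR; rewrite ?nnegrE ?(ltW q0)//.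
    by rewrite /fn le_min ge_min lexx/= ge_min ler_nat mn orbT.
apply: nearW => n.
rewrite -[leLHS]EonE// ?lee_fin//.
by apply: (Lp_itg p1 sG); apply: Lpow; exact: ltW.
Unshelve. all: by end_near. Qed.

End converse_holder.

(** * One time step *)

Section operators_facts.
Context d (Omega : measurableType d) (R : realType) (P : probability Omega R).
Variable p : \bar R.
Hypothesis p1 : (1 <= p)%E.

Section sandwich_convex.
Variables (G : set (set Omega)) (D : set (Omega -> R)).
Hypotheses (sG : subsigma P G).
Variables (x m M : (Omega -> R) -> Omega -> R).
Hypothesis D_linear : forall (a : R) X Y, D X -> D Y -> D (a *: X + Y).
Hypothesis D0 : D 0.
Hypothesis x_convex : op_convex P D x.
Hypothesis x_sandwich : sandwich P p G D x m M.
Hypothesis m_hom : positively_homogeneous P (Lp_ge0 P p G) m.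
Hypothesis M_hom : positively_homogeneous P (Lp_ge0 P p G) M.

Let DZ (a : R) X : D X -> D (a *: X).
Proof. by move=> DX; have := D_linear a DX D0; rewrite addr0. Qed.

(* For theta = 1 / (n + 2), write X as the convex combination of (1 + theta) X'
   and of a multiple of X - X'; positive homogeneity of m and M absorbs the
   weight of the latter, and theta tends to 0. *)
Lemma sandwich_convex_le X X' Y Z : D X -> D X' ->
  Lp_ge0 P p G Y -> Lp_ge0 P p G Z ->
  {ae P, forall w, Z w + X w <= Y w + X' w} ->
  {ae P, forall w, m Z w + x X w <= M Y w + x X' w}.
Proof.
move=> DX DX' LY LZ ZXY.
have step n : {ae P, forall w, let t : R := n.+2%:R^-1 in
    (1 + t) * (m Z w + x X w - M Y w) <= (1 - t) * x X' w + t * x (2 *: X') w}.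
  pose t : R := n.+2%:R^-1.
  have t0 : 0 < t by rewrite invr_gt0.
  have t1 : t < 1 by rewrite invf_lt1// ltr1n.
  have D1 : D ((1 + t) *: X') by exact: DZ.
  (* With [a = 1 / (1 + t)] one has [(1 - a) c = 1], so [X] is the combination of [(1 + t) X'] and
     [c (X - X')] with weights [a] and [1 - a]. *)
  pose c : R := (1 + t) / t.
  have c0 : 0 < c by rewrite divr_gt0// addr_gt0.
  have D2 : D (c *: (X - X')).
    by apply: DZ; rewrite addrC -scaleN1r; exact: D_linear.
  have LcY : Lp_ge0 P p G (c *: Y).
    have := Lp_ge0_lin p1 sG (ltW c0) LY (Lp_ge0_cst P G p1 (lexx 0)).
    by rewrite (_ : c *: Y + cst 0 = c *: Y)//; apply/funext => w; exact: addr0.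
  have LcZ : Lp_ge0 P p G (c *: Z).
    have := Lp_ge0_lin p1 sG (ltW c0) LZ (Lp_ge0_cst P G p1 (lexx 0)).
    by rewrite (_ : c *: Z + cst 0 = c *: Z)//; apply/funext => w; exact: addr0.
  have sw : {ae P, forall w, m (c *: Z) w + x (c *: (X - X')) w <= M (c *: Y) w}.
    apply: x_sandwich => //; apply: filterS ZXY => w h.
    rewrite -[leLHS]/(c * Z w + c * (X w - X' w)) -[leRHS]/(c * Y w) -mulrDr.
    by rewrite ler_pM2l//; lra.
  have mc := m_hom LZ (ltW c0); have Mc := M_hom LY (ltW c0).
  (* [(1 + t) X' = (1 - t) X' + t (2 X')]: a bound through [X'] and [2 X'] alone stays controlled as
     [t] tends to 0, which a bound on [x ((1 + t) X')] by itself would not show. *)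
  have cv2 := @x_convex X' (2 *: X') (1 - t) DX' (DZ 2 DX').
  have {}cv2 : {ae P, forall w, x ((1 + t) *: X') w <= (1 - t) * x X' w + t * x (2 *: X') w}.
    have -> : (1 + t) *: X' = (1 - t) *: X' + (1 - (1 - t)) *: (2 *: X').
      by rewrite scalerA -scalerDl; congr (_ *: _); ring.
    have -> : t = 1 - (1 - t) by ring.
    rewrite (_ : 1 - (1 - (1 - t)) = 1 - t); last by ring.
    by apply: cv2; rewrite subr_ge0 (ltW t1)/= lerBlDr lerDl ltW.
  pose a := (1 + t)^-1.
  have t10 : 1 + t != 0 by rewrite gt_eqF// addr_gt0.
  have a01 : 0 <= a <= 1.
    by rewrite invr_ge0 addr_ge0 ?(ltW t0)//= invf_le1 ?lerDl ?(ltW t0)// addr_gt0.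
  have cv1 := x_convex D1 D2 a01.
  have XE : a *: ((1 + t) *: X') + (1 - a) *: (c *: (X - X')) = X.
    rewrite !scalerA mulVf// scale1r.
    have -> : (1 - a) * c = 1 by rewrite /a /c; field; rewrite t10 gt_eqF.
    by rewrite scale1r addrCA subrr addr0.
  rewrite XE in cv1.
  apply: filterS3 (filterI cv1 cv2) sw (filterI mc Mc) => w [h1 h2] h3 [h4 h5] /=; rewrite -/t.
  move: h4 h5 => /(_ Logic.I) h4 /(_ Logic.I) h5.
  rewrite {}h4 {}h5 -[(c *: m Z) w]/(c * m Z w) -[(c *: M Y) w]/(c * M Y w) in h3.
  have h6 : (1 + t) * x X w <= x ((1 + t) *: X') w + t * x (c *: (X - X')) w.
    have := ler_wpM2l (ltW (addr_gt0 ltr01 t0)) h1.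
    rewrite mulrDr !mulrA mulfV// mul1r.
    have -> : (1 + t) * (1 - a) = t by rewrite /a; field; exact: t10.
    by [].
  have h7 : (1 + t) * m Z w + t * x (c *: (X - X')) w <= (1 + t) * M Y w.
    have tc : 1 + t = t * c by rewrite /c; field; rewrite gt_eqF.
    by rewrite tc -(mulrA t c (m Z w)) -(mulrA t c (M Y w)) -mulrDr ler_pM2l.
  rewrite mulrBr mulrDr; lra.
have := ae_foralln step.
apply: filterS => w h.
rewrite -lerBlDl leNgt; apply/negP => lt.
set u := m Z w + x X w - M Y w in lt.
set b := x (2 *: X') w.
(* If the claim failed at [w], [step] would bound [(n + 2) (u - x X' w)], with a positive second
   factor, independently of [n]. *)
have [n hn] : exists n : nat, `|b - x X' w - u| < (u - x X' w) * n%:R.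
  exists (Num.truncn (`|b - x X' w - u| / (u - x X' w))).+1.
  by rewrite mulrC -ltr_pdivrMr ?subr_gt0//; exact: truncnS_gt.
have := h n; rewrite /= -/u -/b => {}h.
have n0 : (0 : R) < n.+2%:R by [].
have arith (t u' a b' : R) : (1 + t) * u' <= (1 - t) * a + t * b' ->
    u' - a <= t * (b' - a - u') by nra.
have {h} h := arith _ _ _ _ h.
rewrite ler_pdivlMl// in h.
have : (u - x X' w) * n%:R <= n.+2%:R * (u - x X' w).
  rewrite mulrC; apply: ler_wpM2r; first by rewrite subr_ge0 ltW.
  by rewrite ler_nat (leqW (leqnSn n)).
have := ler_norm (b - x X' w - u); lra.
Qed.

End sandwich_convex.

Section mM.
Variables (G H : set (set Omega)).
Hypotheses (sG : subsigma P G).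
Variables (m : (Omega -> R) -> Omega -> R).
Notation Lpp := (Lp_ge0 P p G).
Hypothesis m_op : operator P Lpp (Lp_ge0 P p H) m.

Lemma hom_zero : positively_homogeneous P Lpp m -> {ae P, forall w, m 0 w = 0}.
Proof.
move=> m_hom; have := m_hom _ 0 (Lp_ge0_cst P G p1 (lexx 0)) (lexx 0).
rewrite !scale0r; apply: filterS => w /(_ Logic.I) ->; by [].
Qed.

(** m(Y) >= m(X) + m(Y - X) and the last term is nonnegative. *)
Lemma superlinear_monotone X Y : superlinear P Lpp m -> Lpp X -> Lpp Y ->
  {ae P, forall w, X w <= Y w} -> {ae P, forall w, m X w <= m Y w}.
Proof.
move=> [m_super _] LX LY XY.
have LYX : Lpp (Y - X).
  split; first by apply: (LpB p1 sG); [case: LY|case: LX].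
  by apply: filterS XY => w; rewrite -[(Y - X) w]/(Y w - X w) subr_ge0.
have h := m_super _ _ LX LYX.
rewrite (addrC X) subrK in h.
have [_ m0] := m_op.1 _ LYX.
by apply: filterS2 h m0 => w; lra.
Qed.

End mM.
End operators_facts.

(** * Sandwich bounds, admissible densities and penalties between two times *)

Section one_step.
Context d (Omega : measurableType d) (R : realType) (P : probability Omega R).
Variables (T : R) (F : R -> set (set Omega)) (p : \bar R) (TT : set R).
Variables (L : R -> set (Omega -> R)) (x m M : R -> R -> (Omega -> R) -> Omega -> R).

Record sandwich_setting : Prop := {
  setting_filtration : augmented_filtration P T F ;
  setting_p_ge1 : (1 <= p)%E ;
  setting_bounds : forall t, TT t -> 0 <= t <= T ;
  setting_0 : TT 0 ;
  setting_T : TT T ;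
  setting_star : star_system P p T F TT L x ;
  setting_mM : mM_condition P p T F TT m M ;
  setting_sandwich : sandwich_condition P p F TT L x m M }.

Hypothesis S : sandwich_setting.
Let F_filtration := setting_filtration S.
Let p1 := setting_p_ge1 S.
Let TT_bounds := setting_bounds S.
Let TT0 := setting_0 S.
Let TTT := setting_T S.
Let x_star := setting_star S.
Let mM := setting_mM S.
Let x_sandwich := setting_sandwich S.
Let q := hoelder_conjugate p.

Lemma filtration_subsigma t : TT t -> subsigma P (F t).
Proof.
move=> /TT_bounds t0T; split.
- exact: (filtration_sigma_algebra F_filtration).
- exact: (filtration_measurable F_filtration).
- move=> N nN; have [C [_ _ ->]] := filtration_generated F_filtration t0T.
  by apply: sub_sigma_algebra; right.
Qed.

Lemma filtration_le s t : TT s -> TT t -> s <= t -> F s `<=` F t.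
Proof.
move=> /TT_bounds/andP[s0 _] /TT_bounds/andP[_ tT] st.
exact: (filtration_nondecreasing F_filtration).
Qed.

Lemma gfun_le s t d' (U : measurableType d') (f : Omega -> U) :
  TT s -> TT t -> s <= t ->
  measurable_fun [set: g_sigma_algebraType (F s)] f ->
  measurable_fun [set: g_sigma_algebraType (F t)] f.
Proof.
move=> Ts Tt st mf _ B mB; rewrite setTI.
apply/(gmeasurableP (filtration_subsigma Tt)); apply: (filtration_le Ts Tt st).
exact: (gfun_preimage (filtration_subsigma Ts)).
Qed.

Lemma Lp_le s t f : TT s -> TT t -> s <= t -> Lp P p (F s) f -> Lp P p (F t) f.
Proof. by move=> Ts Tt st [mf ff]; split => //; exact: gfun_le mf. Qed.

Section step.
Variables s t : R.
Hypotheses (Ts : TT s) (Tt : TT t) (st : s <= t).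
Let sG := filtration_subsigma Tt.
Let sH := filtration_subsigma Ts.
Let HG := filtration_le Ts Tt st.
Notation Lpt := (Lp P p (F t)).
Notation Lppt := (Lp_ge0 P p (F t)).
Notation ce := (rce P (F s)).
Notation Dse := (DSe P p F m M s t).
Notation Exp := (Eon P setT).

Lemma m_op : operator P Lppt (Lp_ge0 P p (F s)) (m s t).
Proof. exact: (mM_operator_m mM). Qed.
Lemma M_op : operator P Lppt (Lp_ge0 P p (F s)) (M s t).
Proof. exact: (mM_operator_M mM). Qed.
Lemma m_Lp X : Lppt X -> Lp P p (F s) (m s t X).
Proof. by move=> LX; have [] := m_op.1 _ LX. Qed.
Lemma M_Lp X : Lppt X -> Lp P p (F s) (M s t X).
Proof. by move=> LX; have [] := M_op.1 _ LX. Qed.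
Lemma m_itg X : Lppt X -> itg P (m s t X).
Proof. by move=> /m_Lp /(Lp_itg p1 sH). Qed.
Lemma M_itg X : Lppt X -> itg P (M s t X).
Proof. by move=> /M_Lp /(Lp_itg p1 sH). Qed.
Lemma m_zero : {ae P, forall w, m s t 0 w = 0}.
Proof. apply: (hom_zero p1 (G := F t)); exact: (mM_superlinear mM Ts Tt st).2. Qed.
Lemma M_zero : {ae P, forall w, M s t 0 w = 0}.
Proof. apply: (hom_zero p1 (G := F t)); exact: (mM_sublinear mM Ts Tt st).2. Qed.

(** Locality: an expectation inequality for m that is valid for all arguments can be applied to
    [1_A X], and thereby becomes an inequality of integrals over every event of [F s]. *)
Lemma m_localE A X : F s A -> Lppt X -> Eon P A (m s t X) = Exp (m s t (\1_A \* X)).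
Proof.
move=> HA LX; have LAX := Lp_ge0_indicM p1 sG (HG HA) LX.
rewrite -EonT_indic; apply: Eon_ae_eq => //.
- by apply: measurable_funM; [exact/measurable_indic/(gsetM sH)|exact/itg_measurable/m_itg].
- by apply: itg_measurable; exact: m_itg.
have := mM_weak_homogeneous_m mM Ts Tt st HA LX LAX.
by apply: filterS => w /(_ Logic.I) ->.
Qed.

Lemma M_localE A X : F s A -> Lppt X -> Eon P A (M s t X) = Exp (M s t (\1_A \* X)).
Proof.
move=> HA LX; have LAX := Lp_ge0_indicM p1 sG (HG HA) LX.
rewrite -EonT_indic; apply: Eon_ae_eq => //.
- by apply: measurable_funM; [exact/measurable_indic/(gsetM sH)|exact/itg_measurable/M_itg].
- by apply: itg_measurable; exact: M_itg.
have := mM_weak_homogeneous_M mM Ts Tt st HA LX LAX.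
by apply: filterS => w /(_ Logic.I) ->.
Qed.

Lemma L_Lp X : L t X -> Lpt X. Proof. exact: (star_Lp x_star). Qed.
Lemma L0 : L t 0. Proof. exact: (star_zero x_star Tt). Qed.
Lemma x_Ls X : L t X -> L s (x s t X).
Proof. exact: (star_operator x_star Ts Tt st).1. Qed.
Lemma x_Lp X : L t X -> Lp P p (F s) (x s t X).
Proof. by move=> /x_Ls; exact: (star_Lp x_star). Qed.
Lemma x_itg X : L t X -> itg P (x s t X).
Proof. by move=> /x_Lp /(Lp_itg p1 sH). Qed.
Lemma L_cst (c : R) : L t (cst c).
Proof.
have := star_linear x_star c Tt (star_one x_star Tt) L0; rewrite addr0.
by congr (L t _); apply/funext => w; exact: mulr1.
Qed.
Lemma x_cst (c : R) : {ae P, forall w, x s t (cst c) w = c}.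
Proof.
apply/aeTP; apply: (star_projection x_star Ts Tt st); last exact: L_cst.
exact: Lp_cst.
Qed.
Lemma x_zero : {ae P, forall w, x s t 0 w = 0}.
Proof. exact: (x_cst 0). Qed.

Section Dse_facts.
Variable f : Omega -> R.
Hypothesis Df : Dse f.

Lemma Dse_Lq : Lp P q (F t) f. Proof. by case: Df. Qed.
Lemma Dse_gt0 : {ae P, forall w, 0 < f w}. Proof. by case: Df. Qed.
Lemma Dse_measurable : measurable_fun setT f.
Proof. by have [mf _] := Dse_Lq; exact: (gfun_measurable sG mf). Qed.

Lemma Dse_itgM X : Lpt X -> itg P (fun w => f w * X w).
Proof.
move=> LX; have := holder_itg p1 (Lp_measurable sG LX) Dse_measurable LX.2 Dse_Lq.2.
by congr itg; apply/funext => w; rewrite mulrC.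
Qed.

Lemma Dse_itg : itg P f.
Proof.
have := Dse_itgM (Lp_cst P (F t) p1 1).
by congr itg; apply/funext => w; rewrite mulr1.
Qed.

Lemma Dse_one A : F s A -> Eon P A f = fine (P A).
Proof.
move=> HA; have mA := gsetM sH HA.
rewrite -(rceE sH Dse_itg HA) -[RHS]mul1r -Eon_cst//.
apply: Eon_ae_eq => //; first exact: (itg_measurable (rce_itg sH Dse_itg)).
have [_ _ /aeTP h _] := Df.
apply: filterS2 h (cond_exp_rce sH Dse_itg) => w -> [] <-.
by [].
Qed.

Lemma Dse_m X : Lppt X -> {ae P, forall w, m s t X w <= ce (fun w => f w * X w) w}.
Proof.
move=> LX; have [_ _ _ h] := Df; have fXi := Dse_itgM LX.1.
apply: filterS2 (h _ LX) (cond_exp_rce sH fXi) => w /andP[+ _].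
by rewrite -[(f \* X)]/(fun w => f w * X w) => + e; rewrite e lee_fin.
Qed.

Lemma Dse_M X : Lppt X -> {ae P, forall w, ce (fun w => f w * X w) w <= M s t X w}.
Proof.
move=> LX; have [_ _ _ h] := Df; have fXi := Dse_itgM LX.1.
apply: filterS2 (h _ LX) (cond_exp_rce sH fXi) => w /andP[_ +].
by rewrite -[(f \* X)]/(fun w => f w * X w) => + e; rewrite e lee_fin.
Qed.

End Dse_facts.

(** The conditional clauses of [DSe] in integrated form over the events of [F s], which is the form
    a scalar functional delivers. *)
Lemma Dse_intro f : Lp P q (F t) f -> {ae P, forall w, 0 < f w} ->
  (forall A, F s A -> Eon P A f = fine (P A)) ->
  (forall X, Lppt X -> itg P (fun w => f w * X w) /\
    forall A, F s A -> Eon P A (m s t X) <= Eon P A (fun w => f w * X w) <= Eon P A (M s t X)) ->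
  Dse f.
Proof.
move=> Lf f0 f1 fmM.
have fi : itg P f.
  have [h _] := fmM _ (Lp_ge0_cst P (F t) p1 ler01).
  by move: h; congr itg; apply/funext => w; rewrite mulr1.
split => //.
- apply/aeTP; have h : {ae P, forall w, ce f w = cst 1 w}.
    apply: (rce_unique sH) => //; first exact: itg_cst.
    by move=> A HA; rewrite f1// Eon_cst ?mul1r//; exact: (gsetM sH).
  by apply: filterS2 h (cond_exp_rce sH fi) => w -> ->.
- move=> X LX; have [fXi h] := fmM X LX.
  have h1 : {ae P, forall w, m s t X w <= ce (fun w => f w * X w) w}.
    apply: (rce_ge sH) => //; [exact: m_itg|by case: (m_Lp LX)|].
    by move=> A HA; have /andP[] := h A HA.
  have h2 : {ae P, forall w, ce (fun w => f w * X w) w <= M s t X w}.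
    apply: (rce_le sH) => //; [exact: M_itg|by case: (M_Lp LX)|].
    by move=> A HA; have /andP[] := h A HA.
  apply: filterS3 h1 h2 (cond_exp_rce sH fXi) => w a b.
  by rewrite -[(f \* X)]/(fun w => f w * X w) => ->; rewrite !lee_fin a b.
Qed.

Notation alpha := (min_penalty P F L x s t).

Section penalty.
Variable f : Omega -> R.
Hypothesis fi : forall X, Lpt X -> itg P (fun w => f w * X w).

Let family := [set Y | exists2 X, L t X &
    Y = (fun w => cond_exp P (F s) (EFin \o (f \* X)%R) w - (x s t X w)%:E)%E].

Let family_rce X : L t X -> {ae P, forall w,
  (ce (fun w => f w * X w) w - x s t X w)%:E =
  (cond_exp P (F s) (EFin \o (f \* X)%R) w - (x s t X w)%:E)%E}.
Proof.
move=> LX; apply: filterS (cond_exp_rce sH (fi (L_Lp LX))) => w.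
by rewrite -[(f \* X)]/(fun w => f w * X w) => ->.
Qed.

Let ce_gmf X : Lpt X -> measurable_fun [set: g_sigma_algebraType (F s)] (ce (fun w => f w * X w)).
Proof. by move=> LX; apply: (rce_measurable sH); exact: fi. Qed.

Let x_gmf X : L t X -> measurable_fun [set: g_sigma_algebraType (F s)] (x s t X).
Proof. by move=> /x_Lp[]. Qed.

Let family_gmf Y : family Y -> measurable_fun [set: g_sigma_algebraType (F s)] Y.
Proof.
move=> [X LX ->]; apply: (gfun_ae sH (family_rce LX)).
apply/measurable_EFinP; apply: measurable_funB; [by apply: ce_gmf; exact: L_Lp|exact: x_gmf].
Qed.

Let family0 : family !=set0.
Proof. by eexists; exists 0 => //; exact: L0. Qed.

Let alphaP : is_ess_sup_family P family (alpha f).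
Proof. exact: (ess_sup_familyP sH family0 family_gmf). Qed.

Lemma penalty_gmf : measurable_fun [set: g_sigma_algebraType (F s)] (alpha f).
Proof. exact: (ess_sup_family_gmf sH family0 family_gmf). Qed.

Lemma penalty_ge X : L t X ->
  {ae P, forall w, (ce (fun w => f w * X w) w - x s t X w)%:E <= alpha f w}%E.
Proof.
move=> LX; have [_ ub _] := alphaP.
by apply: filterS2 (ub _ (ex_intro2 _ _ X LX erefl)) (family_rce LX) => w + ->.
Qed.

Let rce_mul0 : {ae P, forall w, ce (fun w => f w * (0 : Omega -> R) w) w = 0}.
Proof.
rewrite (_ : (fun w => f w * (0 : Omega -> R) w) = cst 0); last by apply/funext => w; exact: mulr0.
exact: (rce_id sH (itg_cst P 0) (measurable_cst _)).
Qed.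

Lemma penalty_ge0 : {ae P, forall w, 0 <= alpha f w}%E.
Proof.
have h0 := rce_mul0.
apply: filterS3 (penalty_ge L0) h0 x_zero => w h e1 e2.
by move: h; rewrite e1 e2 subrr.
Qed.

Lemma penalty_le (z : Omega -> \bar R) : measurable_fun setT z ->
  (forall X, L t X ->
    {ae P, forall w, (ce (fun w => f w * X w) w - x s t X w)%:E <= z w}%E) ->
  {ae P, forall w, alpha f w <= z w}%E.
Proof.
move=> mz hz; have [_ _ lub] := alphaP; apply: lub => // _ [X LX ->].
by apply: filterS2 (hz _ LX) (family_rce LX) => w + <-.
Qed.

(* The family of the penalty is directed: two elements of L are glued along
   the event of F s on which the first one does better. *)
Lemma penalty_itg (C : R) : s < t ->
  (forall X, L t X -> Exp (fun w => f w * X w) - Exp (x s t X) <= C) ->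
  exists z, [/\ measurable_fun [set: g_sigma_algebraType (F s)] z, itg P z,
    {ae P, forall w, alpha f w = (z w)%:E} & Exp z <= C].
Proof.
move=> slt hC; apply: (ess_sup_family_directed sH family_gmf).
- exists (fun w => cond_exp P (F s) (EFin \o (f \* (0 : Omega -> R))%R) w - (x s t 0 w)%:E)%E.
    by exists 0 => //; exact: L0.
  have h0 := rce_mul0.
  apply: filterS3 (family_rce L0) h0 x_zero => w <- -> ->.
  by rewrite subrr.
- move=> _ _ [X1 LX1 ->] [X2 LX2 ->].
  pose y X := fun w => ce (fun w => f w * X w) w - x s t X w.
  have my X : L t X -> measurable_fun [set: g_sigma_algebraType (F s)] (y X).
    by move=> LX; apply: measurable_funB; [by apply: ce_gmf; exact: L_Lp|exact: x_gmf].
  pose A := [set w | y X2 w <= y X1 w].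
  have HA : F s A.
    apply/(gmeasurableP sH); rewrite -[X in measurable X]setTI.
    by apply: measurable_fun_ler => //; exact: my.
  have HCA := gsetC sH HA.
  pose X3 := \1_A \* X1 + \1_(~` A) \* X2.
  have L1 : L t (\1_A \* X1) by exact: (star_indic x_star Ts).
  have L2 : L t (\1_(~` A) \* X2) by exact: (star_indic x_star Ts).
  have LX3 : L t X3.
    by rewrite /X3 -[\1_A \* X1]scale1r; exact: (star_linear x_star).
  (* By weak homogeneity of [x], and since 1_B passes through the conditional expectation, [y X] on
     [B] depends on [X] only through [1_B X]. *)
  have glue B Xi : F s B -> L t Xi -> L t (\1_B \* Xi) -> \1_B \* X3 = \1_B \* Xi ->
      {ae P, forall w, B w -> y X3 w = y Xi w}.
    move=> HB LXi LBi e.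
    have whl := star_weak_homogeneous x_star Ts Tt st HB LX3.
    have whr := star_weak_homogeneous x_star Ts Tt st HB LXi LBi.
    rewrite e in whl; have {}whl := whl LBi.
    have cel Xj : Lpt Xj -> {ae P, forall w,
        ce (fun w => f w * (\1_B \* Xj) w) w = \1_B w * ce (fun w => f w * Xj w) w}.
      move=> LXj; have fXj := fi LXj.
      have mB := gsetM sH HB.
      have ej : (fun w => f w * (\1_B \* Xj) w) = \1_B \* (fun w => f w * Xj w).
        by apply/funext => w /=; rewrite mulrCA.
      rewrite ej; apply: (rce_unique sH).
      - exact: itg_indicM.
      - by apply: itg_indicM => //; exact: (rce_itg sH).
      - by apply: measurable_funM; [exact: (gindic sH)|exact: ce_gmf].
      - move=> B' HB'; rewrite !Eon_indic (rceE sH)//; exact: (gsetI sH).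
    have c3 := cel _ (L_Lp LX3); rewrite e in c3.
    apply: filterS3 (filterI whl whr) c3 (cel _ (L_Lp LXi)) => w [a b] c d' Bw.
    move: a b => /(_ Logic.I) a /(_ Logic.I) b.
    rewrite a in b; rewrite c in d'.
    move: b d' => /=; rewrite indicE mem_set// !mul1r /y => -> -> //.
  have g1 := glue A X1 HA LX1 L1; have g2 := glue (~` A) X2 HCA LX2 L2.
  have e1 : \1_A \* X3 = \1_A \* X1.
    apply/funext => w; rewrite -[LHS]/(\1_A w * (\1_A w * X1 w + \1_(~` A) w * X2 w)) /=.
    by rewrite !indicE in_setC; case: (w \in A); rewrite /= ?(mul1r, mul0r, addr0, add0r).
  have e2 : \1_(~` A) \* X3 = \1_(~` A) \* X2.
    apply/funext => w; rewrite -[LHS]/(\1_(~` A) w * (\1_A w * X1 w + \1_(~` A) w * X2 w)) /=.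
    by rewrite !indicE in_setC; case: (w \in A); rewrite /= ?(mul1r, mul0r, addr0, add0r).
  exists (fun w => cond_exp P (F s) (EFin \o (f \* X3)%R) w - (x s t X3 w)%:E)%E.
    by exists X3.
  apply: filterS3 (filterI (g1 e1) (g2 e2)) (filterI (family_rce LX1) (family_rce LX2))
    (family_rce LX3) => w [h1 h2] [<- <-] <-.
  rewrite !lee_fin -/(y X1 w) -/(y X2 w) -/(y X3 w).
  have [Aw|nAw] := pselect (A w); first by rewrite h1.
  by rewrite h2//; split=> //; move/negP: nAw; rewrite /A /= -ltNge => /ltW.
- move=> _ [X LX ->]; have fX := fi (L_Lp LX).
  have ceX := rce_itg sH fX.
  exists (fun w => ce (fun w => f w * X w) w - x s t X w); split.
  + by apply: itgB => //; exact: x_itg.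
  + by apply: filterS (family_rce LX) => w ->.
  + rewrite EonB//; last exact: x_itg.
    by rewrite (rceE sH)//; [exact: hC|exact: (gsetT sH)].
Qed.

End penalty.
End step.

(** The sandwich for [X = -1], [Z = 1], [Y = 0] reads m(1) + x(-1) <= M(0), where x(-1) = -1 by
    projection and M(0) = 0. *)
Lemma m_one_le s t : TT s -> TT t -> s <= t -> {ae P, forall w, m s t (cst 1) w <= 1}.
Proof.
move=> Ts Tt st.
have LN := L_cst Tt (-1).
have := x_sandwich Ts Tt st LN (Lp_ge0_cst P (F t) p1 (lexx 0)) (Lp_ge0_cst P (F t) p1 ler01) _.
have h : {ae P, forall w : Omega, cst 1 w + cst (-1) w <= (cst 0 w : R)}.
  by apply: aeW => w; rewrite /= subrr.
move=> /(_ h){}h.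
apply: filterS3 h (x_cst Ts Tt st (-1)) (M_zero Ts Tt st) => w h h1 h2.
have {}h2 : M s t (cst 0) w = 0 by exact: h2.
by rewrite h1 h2 in h; lra.
Qed.

Lemma m_indic_le s t B : TT s -> TT t -> s <= t -> F s B ->
  {ae P, forall w, m s t \1_B w <= (\1_B w : R)}.
Proof.
move=> Ts Tt st HB; have sG := filtration_subsigma Tt.
have GB := filtration_le Ts Tt st HB.
have L1 := Lp_ge0_cst P (F t) p1 ler01.
have := mM_weak_homogeneous_m mM Ts Tt st HB L1 (Lp_ge0_indicM p1 sG GB L1).
rewrite (_ : \1_B \* cst 1 = \1_B); last by apply/funext => w; exact: mulr1.
have h1 := m_one_le Ts Tt st.
move=> h2; apply: filterS2 h1 h2 => w a /(_ Logic.I) ->.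
by rewrite /= ler_piMr// indicE.
Qed.

(** If the mean were 0 then [m s t 1_B = 0] almost surely, and weak time consistency together with
    [m t T 1_B <= 1_B] would give [m 0 T 1_B <= m 0 t 1_B <= m 0 s (m s t 1_B) = 0]. *)
Lemma nondegenerate_step s t B : TT s -> TT t -> s <= t -> F t B -> (0 < P B)%E ->
  0 < Eon P setT (m s t \1_B).
Proof.
move=> Ts Tt st GB PB.
have /andP[s0 _] := TT_bounds Ts; have /andP[t0 tT] := TT_bounds Tt.
have sG := filtration_subsigma Tt.
have sT := filtration_subsigma TTT.
have sS := filtration_subsigma Ts.
have TB : F T B by exact: (filtration_le Tt TTT tT).
have LT : Lp_ge0 P p (F T) \1_B.
  by split; [exact: Lp_indic|apply: aeW => w; rewrite indicE].
have Lt : Lp_ge0 P p (F t) \1_B.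
  by split; [exact: Lp_indic|apply: aeW => w; rewrite indicE].
have Ls := (mM_operator_m mM Ts Tt st).1 _ Lt.
have Lm := (mM_operator_m mM Tt TTT tT).1 _ LT.
have [_ ms0] := Ls.
rewrite lt_neqAle (Eon_ge0 _ _ ms0)//; last exact: (itg_measurable (m_itg Ts Tt st Lt)).
rewrite andbT eq_sym; apply/eqP => E0.
have mz : {ae P, forall w, m s t \1_B w = 0}.
  have mi := m_itg Ts Tt st Lt.
  have h0 : {ae P, forall w, 0 <= m s t \1_B w} by [].
  have mA := (itg_measurable mi).
  apply: (ae_eq_Eon sS _ (measurable_cst _) mi (itg_cst P 0)); first by case: Ls => -[].
  move=> A HA; have mA' := gsetM sS HA.
  rewrite Eon_cst// mul0r; apply/eqP; rewrite eq_le Eon_ge0// andbT.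
  rewrite -E0 -(Eon_setC mA' mi) lerDl; apply: Eon_ge0 => //; exact: measurableC.
have h1 := mM_weak_time_consistent_m mM TT0 Tt TTT t0 tT LT.
have h2 : {ae P, forall w, m 0 t (m t T \1_B) w <= m 0 t \1_B w}.
  apply: (superlinear_monotone p1 sG (mM_operator_m mM TT0 Tt t0) (mM_superlinear mM TT0 Tt t0)) => //.
  exact: m_indic_le.
have h3 := mM_weak_time_consistent_m mM TT0 Ts Tt s0 st Lt.
have h4 : {ae P, forall w, m 0 s (m s t \1_B) w = m 0 s 0 w}.
  apply/aeTP; apply: (mM_operator_m mM TT0 Ts s0).2 => //.
    exact: (Lp_ge0_cst P (F s) p1 (lexx 0)).
  by apply/aeTP.
have h5 := m_zero TT0 Ts s0.
have := mM_non_degenerate mM TB PB; rewrite unlock.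
have /andP[_ T0] := TT_bounds TT0.
have mi := m_itg TT0 TTT T0 LT.
rewrite -[X in (0 < X)%E]EonE// lte_fin ltNge => /negP; apply.
rewrite [leRHS](_ : 0 = Eon P setT (cst 0)); last by rewrite Eon_cst// mul0r.
apply: Eon_ae_le => //; first exact: (itg_cst P 0).
apply: filterS3 (filterI h1 h2) h3 (filterI h4 h5) => w [a b] c [e g].
by rewrite (le_trans a)// (le_trans b)// (le_trans c)// e g.
Qed.

(** * Bounds for coinciding times *)

Section same_time.
Variables t : R.
Hypothesis Tt : TT t.
Let sG := filtration_subsigma Tt.

(** On an event A of the form X <= a, locality and monotonicity give m(1_A X) <= m(a 1_A) = a m(1_A)
    <= a 1_A. Rational levels a suffice. *)
Lemma m_refl_le X : Lp_ge0 P p (F t) X -> {ae P, forall w, m t t X w <= X w}.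
Proof.
move=> LX; have [LX1 X0] := LX.
have tt : t <= t by [].
have step (a : R) : 0 <= a -> {ae P, forall w, X w <= a -> m t t X w <= a}.
  move=> a0; pose A := [set w | X w <= a].
  have GA : F t A.
    apply/(gmeasurableP sG); rewrite -[X in measurable X]setTI.
    by apply: measurable_fun_ler => //; exact: (Lp_gmf LX1).
  have LA : Lp_ge0 P p (F t) \1_A.
    by split; [exact: Lp_indic|apply: aeW => w; rewrite indicE].
  have LAX := Lp_ge0_indicM p1 sG GA LX.
  have h1 := mM_weak_homogeneous_m mM Tt Tt tt GA LX LAX.
  have LaA : Lp_ge0 P p (F t) (a *: \1_A).
    have := Lp_ge0_lin p1 sG a0 LA (Lp_ge0_cst P (F t) p1 (lexx 0)).
    by rewrite (_ : a *: \1_A + cst 0 = a *: \1_A)//; apply/funext => w; exact: addr0.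
  have h2 : {ae P, forall w, m t t (\1_A \* X) w <= m t t (a *: \1_A) w}.
    apply: (superlinear_monotone p1 sG (mM_operator_m mM Tt Tt tt) (mM_superlinear mM Tt Tt tt)) => //.
    apply: aeW => w; rewrite -[leRHS]/(a * \1_A w) /= indicE.
    case: (boolP (w \in A)) => [/set_mem Aw|_]; last by rewrite mulr0 mul0r.
    by rewrite mul1r mulr1.
  have h3 := (mM_superlinear mM Tt Tt tt).2 _ _ LA a0.
  have h4 := m_indic_le Tt Tt tt GA.
  apply: filterS3 (filterI h1 h2) h3 h4 => w [b c] e g Xa.
  move: b e => /(_ Logic.I) b /(_ Logic.I) e.
  rewrite b e -[(a *: _) w]/(a * m t t \1_A w) /= in c.
  have wA : w \in A by rewrite inE.
  move: c g; rewrite !indicE wA mul1r => c g.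
  by apply: (le_trans c); rewrite -[leRHS]mulr1 ler_wpM2l.
(* The absolute value keeps the level nonnegative, as positive homogeneity requires; since X >= 0,
   no other levels are needed. *)
have h : {ae P, forall w, forall n : nat,
    let a : R := ratr `|odflt 0 (unpickle n)|%Q in X w <= a -> m t t X w <= a}.
  by apply: ae_foralln => n; apply: step; rewrite ler0q.
apply: filterS2 h X0 => w h Xw; rewrite leNgt; apply/negP => lt.
have [a] := rat_in_itvoo lt; rewrite in_itv/= => /andP[Xa am].
have a0 : 0 <= a by rewrite -(ler0q R); exact: le_trans Xw (ltW Xa).
have := h (pickle a); rewrite /= pickleK /= ger0_norm// => /(_ (ltW Xa)).
by move=> /(lt_le_trans am); rewrite ltxx.
Qed.

(** Replacing X by a outside the event A where X >= a gives a variable Y above the constant a, so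
    the sandwich yields M(Y) >= a; by locality M(Y) and M(X) agree on A. *)
Lemma M_refl_ge X : Lp_ge0 P p (F t) X -> {ae P, forall w, X w <= M t t X w}.
Proof.
move=> LX; have [LX1 X0] := LX.
have tt : t <= t by [].
have step (a : R) : 0 <= a -> {ae P, forall w, a <= X w -> a <= M t t X w}.
  move=> a0; pose A := [set w | a <= X w].
  have GA : F t A.
    apply/(gmeasurableP sG); rewrite -[X in measurable X]setTI.
    by apply: measurable_fun_ler => //; exact: (Lp_gmf LX1).
  have LAX := Lp_ge0_indicM p1 sG GA LX.
  have h1 := mM_weak_homogeneous_M mM Tt Tt tt GA LX LAX.
  have LCA : Lp_ge0 P p (F t) (\1_(~` A) \* cst a).
    apply: Lp_ge0_indicM => //; first exact: (gsetC sG).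
    exact: Lp_ge0_cst.
  pose Y := 1 *: (\1_A \* X) + (\1_(~` A) \* cst a).
  have LY : Lp_ge0 P p (F t) Y by apply: Lp_ge0_lin.
  have h2 := x_sandwich Tt Tt tt (L_cst Tt a) LY (Lp_ge0_cst P (F t) p1 (lexx 0)).
  have {}h2 : {ae P, forall w, m t t (cst 0) w + x t t (cst a) w <= M t t Y w}.
    apply: h2; apply: aeW => w; rewrite add0r.
    rewrite -[leRHS]/(1 * (\1_A w * X w) + \1_(~` A) w * a) mul1r !indicE in_setC.
    case: (boolP (w \in A)) => [/set_mem Aw|_]; last by rewrite mul0r mul1r add0r.
    by rewrite mul1r mul0r addr0.
  have LAY := Lp_ge0_indicM p1 sG GA LY.
  have h3 := mM_weak_homogeneous_M mM Tt Tt tt GA LY LAY.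
  have e : \1_A \* Y = \1_A \* X.
    apply/funext => w; rewrite -[LHS]/(\1_A w * (1 * (\1_A w * X w) + \1_(~` A) w * a)) /=.
    rewrite !indicE in_setC; case: (w \in A); rewrite /= ?(mul1r, mul0r, addr0)//.
  rewrite e in h3.
  apply: filterS3 (filterI h1 h2) h3 (filterI (m_zero Tt Tt tt) (x_cst Tt Tt tt a)) => w [b c] g [k l'] aX.
  move: b g => /(_ Logic.I) b /(_ Logic.I) g.
  rewrite l' in c.
  have {}k : m t t (cst 0) w = 0 by exact: k.
  rewrite k add0r in c.
  have wA : w \in A by rewrite inE.
  move: b g; rewrite /= indicE wA !mul1r => <- ->.
  exact: c.
have h : {ae P, forall w, forall n : nat,
    let a : R := ratr `|odflt 0 (unpickle n)|%Q in a <= X w -> a <= M t t X w}.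
  by apply: ae_foralln => n; apply: step; rewrite ler0q.
have M0 := ((mM_operator_M mM Tt Tt tt).1 _ LX).2.
apply: filterS2 h M0 => w h Mw; rewrite leNgt; apply/negP => lt.
have [a] := rat_in_itvoo lt; rewrite in_itv/= => /andP[Ma aX].
have a0 : 0 <= a by rewrite -(ler0q R); exact: le_trans Mw (ltW Ma).
have := h (pickle a); rewrite /= pickleK /= ger0_norm// => /(_ (ltW aX)).
by move=> /(lt_le_trans Ma); rewrite ltxx.
Qed.

End same_time.
End one_step.

(** * Strong duality across a strict time step *)

Section strict_step.
Context d (Omega : measurableType d) (R : realType) (P : probability Omega R).
Variables (T : R) (F : R -> set (set Omega)) (p : \bar R) (TT : set R).
Variables (L : R -> set (Omega -> R)) (x m M : R -> R -> (Omega -> R) -> Omega -> R).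
Hypothesis S : sandwich_setting P T F p TT L x m M.
Let q := hoelder_conjugate p.
Let p1 := setting_p_ge1 S.
Variables s t : R.
Hypotheses (Ts : TT s) (Tt : TT t) (slt : s < t).
Let st := ltW slt.
Let sG := filtration_subsigma S Tt.
Let sH := filtration_subsigma S Ts.
Let HG := filtration_le S Ts Tt st.
Notation Lpt := (Lp P p (F t)).
Notation Lppt := (Lp_ge0 P p (F t)).
Notation ce := (rce P (F s)).
Notation Dse := (DSe P p F m M s t).
Notation Exp := (Eon P setT).
Notation alpha := (min_penalty P F L x s t).

Let L_lin (a : R) X Y : L t X -> L t Y -> L t (a *: X + Y).
Proof. exact: (star_linear (setting_star S)). Qed.

Definition dominating (X0 X' Y Z : Omega -> R) :=
  [/\ L t X', Lppt Y, Lppt Z & {ae P, forall w, Z w + X0 w <= Y w + X' w}].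

(** By [sandwich_convex_le], an upper bound at every dominated [X0] for any convex operator that
    extends [x] and preserves the sandwich. *)
Definition price (X' Y Z : Omega -> R) w := x s t X' w + M s t Y w - m s t Z w.

Lemma price_itg X0 X' Y Z : dominating X0 X' Y Z -> itg P (price X' Y Z).
Proof.
move=> [LX' LY LZ _]; apply: itgB; last exact: (m_itg S Ts Tt st).
by apply: itgD; [exact: (x_itg S)|exact: (M_itg S)].
Qed.

Lemma price_Exp X0 X' Y Z : dominating X0 X' Y Z ->
  Exp (price X' Y Z) = Exp (x s t X') + Exp (M s t Y) - Exp (m s t Z).
Proof.
move=> [LX' LY LZ _].
have xi := x_itg S Ts Tt st LX'; have Mi := M_itg S Ts Tt st LY.
by rewrite /price EonB ?EonD//; [exact: itgD|exact: (m_itg S Ts Tt st)].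
Qed.

Lemma dominating_self X0 : Lpt X0 -> dominating X0 0 (fun w => Num.max (X0 w) 0) 0.
Proof.
move=> LX0; split; [exact: (L0 S)|exact: Lp_pos|exact: (Lp_ge0_cst P (F t) p1 (lexx 0))|].
by apply: aeW => w; rewrite -[leLHS]/(0 + X0 w) -[leRHS]/(Num.max (X0 w) 0 + 0) add0r addr0 le_max lexx.
Qed.

(** Multiply [Z + X0 <= Y + X'] by [f > 0] and take conditional expectations: m and M bound the
    terms in [Z] and [Y], and the penalty bounds the term in [X']. *)
Lemma weak_duality f X0 X' Y Z : Dse f -> Lpt X0 -> dominating X0 X' Y Z ->
  {ae P, forall w, (ce (fun w => f w * X0 w) w - price X' Y Z w)%:E <= alpha f w}%E.
Proof.
move=> Df LX0 [LX' LY LZ h].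
have fi X : Lpt X -> itg P (fun w => f w * X w) by exact: (Dse_itgM S Tt Df).
have LpX' := L_Lp S Tt LX'.
have f0 := Dse_gt0 Df.
have [iX0 iX' iY iZ] : [/\ itg P (fun w => f w * X0 w), itg P (fun w => f w * X' w),
    itg P (fun w => f w * Y w) & itg P (fun w => f w * Z w)].
  by split; apply: fi => //; [case: LY|case: LZ].
have h1 : {ae P, forall w, ce (fun w => f w * Z w + f w * X0 w) w <=
                           ce (fun w => f w * Y w + f w * X' w) w}.
  apply: (rce_ae_le sH); [exact: itgD|exact: itgD|].
  by apply: filterS2 h f0 => w a b; rewrite -!mulrDr ler_pM2l.
have h2 := rceD sH iZ iX0; have h3 := rceD sH iY iX'.
have h4 := Dse_m S Ts Tt Df LZ; have h5 := Dse_M S Ts Tt Df LY.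
have h6 := penalty_ge S Ts Tt st fi LX'.
apply: filterS3 (filterI h1 h2) (filterI h3 h4) (filterI h5 h6) => w [a b] [c e] [g k].
apply: le_trans k; rewrite lee_fin /price.
rewrite b c in a; lra.
Qed.

(** The domination of [X0] gives [Z + 0 <= (Y + X0^-) + X'], so [sandwich_convex_le] applies at the
    element 0 of [L t]. The lower bound is common to all prices and makes [phi] finite. *)
Lemma price_ge X0 X' Y Z : Lpt X0 -> dominating X0 X' Y Z ->
  {ae P, forall w, - M s t (fun w => Num.max (- X0 w) 0) w <= price X' Y Z w}.
Proof.
move=> LX0 [LX' LY LZ h].
have LN := Lp_pos p1 sG (LpN p1 sG LX0).
have LYN : Lppt (Y + (fun w => Num.max (- X0 w) 0)).
  by rewrite -[Y]scale1r; exact: Lp_ge0_lin.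
have key := sandwich_convex_le p1 sG L_lin (L0 S Tt)
  (star_convex (setting_star S) Ts Tt st) (setting_sandwich S Ts Tt st)
  (mM_superlinear (setting_mM S) Ts Tt st).2 (mM_sublinear (setting_mM S) Ts Tt st).2
  (L0 S Tt) LX' LYN LZ.
have {}key := key _.
have h1 : {ae P, forall w, m s t Z w + x s t 0 w <= M s t (Y + (fun w => Num.max (- X0 w) 0)) w + x s t X' w}.
  apply: key; apply: filterS h => w a.
  rewrite -[leLHS]/(Z w + 0) -[leRHS]/(Y w + Num.max (- X0 w) 0 + X' w) addr0.
  have : - X0 w <= Num.max (- X0 w) 0 by rewrite le_max lexx.
  lra.
have h2 := (mM_sublinear (setting_mM S) Ts Tt st).1 _ _ LY LN.
apply: filterS3 h1 h2 (x_zero S Ts Tt st) => w a b c.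
rewrite /price; rewrite c in a; lra.
Qed.

Let V X0 := [set r | exists X' Y Z, dominating X0 X' Y Z /\ r = Exp (price X' Y Z)].
Let phi X0 := inf (V X0).

Let V_lb X0 : Lpt X0 -> lbound (V X0) (- Exp (M s t (fun w => Num.max (- X0 w) 0))).
Proof.
move=> LX0 _ [X' [Y [Z [D ->]]]].
have Mi := M_itg S Ts Tt st (Lp_pos p1 sG (LpN p1 sG LX0)).
rewrite -EonN//; apply: Eon_ae_le => //; [exact: itgN|exact: price_itg D|].
exact: price_ge D.
Qed.

Let V_inf X0 : Lpt X0 -> has_inf (V X0).
Proof.
move=> LX0; split; last by eexists; exact: V_lb.
by eexists; exists 0, (fun w => Num.max (X0 w) 0), 0; split; first exact: dominating_self.
Qed.

Let phi_le X0 X' Y Z : Lpt X0 -> dominating X0 X' Y Z -> phi X0 <= Exp (price X' Y Z).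
Proof.
move=> LX0 D; apply: ge_inf; first by case: (V_inf LX0).
by exists X', Y, Z.
Qed.

Let phi_ge X0 r : Lpt X0 ->
  (forall X' Y Z, dominating X0 X' Y Z -> r <= Exp (price X' Y Z)) -> r <= phi X0.
Proof.
move=> LX0 h; apply: lb_le_inf; first by case: (V_inf LX0).
by move=> _ [X' [Y [Z [D ->]]]]; exact: h.
Qed.

Let Lppt_add X Y : Lppt X -> Lppt Y -> Lppt (X + Y).
Proof. by move=> LX LY; rewrite -[X]scale1r; exact: Lp_ge0_lin. Qed.

Let Lppt_scale (a : R) X : 0 <= a -> Lppt X -> Lppt (a *: X).
Proof.
move=> a0 LX; have := Lp_ge0_lin p1 sG a0 LX (Lp_ge0_cst P (F t) p1 (lexx 0)).
by rewrite (_ : a *: X + cst 0 = a *: X)//; apply/funext => w; exact: addr0.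
Qed.

(** The surplus [Y1] is simply added to [Y]. With [phi_subZ] this confines every subgradient of
    [phi] between E m and E M. *)
Let phi_addY X0 Y1 : Lpt X0 -> Lppt Y1 -> phi (X0 + Y1) <= phi X0 + Exp (M s t Y1).
Proof.
move=> LX0 LY1; rewrite -lerBlDr; apply: phi_ge => // X' Y Z D.
have [LX' LY LZ h] := D.
have D' : dominating (X0 + Y1) X' (Y + Y1) Z.
  split => //; first exact: Lppt_add.
  apply: filterS h => w h.
  rewrite -[leLHS]/(Z w + (X0 w + Y1 w)) -[leRHS]/(Y w + Y1 w + X' w); lra.
have := phi_le (LpD p1 sG LX0 LY1.1) D'; rewrite (price_Exp D') (price_Exp D) lerBlDr.
move=> /le_trans; apply.
have Y1i := M_itg S Ts Tt st LY1; have Yi := M_itg S Ts Tt st LY.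
have : Exp (M s t (Y + Y1)) <= Exp (fun w => M s t Y w + M s t Y1 w).
  apply: Eon_ae_le => //; [by apply: (M_itg S Ts Tt st); exact: Lppt_add|exact: itgD|].
  exact: (mM_sublinear (setting_mM S) Ts Tt st).1.
rewrite EonD//; lra.
Qed.

Let phi_subZ X0 Z1 : Lpt X0 -> Lppt Z1 -> phi (X0 - Z1) <= phi X0 - Exp (m s t Z1).
Proof.
move=> LX0 LZ1; rewrite -lerBlDr opprK; apply: phi_ge => // X' Y Z D.
have [LX' LY LZ h] := D.
have D' : dominating (X0 - Z1) X' Y (Z + Z1).
  split => //; first exact: Lppt_add.
  apply: filterS h => w h.
  rewrite -[leLHS]/(Z w + Z1 w + (X0 w - Z1 w)); lra.
have := phi_le (LpB p1 sG LX0 LZ1.1) D'; rewrite (price_Exp D') (price_Exp D) -lerBrDr.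
move=> /le_trans; apply.
have Z1i := m_itg S Ts Tt st LZ1; have Zi := m_itg S Ts Tt st LZ.
have : Exp (fun w => m s t Z w + m s t Z1 w) <= Exp (m s t (Z + Z1)).
  apply: Eon_ae_le => //; [exact: itgD|by apply: (m_itg S Ts Tt st); exact: Lppt_add|].
  exact: (mM_superlinear (setting_mM S) Ts Tt st).1.
rewrite EonD//; lra.
Qed.

Let phi_L X : L t X -> phi X <= Exp (x s t X).
Proof.
move=> LX; have L00 := Lp_ge0_cst P (F t) p1 (lexx 0).
have D : dominating X X 0 0.
  by split => //; exact: aeW.
apply: le_trans (phi_le (L_Lp S Tt LX) D) _.
have xi := x_itg S Ts Tt st LX.
apply: Eon_ae_le => //; first exact: price_itg D.
apply: filterS2 (m_zero S Ts Tt st) (M_zero S Ts Tt st) => w a b.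
by rewrite /price a b subr0 addr0.
Qed.

(** Dominating triples may be combined convexly, and the price is convex in the triple. The infimum
    is then taken over one triple at a time. *)
Let phi_convex (a : R) X1 X2 : 0 < a < 1 -> Lpt X1 -> Lpt X2 ->
  phi (a *: X1 + (1 - a) *: X2) <= a * phi X1 + (1 - a) * phi X2.
Proof.
move=> /andP[a0 a1] LX1 LX2.
have b0 : 0 < 1 - a by rewrite subr_gt0.
have Lc : Lpt (a *: X1 + (1 - a) *: X2).
  by apply: Lp_linear => //; exact: LpZ.
have key r1 r2 : V X1 r1 -> V X2 r2 -> phi (a *: X1 + (1 - a) *: X2) <= a * r1 + (1 - a) * r2.
  move=> [X1' [Y1 [Z1 [D1 ->]]]] [X2' [Y2 [Z2 [D2 ->]]]].
  have [LX1' LY1 LZ1 h1] := D1; have [LX2' LY2 LZ2 h2] := D2.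
  have Lx2 : L t ((1 - a) *: X2').
    by have := L_lin (1 - a) LX2' (L0 S Tt); rewrite addr0.
  have Lx : L t (a *: X1' + (1 - a) *: X2') by exact: L_lin.
  have aY1 := Lppt_scale (ltW a0) LY1; have bY2 := Lppt_scale (ltW b0) LY2.
  have aZ1 := Lppt_scale (ltW a0) LZ1; have bZ2 := Lppt_scale (ltW b0) LZ2.
  have D : dominating (a *: X1 + (1 - a) *: X2) (a *: X1' + (1 - a) *: X2')
      (a *: Y1 + (1 - a) *: Y2) (a *: Z1 + (1 - a) *: Z2).
    split; [exact: Lx|exact: Lppt_add|exact: Lppt_add|].
    apply: filterS2 h1 h2 => w h1 h2.
    rewrite -[leLHS]/(a * Z1 w + (1 - a) * Z2 w + (a * X1 w + (1 - a) * X2 w)).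
    rewrite -[leRHS]/(a * Y1 w + (1 - a) * Y2 w + (a * X1' w + (1 - a) * X2' w)).
    have := ler_wpM2l (ltW a0) h1; have := ler_wpM2l (ltW b0) h2.
    rewrite !mulrDr; lra.
  apply: le_trans (phi_le Lc D) _.
  have i1 := price_itg D1; have i2 := price_itg D2.
  rewrite -!EonZ// -EonD//; [|exact: itgZ..].
  apply: Eon_ae_le => //; [exact: price_itg D|by apply: itgD; exact: itgZ|].
  have a01 : 0 <= a <= 1 by rewrite !ltW.
  have c1 := star_convex (setting_star S) Ts Tt st LX1' LX2' a01.
  have c2 := (mM_sublinear (setting_mM S) Ts Tt st).1 _ _ aY1 bY2.
  have c3 := (mM_superlinear (setting_mM S) Ts Tt st).1 _ _ aZ1 bZ2.
  have c4 := (mM_sublinear (setting_mM S) Ts Tt st).2 _ _ LY1 (ltW a0).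
  have c5 := (mM_sublinear (setting_mM S) Ts Tt st).2 _ _ LY2 (ltW b0).
  have c6 := (mM_superlinear (setting_mM S) Ts Tt st).2 _ _ LZ1 (ltW a0).
  have c7 := (mM_superlinear (setting_mM S) Ts Tt st).2 _ _ LZ2 (ltW b0).
  apply: filterS3 (filterI c1 (filterI c2 c3)) (filterI c4 c5) (filterI c6 c7) => w [e1 [e2 e3]] [e4 e5] [e6 e7].
  move: e4 e5 e6 e7 => /(_ Logic.I) e4 /(_ Logic.I) e5 /(_ Logic.I) e6 /(_ Logic.I) e7.
  rewrite e4 e5 -[(a *: M s t Y1) w]/(a * M s t Y1 w) -[((1 - a) *: M s t Y2) w]/((1 - a) * M s t Y2 w) in e2.
  rewrite e6 e7 -[(a *: m s t Z1) w]/(a * m s t Z1 w) -[((1 - a) *: m s t Z2) w]/((1 - a) * m s t Z2 w) in e3.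
  rewrite /price !mulrBr !mulrDr; lra.
have [[r10 Vr10] _] := V_inf LX1; have [[r20 Vr20] _] := V_inf LX2.
have k1 r1 : V X1 r1 -> (phi (a *: X1 + (1 - a) *: X2) - a * r1) / (1 - a) <= phi X2.
  move=> V1; apply: lb_le_inf; first by exists r20.
  move=> r2 V2; rewrite ler_pdivrMr//.
  have := key _ _ V1 V2; lra.
have : (phi (a *: X1 + (1 - a) *: X2) - (1 - a) * phi X2) / a <= phi X1.
  apply: lb_le_inf; first by exists r10.
  move=> r1 V1; rewrite ler_pdivrMr//.
  have := k1 _ V1; rewrite ler_pdivrMr//; lra.
rewrite ler_pdivrMr//; lra.
Qed.

(* A subgradient of phi at X0 is squeezed between m and M, hence is given by a
   density f; as L contains the multiples of the indicators of F s, the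
   projection property forces E[f|F_s] = 1. *)
Lemma strict_step_attained X0 : Lpt X0 -> exists f Z,
  [/\ Dse f, Lp P p (F s) Z,
      {ae P, forall w, alpha f w = (ce (fun w => f w * X0 w) w - Z w)%:E},
      forall X' Y Z', dominating X0 X' Y Z' -> {ae P, forall w, Z w <= price X' Y Z' w} &
      forall W, itg P W ->
        (forall X' Y Z', dominating X0 X' Y Z' -> {ae P, forall w, W w <= price X' Y Z' w}) ->
        {ae P, forall w, W w <= Z w}].
Proof.
move=> LX0.
have Lp00 : Lpt 0 by exact: (Lp_cst P (F t) p1 0).
have [l [l_lin l_le]] := convex_subgradient Lp00 (Lp_linear p1 sG) phi_convex LX0.
have l00 : l 0 = 0.
  by have := l_lin 1 _ _ Lp00 Lp00; rewrite scaler0 addr0; lra.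
have lZ a u : Lpt u -> l (a *: u) = a * l u.
  by move=> Lu; have := l_lin a _ _ Lu Lp00; rewrite !addr0 l00 addr0.
have lB u v : Lpt u -> Lpt v -> l (u - v) = l u - l v.
  move=> Lu Lv; have -> : u - v = -1 *: v + u by rewrite scaleN1r addrC.
  by rewrite l_lin//; lra.
have lM Y : Lppt Y -> l Y <= Exp (M s t Y).
  by move=> LY; have := l_le _ LY.1; have := phi_addY LX0 LY; lra.
have lm Z : Lppt Z -> Exp (m s t Z) <= l Z.
  move=> LZ; have LNZ : Lpt (- 1 *: Z) by apply: LpZ => //; case: LZ.
  have := l_le _ LNZ; rewrite lZ ?scaleN1r; last by case: LZ.
  by have := phi_subZ LX0 LZ; lra.
have l_ge0 u : Lppt u -> 0 <= l u.
  move=> Lu; apply: le_trans (lm _ Lu).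
  have [_ mu0] := (m_op S Ts Tt st).1 _ Lu.
  by apply: Eon_ge0 => //; exact: (itg_measurable (m_itg S Ts Tt st Lu)).
(* The subgradient inequality in the direction [X - X0]; [l X0 - phi X0] will bound the mean of the
   penalty. *)
have lL X : L t X -> l X - l X0 <= Exp (x s t X) - phi X0.
  move=> LX; have LpX := L_Lp S Tt LX.
  have LD : Lpt (X - X0) by exact: LpB.
  have := l_le _ LD; rewrite addrCA subrr addr0.
  rewrite lB//.
  by have := phi_L LX; lra.
have regular : p = +oo%E -> forall A : nat -> set Omega,
    (forall n, F t (A n)) -> (forall n, A n.+1 `<=` A n) -> \bigcap_n A n = set0 ->
    l \1_(A n) @[n --> \oo] --> 0.
  move=> p_oo A GA decA capA.
  have mA n := gsetM sG (GA n).
  have L1 n : Lppt \1_(A n).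
    by split; [exact: Lp_indic|apply: aeW => w; rewrite indicE].
  have L1T := Lp_ge0_cst P (F t) p1 ler01.
  have M1i := M_itg S Ts Tt st L1T.
  have Mto0 : {ae P, forall w, M s t \1_(A n) w @[n --> \oo] --> (0 : R)}.
    apply: (mM_regular (setting_mM S) p_oo Ts Tt st).
    - by move=> n; case: (L1 n).
    - move=> n; apply: aeW => w; rewrite !indicE ler_nat.
      case: (boolP (w \in A n.+1)) => // /set_mem/decA Aw.
      by rewrite mem_set.
    - apply: aeW => w.
      apply: cvg_near_cst; apply: filterS (shrink_near decA capA w) => n Anw.
      by rewrite indicE memNset.
  apply/cvgrPdist_le => e e0.
  have e20 : 0 < e / 2 by rewrite divr_gt0.
  (* [M 1_(A n)] is not known to lie below [M 1], so dominated convergence is not applied to it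
     directly. On [B n], positivity of [l] gives [l (1_B 1_A) <= l 1_B <= E[1_B M(1)]], which
     vanishes in the limit; off [B n], [M 1_(A n)] is at most e / 2. *)
  pose B n := [set w | e / 2 < M s t \1_(A n) w].
  have mM1 n : measurable_fun [set: g_sigma_algebraType (F s)] (M s t \1_(A n)).
    by case: (M_Lp S Ts Tt st (L1 n)).
  have HB n : F s (B n).
    apply/(gmeasurableP sH); rewrite -[X in measurable X]setTI.
    exact: measurable_fun_ltr.
  have mB n := gsetM sH (HB n).
  have EB0 : Eon P (B n) (M s t (cst 1)) @[n --> \oo] --> 0.
    apply: (Eon_vanish M1i mB); apply: filterS Mto0 => w Mw.
    have /cvgrPdist_le /(_ _ e20) := Mw; apply: filterS => n.
    rewrite sub0r normrN => /(le_trans (ler_norm _)) h Bw.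
    by have := lt_le_trans Bw h; rewrite ltxx.
  near=> n; rewrite sub0r normrN ger0_norm; last exact: l_ge0.
  have En : Eon P (B n) (M s t (cst 1)) <= e / 2.
    near: n; have /cvgrPdist_le /(_ _ e20) := EB0.
    apply: filterS => n; rewrite sub0r normrN; exact: le_trans (ler_norm _).
  have HCB := gsetC sH (HB n); have mCB := gsetM sH HCB.
  have LB : Lppt (\1_(B n) \* cst 1) by apply: Lp_ge0_indicM => //; exact: HG.
  have LBA : Lppt (\1_(B n) \* \1_(A n)) by apply: Lp_ge0_indicM => //; exact: HG.
  have LCA : Lppt (\1_(~` B n) \* \1_(A n)) by apply: Lp_ge0_indicM => //; exact: HG.
  have h1 : l (\1_(B n) \* \1_(A n)) <= e / 2.
    apply: le_trans En; rewrite (M_localE S Ts Tt st (HB n) L1T).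
    apply: le_trans (lM _ LB).
    have LD : Lppt (\1_(B n) \* cst 1 - \1_(B n) \* \1_(A n)).
      split; first by apply: (LpB p1 sG); [case: LB|case: LBA].
      apply: aeW => w; rewrite -[leRHS]/(\1_(B n) w * 1 - \1_(B n) w * \1_(A n) w) -mulrBr.
      by rewrite mulr_ge0// ?indicE// subr_ge0 lern1 leq_b1.
    rewrite -subr_ge0.
    rewrite -lB; [|by case: LB|by case: LBA].
    exact: l_ge0.
  have h2 : l (\1_(~` B n) \* \1_(A n)) <= e / 2.
    apply: le_trans (lM _ LCA) _; rewrite -(M_localE S Ts Tt st HCB (L1 n)).
    rewrite -EonT_indic.
    rewrite [leRHS](_ : _ = Exp (cst (e / 2))); last first.
      by rewrite Eon_cst// probability_setT/= mulr1.
    have Mi := M_itg S Ts Tt st (L1 n).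
    apply: Eon_ae_le => //; [exact: itg_indicM|exact: itg_cst|].
    apply: aeW => w; rewrite /= indicE; case: (boolP (w \in ~` B n)) => [/set_mem|_].
      by rewrite /B /= mul1r => /negP; rewrite -leNgt.
    by rewrite mul0r ltW.
  have -> : (\1_(A n) : Omega -> R) =
      1 *: ((\1_(B n) \* \1_(A n)) : Omega -> R) + ((\1_(~` B n) \* \1_(A n)) : Omega -> R).
    apply/funext => w; rewrite -[RHS]/(1 * (\1_(B n) w * \1_(A n) w) + \1_(~` B n) w * \1_(A n) w).
    by rewrite mul1r !indicE in_setC; case: (w \in B n); rewrite /= ?(mul1r, mul0r, addr0, add0r).
  rewrite l_lin; [|by case: LBA|by case: LCA].
  lra.
have [f [mf f0 fi fl]] := positive_functional_density p1 sG l_lin l_ge0 regular.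
have fiX X : Lpt X -> itg P (fun w => f w * X w) by move=> /fl[].
have flE X : Lpt X -> l X = Exp (fun w => f w * X w) by move=> /fl[].
have Lq : Lp P q (F t) f.
  by apply: (converse_holder p1 sG) => // X LX; apply: fiX; case: LX.
have fpos : {ae P, forall w, 0 < f w}.
  (* If P(B) > 0, then 0 < E[m(1_B)] <= l(1_B) = E[f 1_B] = 0. *)
  pose B := [set w | f w <= 0].
  have GB : F t B.
    apply/(gmeasurableP sG); rewrite -[X in measurable X]setTI.
    exact: measurable_fun_ler.
  have mB := gsetM sG GB.
  have L1 : Lppt \1_B.
    by split; [exact: Lp_indic|apply: aeW => w; rewrite indicE].
  have PB : P B = 0%E.
    apply: contrapT => /eqP PB.
    have PB0 : (0 < P B)%E by rewrite lt0e PB measure_ge0.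
    have := lt_le_trans (nondegenerate_step S Ts Tt st GB PB0) (lm _ L1).
    rewrite flE; last by case: L1.
    rewrite (_ : (fun w => _) = cst 0); last first.
      apply/funext => w; rewrite indicE; case: (boolP (w \in B)) => [/set_mem Bw|_]; last by rewrite mulr0.
      by rewrite mulr1; apply/eqP; rewrite eq_le f0 andbT.
    by rewrite Eon_cst// mul0r ltxx.
  by exists B; split => // w /= /negP; rewrite -leNgt.
have Lind A : F s A -> L t \1_A.
  move=> HA; have := star_indic (setting_star S) Ts Tt slt HA (star_one (setting_star S) Tt).
  by congr (L t _); apply/funext => w; exact: mulr1.
have f1 A : F s A -> Eon P A f = fine (P A).
  move=> HA; have mA := gsetM sH HA; have LA := Lind A HA.
  have LpA := L_Lp S Tt LA.
  have lA : l \1_A = Eon P A f.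
    rewrite flE// -[RHS]EonT_indic; congr (Eon _ _ _); apply/funext => w.
    by rewrite /= mulrC.
  (* By projection x(c 1_A) = c 1_A. The bound holds for every real [c], of either sign, which
     forces its coefficient to vanish. *)
  have key (c : R) : c * (Eon P A f - fine (P A)) <= l X0 - phi X0.
    have LcA : L t (c *: \1_A) by have := L_lin c LA (L0 S Tt); rewrite addr0.
    have := lL _ LcA; rewrite lZ// lA.
    have -> : Exp (x s t (c *: \1_A)) = c * fine (P A).
      transitivity (Exp (fun w => c * \1_A w)).
        apply: Eon_ae_eq => //.
        - exact: (itg_measurable (x_itg S Ts Tt st LcA)).
        - by apply: measurable_funM => //; exact: measurable_indic.
        apply/aeTP; apply: (star_projection (setting_star S) Ts Tt st) => //.
        by apply: LpZ => //; exact: Lp_indic.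
      rewrite EonZ//; last exact: itg_indic.
      rewrite (_ : \1_A = \1_A \* cst 1); last by apply/funext => w /=; rewrite mulr1.
      by rewrite EonT_indic Eon_cst// mul1r.
    rewrite mulrBr; lra.
  apply/eqP; rewrite -subr_eq0; apply: contraT => N0.
  set a := Eon P A f - fine (P A) in key N0.
  have := key ((l X0 - phi X0 + 1) / a); rewrite divfK//; lra.
have Df : Dse f.
  apply: (Dse_intro S Ts Tt st) => // X LX; have fX := fiX _ LX.1; split=> // A HA.
  have mA := gsetM sH HA.
  have LAX : Lppt (\1_A \* X) by apply: Lp_ge0_indicM => //; exact: HG.
  have e : Eon P A (fun w => f w * X w) = l (\1_A \* X).
    rewrite flE; last by case: LAX.
    rewrite -[LHS]EonT_indic; congr (Eon _ _ _); apply/funext => w.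
    by rewrite /= mulrCA.
  by rewrite (m_localE S Ts Tt st HA LX) (M_localE S Ts Tt st HA LX) e lm// lM.
have fXL X : L t X -> Exp (fun w => f w * X w) - Exp (x s t X) <= l X0 - phi X0.
  by move=> LX; have := lL _ LX; rewrite flE; [lra|exact: (L_Lp S Tt)].
have [z [mz zi az Ez]] := penalty_itg S Ts Tt st fiX slt fXL.
(* The dual objective at [f]. By weak duality it lies below every price, while its mean is at least
   [phi X0], the infimum of their means. *)
pose Z w := ce (fun w => f w * X0 w) w - z w.
have ceX0 := rce_itg sH (fiX _ LX0).
have Zi : itg P Z by exact: itgB.
have mZ : measurable_fun [set: g_sigma_algebraType (F s)] Z.
  by apply: measurable_funB => //; apply: (rce_measurable sH); exact: fiX.
have EZ : phi X0 <= Exp Z.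
  rewrite EonB//; have -> : Exp (ce (fun w => f w * X0 w)) = l X0.
    by rewrite (rceE sH) ?flE//; [exact: fiX|exact: (gsetT sH)].
  lra.
have Zle X' Y Z' : dominating X0 X' Y Z' -> {ae P, forall w, Z w <= price X' Y Z' w}.
  move=> D; apply: filterS2 (weak_duality Df LX0 D) az => w + aw.
  by rewrite aw lee_fin /Z; lra.
have Zglb W : itg P W ->
    (forall X' Y Z', dominating X0 X' Y Z' -> {ae P, forall w, W w <= price X' Y Z' w}) ->
    {ae P, forall w, W w <= Z w}.
  move=> Wi hW.
  (* The maximum of [W] and [Z] is still below every price, so its mean is at most [phi X0], hence
     at most that of [Z]. *)
  have WZi := itg_max Wi Zi.
  have h : Exp (fun w => Num.max (W w) (Z w)) <= phi X0.
    apply: phi_ge => // X' Y Z' D; apply: Eon_ae_le => //; first exact: price_itg D.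
    by apply: filterS2 (hW _ _ _ D) (Zle _ _ _ D) => w a b; rewrite ge_max a b.
  have h0 w : setT w -> 0 <= Num.max (W w) (Z w) - Z w.
    by move=> _; rewrite subr_ge0 le_max lexx orbT.
  have hE : Exp (fun w => Num.max (W w) (Z w) - Z w) <= 0 by rewrite EonB//; lra.
  have := Eon_le0_ae_le0 measurableT (itgB WZi Zi) h0 hE.
  apply: filterS => w /(_ Logic.I) e.
  have : W w <= Num.max (W w) (Z w) by rewrite le_max lexx.
  lra.
exists f, Z; split => //.
- have LpP := Lp_pos p1 sG LX0; have LpN := Lp_pos p1 sG (LpN p1 sG LX0).
  have MP := M_Lp S Ts Tt st LpP; have MN := M_Lp S Ts Tt st LpN.
  have up := Zle _ _ _ (dominating_self LX0).
  have low : {ae P, forall w, - M s t (fun w => Num.max (- X0 w) 0) w <= Z w}.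
    apply: Zglb; first by apply: itgN; exact: (Lp_itg p1 sH MN).
    by move=> X' Y Z' D; exact: price_ge D.
  have MP0 := ((M_op S Ts Tt st).1 _ LpP).2; have MN0 := ((M_op S Ts Tt st).1 _ LpN).2.
  apply: (Lp_ae_le p1 sH (LpD p1 sH MP MN)) => //.
  apply: filterS3 (filterI up low) (filterI MP0 MN0)
    (filterI (m_zero S Ts Tt st) (x_zero S Ts Tt st)) => w [a b] [c e] [g k].
  rewrite /price g k subr0 add0r in a.
  rewrite [leRHS]ger0_norm ?addr_ge0// ler_norml; apply/andP; split; lra.
- by apply: filterS az => w ->; congr EFin; rewrite /Z; lra.
Unshelve. all: by end_near. Qed.
End strict_step.

(** * The value of the one-step dual problem *)

Section step_value.
Context d (Omega : measurableType d) (R : realType) (P : probability Omega R).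
Variables (T : R) (F : R -> set (set Omega)) (p : \bar R) (TT : set R).
Variables (L : R -> set (Omega -> R)) (x m M : R -> R -> (Omega -> R) -> Omega -> R).
Hypothesis S : sandwich_setting P T F p TT L x m M.
Let p1 := setting_p_ge1 S.
Variables s t : R.
Hypotheses (Ts : TT s) (Tt : TT t) (st : s <= t).
Let sG := filtration_subsigma S Tt.
Let sH := filtration_subsigma S Ts.
Notation Lpt := (Lp P p (F t)).
Notation Lppt := (Lp_ge0 P p (F t)).
Notation ce := (rce P (F s)).
Notation Dse := (DSe P p F m M s t).
Notation alpha := (min_penalty P F L x s t).

(* Z is the value at X of the one-step dual problem, which has a maximizer. *)
Definition step_value (X Z : Omega -> R) :=
  [/\ Lp P p (F s) Z,
      exists2 f, Dse f &
        {ae P, forall w, alpha f w = (ce (fun w => f w * X w) w - Z w)%:E} &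
      forall f, Dse f ->
        {ae P, forall w, (ce (fun w => f w * X w) w - Z w)%:E <= alpha f w}%E].

Let fi f X : Dse f -> Lpt X -> itg P (fun w => f w * X w).
Proof. by move=> Df; exact: (Dse_itgM S Tt Df). Qed.

Let pen0 f : Dse f -> {ae P, forall w, 0 <= alpha f w}%E.
Proof. by move=> Df; apply: (penalty_ge0 S Ts Tt st) => X; exact: fi. Qed.

Let Dse_ce1 f : Dse f -> {ae P, forall w, ce f w = 1}.
Proof.
move=> Df; apply: (rce_unique sH); [exact: (Dse_itg S Tt Df)|exact: (itg_cst P 1)|exact: measurable_cst|].
move=> A HA; rewrite (Dse_one S Ts Tt Df HA).
by rewrite (Eon_cst P 1) ?mul1r//; exact: (gsetM sH).
Qed.

(** [X] factors out and E[f|F_s] = 1. The positive and negative parts are treated separately because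
    the weight in [rce_pull_out] must be nonnegative. *)
Lemma Dse_ce_known f X : Dse f -> Lp P p (F s) X ->
  {ae P, forall w, ce (fun w => f w * X w) w = X w}.
Proof.
move=> Df LX.
have pos Y : Lp P p (F s) Y -> (forall w, 0 <= Y w) -> forall A, F s A ->
    Eon P A (fun w => f w * Y w) = Eon P A Y.
  move=> LY Y0 A HA; have LtY := Lp_le S Ts Tt st LY.
  have fY := fi Df LtY.
  have Yf : itg P (fun w => Y w * f w).
    by move: fY; congr itg; apply/funext => w; rewrite mulrC.
  have [ri h] := rce_pull_out sH (Dse_itg S Tt Df) LY.1 Y0 Yf.
  rewrite (_ : (fun w => f w * Y w) = fun w => Y w * f w); last first.
    by apply/funext => w; rewrite mulrC.
  rewrite -h//; apply: Eon_ae_eq => //.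
  - exact: (gsetM sH).
  - exact: (itg_measurable ri).
  - exact: (Lp_measurable sH LY).
  by apply: filterS (Dse_ce1 Df) => w ->; rewrite mulr1.
have LXp := (Lp_pos p1 sH LX).1; have LXn := (Lp_pos p1 sH (LpN p1 sH LX)).1.
have Xi := Lp_itg p1 sH LX.
apply: (rce_unique sH) => //; [exact/(fi Df)/(Lp_le S Ts Tt st)|by case: LX|].
move=> A HA; have mA := gsetM sH HA.
have XE w : X w = Num.max (X w) 0 - Num.max (- X w) 0.
  by exact/esym/(congr1 (@^~ w) (funrposBneg X)).
rewrite (_ : (fun w => f w * X w) = fun w => f w * Num.max (X w) 0 - f w * Num.max (- X w) 0); last first.
  by apply/funext => w; rewrite {1}XE mulrBr.
rewrite [in RHS](_ : X = fun w => Num.max (X w) 0 - Num.max (- X w) 0); last by apply/funext.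
rewrite !EonB//; [|exact: (Lp_itg p1 sH)|exact: (Lp_itg p1 sH)
  |apply: (fi Df); exact: (Lp_le S Ts Tt st)|apply: (fi Df); exact: (Lp_le S Ts Tt st)].
by congr (_ - _); apply: pos => // w; rewrite le_max lexx orbT.
Qed.

(** The maximizer belonging to one value is admissible for the other. *)
Lemma step_value_unique X Z Z' : step_value X Z -> step_value X Z' ->
  {ae P, forall w, Z w = Z' w}.
Proof.
move=> [_ [f Df af] ub] [_ [f' Df' af'] ub'].
apply: filterS3 (filterI af (ub' _ Df)) af' (ub _ Df') => w [a b] c e.
rewrite a lee_fin in b; rewrite c lee_fin in e.
by apply/eqP; rewrite eq_le; apply/andP; split; lra.
Qed.

Definition step_extension (xb : (Omega -> R) -> Omega -> R) :=
  [/\ operator P Lpt (Lp P p (F s)) xb, op_convex P Lpt xb,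
      sandwich P p (F t) Lpt xb (m s t) (M s t),
      projection_property P p (F s) Lpt xb &
      forall X, L t X -> xb X = x s t X %[ae P]].

(** For [s < t] this is strong duality. For [s = t], indicators of [F s] need not lie in [L t], so a
    subgradient cannot be normalized as before; but every variable is then known at time [s], and
    the value at [X] is [X], attained at density 1. *)
Lemma step_value_exists X : Lpt X -> exists Z, [/\ step_value X Z,
  L t X -> {ae P, forall w, Z w = x s t X w} &
  forall xb, step_extension xb -> {ae P, forall w, xb X w <= Z w}].
Proof.
move=> LX; have := st; rewrite le_eqVlt => /predU1P[e|slt]; last first.
  have [f [Z [Df LZ az Zle Zglb]]] := strict_step_attained S Ts Tt slt LX.
  have L_lin (a : R) Y Y' : L t Y -> L t Y' -> L t (a *: Y + Y').
    exact: (star_linear (setting_star S)).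
  exists Z; split; last 2 first.
  - move=> LtX.
    have up := Zle X 0 0.
    have L00 := Lp_ge0_cst P (F t) p1 (lexx 0).
    have {}up : {ae P, forall w, Z w <= price x m M s t X 0 0 w}.
      by apply: up; split => //; exact: aeW.
    have low : {ae P, forall w, x s t X w <= Z w}.
      apply: Zglb; first exact: (x_itg S Ts Tt st).
      move=> X' Y Z' [LX' LY LZ' h].
      have := sandwich_convex_le p1 sG L_lin (L0 S Tt)
        (star_convex (setting_star S) Ts Tt st) (setting_sandwich S Ts Tt st)
        (mM_superlinear (setting_mM S) Ts Tt st).2 (mM_sublinear (setting_mM S) Ts Tt st).2
        LtX LX' LY LZ' h.
      by apply: filterS => w; rewrite /price; lra.
    apply: filterS3 up low (filterI (m_zero S Ts Tt st) (M_zero S Ts Tt st)) => w a b [c g].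
    by rewrite /price c g subr0 addr0 in a; apply/eqP; rewrite eq_le a b.
  - move=> xb [xb_op xb_cvx xb_sw _ xb_ext].
    have LxbX := xb_op.1 _ LX.
    apply: Zglb; first exact: (Lp_itg p1 sH LxbX).
    move=> X' Y Z' [LX' LY LZ' h].
    have := sandwich_convex_le p1 sG (Lp_linear p1 sG) (Lp_cst P (F t) p1 0)
      xb_cvx xb_sw
      (mM_superlinear (setting_mM S) Ts Tt st).2 (mM_sublinear (setting_mM S) Ts Tt st).2
      LX (L_Lp S Tt LX') LY LZ' h.
    apply: filterS2 (xb_ext _ LX') => w /(_ Logic.I) ->.
    by rewrite /price; lra.
  split => //; first by exists f.
  move=> f' Df'.
  (* Improves [Z] by the objective of a competing [f'] wherever its penalty is finite. By weak
     duality [W] is still below every price, and maximality of [Z] among such variables gives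
     [W <= Z]. *)
  pose W w := if alpha f' w == +oo%E then Z w else
    Num.max (ce (fun w => f' w * X w) w - fine (alpha f' w)) (Z w).
  have mZ := Lp_measurable sH LZ.
  have fX := fi Df' LX.
  have ma := gfun_measurable sH (penalty_gmf S Ts Tt st (fun X => @fi f' X Df')).
  have mW : measurable_fun setT W.
    apply: measurable_fun_ifT => //.
      exact: measurable_fun_eqe.
    apply: measurable_maxr => //; apply: measurable_funB.
      exact: (itg_measurable (rce_itg sH fX)).
    exact: measurableT_comp.
  have Wle X' Y Z' : dominating P F p L t X X' Y Z' ->
      {ae P, forall w, W w <= price x m M s t X' Y Z' w}.
    move=> D; apply: filterS3 (Zle _ _ _ D) (weak_duality S Ts Tt slt Df' LX D) (pen0 Df') => w a b c.
    rewrite /W; case: ifPn => // aoo; rewrite ge_max a andbT.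
    have af : alpha f' w \is a fin_num by rewrite ge0_fin_numE// ltey.
    by rewrite -(fineK af) lee_fin in b; lra.
  have D0 := dominating_self S Tt LX.
  have pi := price_itg S Ts Tt slt D0.
  have Zi := Lp_itg p1 sH LZ.
  have Wi : itg P W.
    apply: (itg_ae_le mW _ (itgD (itg_norm Zi) (itg_norm pi))).
    apply: filterS (Wle _ _ _ D0) => w a.
    have ZW : Z w <= W w by rewrite /W; case: ifP => // _; rewrite le_max lexx orbT.
    rewrite ler_norml; apply/andP; split.
      have := ler_norm (- Z w); rewrite normrN.
      have := normr_ge0 (price x m M s t 0 (fun w => Num.max (X w) 0) 0 w); lra.
    by apply: (le_trans a); apply: (le_trans (ler_norm _)); rewrite lerDr.
  apply: filterS2 (Zglb W Wi Wle) (pen0 Df') => w a b.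
  move: a; rewrite /W; case: ifPn => [/eqP -> _|aoo]; first exact: leey.
  have af : alpha f' w \is a fin_num by rewrite ge0_fin_numE// ltey.
  rewrite ge_max => /andP[a _].
  by rewrite -(fineK af) lee_fin; lra.
have LX' : Lp P p (F s) X by rewrite e.
exists X; split; last 2 first.
- move=> LtX; have := star_projection (setting_star S) Ts Tt st LX' LtX.
  by apply: filterS => w /(_ Logic.I) ->.
- move=> xb [_ _ _ xb_proj _]; have := xb_proj _ LX' LX.
  by apply: filterS => w /(_ Logic.I) ->.
have one : forall X, (fun w => cst 1 w * X w) = X :> (Omega -> R).
  by move=> X'; apply/funext => w; rewrite /= mul1r.
(* The bounds required of density 1 are m(Y) <= Y <= M(Y) for coinciding times. *)
have D1 : Dse (cst 1).
  apply: (Dse_intro S Ts Tt st).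
  - exact: (Lp_cst P (F t) (hoelder_conj_ge1 p1) 1).
  - by apply: aeW => w /=.
  - by move=> A HA; rewrite (Eon_cst P 1) ?mul1r//; exact: (gsetM sH).
  - move=> Y LY; rewrite one; have Yi := Lp_itg p1 sG LY.1; split => // A HA.
    have mA := gsetM sH HA.
    have mi := m_itg S Ts Tt st LY; have Mi := M_itg S Ts Tt st LY.
    have h1 := m_refl_le S Tt LY; have h2 := M_refl_ge S Tt LY.
    by rewrite !Eon_ae_le//; [move: h2; rewrite -e|move: h1; rewrite -e].
split => //.
- exists (cst 1) => //.
  have le0 : {ae P, forall w, (alpha (cst (1 : R)%R) w <= 0%E)%E}.
    apply: (penalty_le S Ts Tt st (fun X => @fi (cst 1) X D1)) => //.
    move=> U LU; have LpU := L_Lp S Tt LU; rewrite one.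
    have LsU : Lp P p (F s) U by rewrite e.
    have h1 := rce_id sH (Lp_itg p1 sH LsU) LsU.1.
    have h2 := star_projection (setting_star S) Ts Tt st LsU LU.
    apply: filterS2 h1 h2 => w -> /(_ Logic.I) ->.
    by rewrite subrr.
  have h1 := rce_id sH (Lp_itg p1 sH LX') LX'.1.
  rewrite one; apply: filterS3 le0 (pen0 D1) h1 => w a b ->.
  by rewrite subrr; apply/eqP; rewrite eq_le a b.
- move=> f Df; apply: filterS2 (Dse_ce_known Df LX') (pen0 Df) => w -> b.
  by rewrite subrr.
Qed.

Lemma step_value_L X Z : L t X -> step_value X Z -> {ae P, forall w, Z w = x s t X w}.
Proof.
move=> LX SZ; have [Z' [SZ' h _]] := step_value_exists (L_Lp S Tt LX).
by apply: filterS2 (step_value_unique SZ SZ') (h LX) => w -> ->.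
Qed.

Lemma step_value_max xb X Z : step_extension xb -> Lpt X -> step_value X Z ->
  {ae P, forall w, xb X w <= Z w}.
Proof.
move=> xbP LX SZ; have [Z' [SZ' _ h]] := step_value_exists LX.
by apply: filterS2 (step_value_unique SZ SZ') (h _ xbP) => w ->.
Qed.

Lemma step_value_monotone X Y Z Z' : Lpt X -> Lpt Y ->
  {ae P, forall w, X w <= Y w} -> step_value X Z -> step_value Y Z' ->
  {ae P, forall w, Z w <= Z' w}.
Proof.
move=> LX LY XY [_ [f Df af] _] [_ _ ub].
have h : {ae P, forall w, ce (fun w => f w * X w) w <= ce (fun w => f w * Y w) w}.
  apply: (rce_ae_le sH); [exact: fi|exact: fi|].
  by apply: filterS2 XY (Dse_gt0 Df) => w a b; rewrite ler_pM2l.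
apply: filterS3 h af (ub _ Df) => w a b c.
by rewrite b lee_fin in c; lra.
Qed.

(** The value is a supremum of affine functions of the argument; only the maximizer for the
    combination has to be tested. *)
Lemma step_value_convex (a : R) X Y Z1 Z2 Z : 0 <= a <= 1 -> Lpt X -> Lpt Y ->
  step_value X Z1 -> step_value Y Z2 -> step_value (a *: X + (1 - a) *: Y) Z ->
  {ae P, forall w, Z w <= a * Z1 w + (1 - a) * Z2 w}.
Proof.
move=> /andP[a0 a1] LX LY [_ _ ub1] [_ _ ub2] [_ [f Df af] _].
have fX := fi Df LX; have fY := fi Df LY.
have e : (fun w => f w * (a *: X + (1 - a) *: Y) w) =
         fun w => a * (f w * X w) + (1 - a) * (f w * Y w).
  apply/funext => w; rewrite -[LHS]/(f w * (a * X w + (1 - a) * Y w)); ring.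
rewrite e in af.
have h1 := rceD sH (itgZ a fX) (itgZ (1 - a) fY).
have h2 := rceZ sH a fX; have h3 := rceZ sH (1 - a) fY.
apply: filterS3 (filterI af h1) (filterI h2 h3) (filterI (ub1 _ Df) (ub2 _ Df)) => w [b c] [g k] [u v].
rewrite b lee_fin in u; rewrite b lee_fin in v.
rewrite c g k in u v.
have u' := ler_wpM2l a0 u.
have v' := ler_wpM2l (_ : 0 <= 1 - a) v.
rewrite subr_ge0 in v'; have {}v' := v' a1.
move: u' v'; set A := rce _ _ _ _; set B := rce _ _ _ _; nra.
Qed.

(** The maximizer at 0: both the value x(0) and E[f 0|F_s] vanish, hence so does the penalty. *)
Let zero_penalty : exists2 f, Dse f & {ae P, forall w, alpha f w = 0%E}.
Proof.
have Lp00 : Lpt 0 by exact: (Lp_cst P (F t) p1 0).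
have [Z [SZ h _]] := step_value_exists Lp00.
have [_ [f Df af] _] := SZ; exists f => //.
have h1 := Dse_ce_known Df (Lp_cst P (F s) p1 0).
apply: filterS3 (filterI af h1) (h (L0 S Tt)) (x_zero S Ts Tt st) => w [-> b] c g.
rewrite c g subr0; congr EFin; exact: b.
Qed.

(** On [A] the objectives for [X] and [1_A X] coincide, so each maximizer can be tested in the other
    problem. Off [A] the objective is minus a nonnegative penalty, and a density of zero penalty
    attains 0. *)
Lemma step_value_hom A X Z Z' : F s A -> Lpt X ->
  step_value X Z -> step_value (\1_A \* X) Z' ->
  {ae P, forall w, Z' w = \1_A w * Z w}.
Proof.
move=> HA LX [LZ [f Df af] ub] [LZ' [f' Df' af'] ub'].
have mA := gsetM sH HA.
have [f0 Df0 af0] := zero_penalty.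
have loc g : Dse g -> {ae P, forall w, ce (fun w => g w * (\1_A \* X) w) w = \1_A w * ce (fun w => g w * X w) w}.
  move=> Dg; have gX := fi Dg LX.
  rewrite (_ : (fun w => g w * (\1_A \* X) w) = \1_A \* (fun w => g w * X w)); last first.
    by apply/funext => w /=; rewrite mulrCA.
  apply: (rce_unique sH).
  - exact: itg_indicM.
  - by apply: itg_indicM => //; exact: (rce_itg sH).
  - by apply: measurable_funM; [exact: (gindic sH)|exact: (rce_measurable sH)].
  - by move=> B HB; rewrite !Eon_indic (rceE sH)//; exact: (gsetI sH).
apply: filterS3 (filterI (loc _ Df) (filterI (loc _ Df') (loc _ Df0)))
  (filterI (filterI af (filterI af' af0)) (pen0 Df'))
  (filterI (ub _ Df') (filterI (ub' _ Df) (ub' _ Df0)))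
  => w [a1 [a2 a3]] [[b1 [b2 b3]] b4] [c1 [c2 c3]].
rewrite a1 b1 lee_fin in c2; rewrite a3 b3 lee_fin in c3.
rewrite a2 in b2; rewrite b2 lee_fin in c1; rewrite b2 lee_fin in b4.
move: c1 c2 c3 b4; rewrite indicE; case: (w \in A); rewrite /= ?mul1r ?mul0r => c1 c2 c3 b4.
- by apply/eqP; rewrite eq_le; apply/andP; split; lra.
- by apply/eqP; rewrite eq_le; apply/andP; split; lra.
Qed.

(** Every admissible density gives E[fX|F_s] = X, so only the least penalty matters, and it is 0. *)
Lemma step_value_projection X Z : Lp P p (F s) X -> step_value X Z ->
  {ae P, forall w, Z w = X w}.
Proof.
move=> LX [_ [f Df af] ub]; have [f0 Df0 af0] := zero_penalty.
apply: filterS3 (filterI (Dse_ce_known Df LX) (Dse_ce_known Df0 LX)) (filterI af af0)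
  (filterI (pen0 Df) (ub _ Df0)) => w [a1 a2] [b1 b2] [c1 c2].
rewrite b1 a1 lee_fin in c1; rewrite b2 a2 lee_fin in c2.
by apply/eqP; rewrite eq_le; apply/andP; split; lra.
Qed.

(** At the maximizer, nonnegativity of the penalty gives Z <= E[fX|F_s]; the rest is the conditional
    expectation under [f] of [Z' + X <= Y]. *)
Lemma step_value_sandwich X Y Z' Z : Lpt X -> Lppt Y -> Lppt Z' ->
  {ae P, forall w, Z' w + X w <= Y w} -> step_value X Z ->
  {ae P, forall w, m s t Z' w + Z w <= M s t Y w}.
Proof.
move=> LX LY LZ' h [_ [f Df af] _].
have fX := fi Df LX; have fY := fi Df LY.1; have fZ := fi Df LZ'.1.
have h1 : {ae P, forall w, ce (fun w => f w * Z' w + f w * X w) w <= ce (fun w => f w * Y w) w}.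
  apply: (rce_ae_le sH) => //; first exact: itgD.
  by apply: filterS2 h (Dse_gt0 Df) => w a b; rewrite -mulrDr ler_pM2l.
have h2 := rceD sH fZ fX.
have h3 := Dse_m S Ts Tt Df LZ'; have h4 := Dse_M S Ts Tt Df LY.
apply: filterS3 (filterI h1 h2) (filterI h3 h4) (filterI af (pen0 Df)) => w [a1 a2] [b1 b2] [c1 c2].
rewrite c1 lee_fin in c2; rewrite a2 in a1; lra.
Qed.

Lemma step_value_ae X Y Z : Lpt X -> {ae P, forall w, X w = Y w} ->
  step_value X Z -> step_value Y Z.
Proof.
move=> LX XY [LZ [f Df af] ub].
have LY := Lp_ae_eq p1 sG LX XY.
have h g : Dse g -> {ae P, forall w, ce (fun w => g w * X w) w = ce (fun w => g w * Y w) w}.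
  move=> Dg; apply: (rce_ae_eq sH); [exact: fi|exact: fi|].
  by apply: filterS XY => w ->.
split => //.
- by exists f => //; apply: filterS2 af (h _ Df) => w -> ->.
- by move=> g Dg; apply: filterS2 (ub _ Dg) (h _ Dg) => w + <-.
Qed.

End step_value.

(** * Composition along the grid *)

Section weighted_integrals.
Context d (Omega : measurableType d) (R : realType) (P : probability Omega R).
Variable G : set (set Omega).
Hypothesis sG : subsigma P G.
Notation gmf := (measurable_fun [set: g_sigma_algebraType G]).

Lemma Eon_le_integral A U (W : Omega -> \bar R) : measurable A -> itg P U ->
  measurable_fun setT W -> {ae P, forall w, 0 <= W w}%E ->
  {ae P, forall w, (U w)%:E <= W w}%E ->
  ((Eon P A U)%:E <= \int[P]_(w in A) W w)%E.
Proof.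
move=> mA Ui mW W0 UW.
have Upi := itg_max Ui (itg_cst P 0).
have h1 : Eon P A U <= Eon P A (fun w => Num.max (U w) 0).
  by apply: Eon_ae_le => //; apply: aeW => w; rewrite le_max lexx.
apply: (@le_trans _ _ (Eon P A (fun w => Num.max (U w) 0))%:E); first by rewrite lee_fin.
rewrite EonE//.
rewrite -(integral_ae_abs mA mW W0).
apply: ae_ge0_le_integral => //.
- by move=> w _; rewrite lee_fin le_max lexx orbT.
- by apply: measurable_funTS; apply/measurable_EFinP; exact: (itg_measurable Upi).
- by apply: measurable_funTS; exact: measurableT_comp.
- apply: filterS2 UW W0 => w a b _; rewrite gee0_abs//.
  by have [_|_] := leP (U w) 0.
Qed.

(** Where [U < 0] the claim holds since [W >= 0], so each test event is cut down to the part where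
    [U >= 0]; this compares the positive part of [U] with |W|. *)
Lemma ae_le_Eon_integral (U : Omega -> R) (W : Omega -> \bar R) : gmf U -> itg P U ->
  gmf W -> {ae P, forall w, 0 <= W w}%E ->
  (forall A, G A -> (Eon P A U)%:E <= \int[P]_(w in A) W w)%E ->
  {ae P, forall w, (U w)%:E <= W w}%E.
Proof.
move=> gU Ui gW W0 h.
have mW := gfun_measurable sG gW.
have absW A : G A -> (\int[P]_(w in A) `|W w| = \int[P]_(w in A) W w)%E.
  by move=> GA; apply: integral_ae_abs => //; exact: (gsetM sG).
have gUp : gmf (fun w => Num.max (U w) 0) by exact: measurable_maxr.
have Upi : itg P (fun w => Num.max (U w) 0) := itg_max Ui (itg_cst P 0).
pose B := [set w | 0 <= U w].
have GB : G B.
  apply/(gmeasurableP sG); rewrite -[X in measurable X]setTI.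
  rewrite (_ : B = U @^-1` `[0, +oo[%classic); last first.
    by apply/seteqP; split => w /=; rewrite in_itv/= andbT.
  exact: gU.
have := @ge0_ae_le_integral _ _ _ _ _ sG (fun w => (Num.max (U w) 0)%:E) (fun w => `|W w|%E).
move=> k; apply: (@filterS2 _ _ _ _ _ _ _ (k _ _ _ _ _) W0).
- move=> w a b; rewrite gee0_abs// in a; apply: le_trans a.
  by rewrite lee_fin le_max lexx.
- exact/measurable_EFinP.
- exact: measurableT_comp.
- by move=> w; rewrite lee_fin le_max lexx orbT.
- by move=> w; exact: abse_ge0.
- move=> A GA; have mA := gsetM sG GA; have mB := gsetM sG GB.
  have GAB := gsetI sG GA GB.
  rewrite -EonE//.
  have -> : Eon P A (fun w => Num.max (U w) 0) = Eon P (A `&` B) U.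
    rewrite -Eon_indic//; congr Eon; apply/funext => w.
    rewrite /= indicE; have [wB|wB] := boolP (w \in B).
      by rewrite mul1r (max_idPl _)//; move: wB; rewrite inE.
    rewrite mul0r (max_idPr _)//; apply/ltW; rewrite ltNge; apply/negP => k0.
    by move/negP: wB; apply; rewrite inE.
  rewrite (le_trans (h _ GAB))// -absW//.
  apply: ge0_subset_integral => //; first exact: measurableI.
  by apply: measurable_funTS; exact: measurableT_comp.
Qed.

Lemma ae_eq_Eon_integral (U : Omega -> R) (W : Omega -> \bar R) : gmf U -> itg P U ->
  gmf W -> {ae P, forall w, 0 <= W w}%E ->
  (forall A, G A -> (Eon P A U)%:E = \int[P]_(w in A) W w)%E ->
  {ae P, forall w, (U w)%:E = W w}%E.
Proof.
move=> gU Ui gW W0 h; have mW := gfun_measurable sG gW.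
have le1 : {ae P, forall w, (U w)%:E <= W w}%E.
  by apply: ae_le_Eon_integral => // A GA; rewrite h.
have absW A : G A -> (\int[P]_(w in A) `|W w| = \int[P]_(w in A) W w)%E.
  by move=> GA; apply: integral_ae_abs => //; exact: (gsetM sG).
have U0 : {ae P, forall w, 0 <= U w}.
  apply: (ae_le_Eon sG (f := cst 0)) => //; first exact: itg_cst.
  move=> A GA; rewrite (Eon_cst P 0) ?mul0r; last exact: (gsetM sG).
  by rewrite -lee_fin h// -absW//; apply: integral_ge0 => w _; exact: abse_ge0.
have le2 : {ae P, forall w, `|W w| <= `|(U w)%:E|}%E.
  apply: (ge0_ae_le_integral sG).
  - exact: measurableT_comp.
  - by apply: measurableT_comp => //; exact/measurable_EFinP.
  - by move=> w; exact: abse_ge0.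
  - by move=> w; exact: abse_ge0.
  - move=> A GA; have mA := gsetM sG GA; rewrite absW// -h//.
    rewrite EonE// le_eqVlt; apply/orP; left; apply/eqP.
    apply: ae_eq_integral => //.
    + by apply: measurable_funTS; apply/measurable_EFinP; exact: (itg_measurable Ui).
    + apply: measurable_funTS; apply: measurableT_comp => //.
      by apply/measurable_EFinP; exact: (itg_measurable Ui).
    + by apply: filterS U0 => w k _; rewrite gee0_abs.
apply: filterS3 (filterI le1 U0) le2 W0 => w [a c] b e.
apply/eqP; rewrite eq_le a/=; move: b; rewrite !gee0_abs//.
Qed.

(** Used to replace the full density by the partial product up to time l in front of the penalty of
    step l, which is known at that time but possibly infinite. *)
Lemma weighted_integral_eq (N N' : Omega -> R) (a : Omega -> \bar R) A :
  itg P N -> itg P N' -> {ae P, forall w, 0 <= N w} -> {ae P, forall w, 0 <= N' w} ->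
  (forall B, G B -> Eon P B N = Eon P B N') ->
  gmf a -> {ae P, forall w, 0 <= a w}%E -> G A ->
  (\int[P]_(w in A) ((N w)%:E * a w) = \int[P]_(w in A) ((N' w)%:E * a w))%E.
Proof.
move=> Ni N'i N0 N'0 NN' ga a0 GA; have mA := gsetM sG GA.
have ma := gfun_measurable sG ga.
pose b w := ((\1_A w)%:E * `|a w|)%E.
have gb : gmf b.
  apply: emeasurable_funM; last exact: measurableT_comp.
  by apply/measurable_EFinP; exact: (gindic sG).
have toT V : itg P V -> {ae P, forall w, 0 <= V w} ->
    (\int[P]_(w in A) ((V w)%:E * a w) = \int[P]_w (b w * (`|V w|)%:E))%E.
  move=> Vi V0; have mV := itg_measurable Vi.
  rewrite integral_mkcond; apply: ae_eq_integral => //.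
  - apply/(measurable_restrictT _ mA)/measurable_funTS; apply: emeasurable_funM => //.
    exact/measurable_EFinP.
  - apply: emeasurable_funM; first exact: (gfun_measurable sG gb).
    by apply/measurable_EFinP; exact: measurableT_comp.
  - move: V0 a0; apply: filterS2 => w v0 aw0 _.
    rewrite patchE /b indicE; case: ifPn => _; last by rewrite !mul0e.
    by rewrite mul1e ger0_norm// gee0_abs// muleC.
rewrite !toT//; apply: (ge0_weighted_eq sG) => //.
- by apply: measurableT_comp => //; exact: (itg_measurable Ni).
- by apply: measurableT_comp => //; exact: (itg_measurable N'i).
- move=> B GB; have mB := gsetM sG GB; have := NN' _ GB.
  have e V : itg P V -> {ae P, forall w, 0 <= V w} ->
      (\int[P]_(w in B) (`|V w|)%:E = (Eon P B V)%:E)%E.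
    move=> Vi V0; rewrite -EonE//; last exact: itg_norm.
    congr EFin; apply: Eon_ae_eq => //.
    + by apply: measurableT_comp => //; exact: (itg_measurable Vi).
    + exact: (itg_measurable Vi).
    + by apply: filterS V0 => w k; rewrite ger0_norm.
  by rewrite !e// => ->.
- by move=> w; rewrite mule_ge0.
Qed.

(** The terms are nonnegative only almost surely; absolute values replace them so that additivity of
    nonnegative integrals applies. *)
Lemma ae_ge0_integral_sum (C : nat -> Omega -> \bar R) (s : seq nat) A :
  measurable A -> (forall l, l \in s -> measurable_fun setT (C l)) ->
  (forall l, l \in s -> {ae P, forall w, 0 <= C l w}%E) ->
  (\int[P]_(w in A) \sum_(l <- s) C l w = \sum_(l <- s) \int[P]_(w in A) C l w)%E.
Proof.
move=> mA mC C0.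
pose D l w := if l \in s then `|C l w|%E else 0%E.
have mD l : measurable_fun A (D l).
  apply: measurable_funTS; rewrite /D; have [ls|_] := boolP (l \in s).
    by apply: measurableT_comp => //; exact: mC.
  exact: measurable_cst.
have DC l : l \in s -> {ae P, forall w, C l w = D l w}.
  by move=> ls; apply: filterS (C0 _ ls) => w h; rewrite /D ls gee0_abs.
have sumE r : {subset r <= s} -> {ae P, forall w, \sum_(l <- r) C l w = \sum_(l <- r) D l w}%E.
  elim: r => [_|l r IH rs]; first by apply: aeW => w; rewrite !big_nil.
  have h1 := DC l (rs _ (mem_head _ _)).
  have h2 : {ae P, forall w, \sum_(l <- r) C l w = \sum_(l <- r) D l w}%E.
    by apply: IH => k kr; apply: rs; rewrite in_cons kr orbT.
  by apply: filterS2 h1 h2 => w e1 e2; rewrite !big_cons e1 e2.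
have mS r : {subset r <= s} -> measurable_fun setT (fun w => \sum_(l <- r) C l w)%E.
  elim: r => [_|l r IH rs].
    by apply: (eq_measurable_fun (cst 0%E)) => // w _; rewrite big_nil.
  apply: (eq_measurable_fun (fun w => C l w + \sum_(l <- r) C l w)%E).
    by move=> w _; rewrite big_cons.
  apply: emeasurable_funD; first by apply: mC; apply: rs; rewrite mem_head.
  by apply: IH => k kr; apply: rs; rewrite in_cons kr orbT.
transitivity (\int[P]_(w in A) \sum_(l <- s) D l w)%E.
  apply: ae_eq_integral => //.
  - by apply: measurable_funTS; exact: mS.
  - exact: emeasurable_sum.
  - by apply: filterS (sumE s (fun _ => id)) => w e _.
rewrite ge0_integral_sum//; last by move=> l w _; rewrite /D; case: ifP.
rewrite big_seq [RHS]big_seq; apply: eq_bigr => l ls.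
apply: ae_eq_integral => //; first by apply: measurable_funTS; exact: mC.
by apply: filterS (DC l ls) => w e _.
Qed.

Lemma rce_pull_out_ae (f N : Omega -> R) : itg P f -> gmf N -> {ae P, forall w, 0 <= N w} ->
  itg P (fun w => N w * f w) ->
  itg P (fun w => N w * rce P G f w) /\
  (forall A, G A -> Eon P A (fun w => N w * rce P G f w) = Eon P A (fun w => N w * f w)).
Proof.
move=> fi gN N0 Nf.
have mN := gfun_measurable sG gN.
have mf := itg_measurable fi.
have mr := itg_measurable (rce_itg sG fi).
have mNr : measurable_fun setT (fun w => N w * rce P G f w) by exact: measurable_funM.
have ab V : {ae P, forall w, `|N w| * V w = N w * V w}.
  by apply: filterS N0 => w h; rewrite ger0_norm.
have gaN : gmf (fun w => `|N w|) by exact: measurableT_comp.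
have maN := gfun_measurable sG gaN.
have aNf : itg P (fun w => `|N w| * f w).
  apply: itg_ae_eq Nf; first exact: measurable_funM.
  by apply: filterS (ab f) => w ->.
have [ri h] := rce_pull_out sG fi gaN (fun w => normr_ge0 _) aNf.
split; first by apply: (itg_ae_eq _ _ ri) => //; exact: ab.
move=> A GA; have mA := gsetM sG GA; have := h _ GA.
have e V : measurable_fun setT V -> Eon P A (fun w => `|N w| * V w) = Eon P A (fun w => N w * V w).
  by move=> mV; apply: Eon_ae_eq (ab V) => //; exact: measurable_funM.
by rewrite !e.
Qed.

End weighted_integrals.

(** * Neighbourhoods defined by functionals from L_q *)

Section lower_semicontinuity.
Context d (Omega : measurableType d) (R : realType) (P : probability Omega R).
Variables (p : \bar R) (G : set (set Omega)).
Hypothesis p1 : (1 <= p)%E.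
Hypothesis sG : subsigma P G.
Let q := hoelder_conjugate p.

(** For p = oo this is a basic weak* neighbourhood, as [q = 1]; for p finite Hölder places a norm
    ball inside. *)
Lemma Lp_nbhs_Eon (h X : Omega -> R) (e : R) : Lp P q G h -> Lp P p G X -> 0 < e ->
  Lp_nbhs P p G X [set Y | Lp P p G Y ->
    `|Eon P setT (fun w => h w * (Y w - X w))| < e].
Proof.
move=> Lh LX e0; rewrite /Lp_nbhs /=.
have mh := Lp_measurable sG Lh; have mX := Lp_measurable sG LX.
have hY Y : Lp P p G Y -> itg P (fun w => h w * (Y w - X w)).
  move=> LY; have LYX := LpB p1 sG LY LX.
  rewrite (_ : (fun w => _) = fun w => (Y w - X w) * h w); last first.
    by apply/funext => w; rewrite mulrC.
  apply: (holder_itg p1) => //; [exact: (Lp_measurable sG LYX)|by case: LYX|by case: Lh].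
case: ifPn => [/eqP poo|pfin].
  exists 1%N, (fun _ => h), e; split => // [_|Y LY hlt _].
    by move: Lh; rewrite /q poo hoelder_conjugatey.
  have := hlt ord0; rewrite unlock -(EonE _ (hY Y LY))//.
pose N := fine ('N[P]_q[EFin \o h])%E.
have N0 : 0 <= N by rewrite fine_ge0// Lnorm_ge0.
have Nfin : ('N[P]_q[EFin \o h])%E = N%:E.
  by rewrite fineK// ge0_fin_numE ?Lnorm_ge0//; case: Lh.
(* [N] is the L_q norm of [h]; the [+ 1] covers [h = 0]. *)
exists (e / (N + 1)); first by rewrite divr_gt0// ltr_wpDl.
move=> Y LY hlt _; have LYX := LpB p1 sG LY LX.
have := @holder_conj _ _ _ P p (Y \- X)%R h p1 (Lp_measurable sG LYX) mh LYX.2 Lh.2.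
rewrite Lnorm1 => hh.
rewrite -lte_fin.
apply: (@le_lt_trans _ _ (\int[P]_w `|((Y w - X w) * h w)%:E|)%E).
  have i1 := hY Y LY.
  rewrite (_ : (\int[P]_w _)%E = (Eon P setT (fun w => `|h w * (Y w - X w)|))%:E).
    rewrite lee_fin /Eon; apply: le_normr_Rintegral => //.
  rewrite EonE//; last exact: itg_norm.
  by apply: eq_integral => w _; rewrite mulrC.
apply: (le_lt_trans hh); rewrite -/q Nfin.
apply: (@le_lt_trans _ _ ((e / (N + 1))%:E * N%:E)%E).
  by apply: lee_wpmul2r; [rewrite lee_fin|exact: ltW].
rewrite -EFinM lte_fin -mulrA gtr_pMr// mulrC ltr_pdivrMr ?mul1r ?ltrDl//.
by rewrite ltr_wpDl.
Qed.

End lower_semicontinuity.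

(** * Backward composition of one-step values *)

Section steps.
Context d (Omega : measurableType d) (R : realType) (P : probability Omega R).
Variables (F : R -> set (set Omega)) (p : \bar R).
Variables (L : R -> set (Omega -> R)) (x m M : R -> R -> (Omega -> R) -> Omega -> R).
Variable tau : nat -> R.

(** A choice of representative. The default 0 is never met on L_p along the grid, where
    [step_value_exists] provides a value. *)
Definition step (s t : R) (X : Omega -> R) : Omega -> R :=
  xget (cst 0) [set Z | step_value P F p L x m M s t X Z].

(* From time [tau (i + n)] down to [tau i]. *)
Fixpoint steps (i n : nat) (X : Omega -> R) : Omega -> R :=
  if n is n'.+1 then step (tau i) (tau i.+1) (steps i.+1 n' X) else X.

Lemma steps_cat i n k X : steps i (n + k) X = steps i n (steps (i + n) k X).
Proof.
elim: n i => [|n IH] i; first by rewrite addn0.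
rewrite addSn.
rewrite -[LHS]/(step (tau i) (tau i.+1) (steps i.+1 (n + k) X)) IH addSnnS.
reflexivity.
Qed.

End steps.

Section grid_operators.
Context d (Omega : measurableType d) (R : realType) (P : probability Omega R).
Variables (T : R) (F : R -> set (set Omega)) (p : \bar R).
Variables (K : nat) (tau : nat -> R).
Variables (L : R -> set (Omega -> R)) (x m M : R -> R -> (Omega -> R) -> Omega -> R).
Hypothesis tau_le : forall k, (k < K)%N -> tau k <= tau k.+1.
Hypothesis S : sandwich_setting P T F p (grid K tau) L x m M.
Let p1 := setting_p_ge1 S.
Let q := hoelder_conjugate p.
Let q1 : (1 <= q)%E := hoelder_conj_ge1 p1.
Notation gmf G := (measurable_fun [set: g_sigma_algebraType G]).
Notation xh := (xhat P p F L x m M K tau).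
Notation Lpt k := (Lp P p (F (tau k))).
Notation step := (step P F p L x m M).
Notation steps := (steps P F p L x m M tau).

Lemma grid_tau k : (k <= K)%N -> grid K tau (tau k).
Proof. by move=> kK; exists k. Qed.

Lemma tau_monotone i j : (i <= j)%N -> (j <= K)%N -> tau i <= tau j.
Proof.
move=> ij; rewrite -(subnKC ij); elim: (j - i)%N => [|n IH] h; first by rewrite addn0.
rewrite addnS in h *; apply: (le_trans (IH (ltnW h))); exact: tau_le.
Qed.

Section one_step.
Variable i : nat.
Hypothesis iK : (i < K)%N.
Let Ti := grid_tau (ltnW iK).
Let Ti1 := grid_tau iK.
Let le1 := tau_le iK.
Let sG := filtration_subsigma S Ti1.

Lemma stepP X : Lpt i.+1 X ->
  step_value P F p L x m M (tau i) (tau i.+1) X (step (tau i) (tau i.+1) X).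
Proof.
move=> LX; have [Z [SZ _ _]] := step_value_exists S Ti Ti1 le1 LX.
exact: (xgetPex (cst 0) (ex_intro _ Z SZ)).
Qed.

Lemma step_monotone X Y : Lpt i.+1 X -> Lpt i.+1 Y ->
  {ae P, forall w, X w <= Y w} ->
  {ae P, forall w, step (tau i) (tau i.+1) X w <= step (tau i) (tau i.+1) Y w}.
Proof.
by move=> LX LY XY; exact: (step_value_monotone S Ti Ti1 LX LY XY (stepP LX) (stepP LY)).
Qed.

Lemma step_ae X Y : Lpt i.+1 X -> {ae P, forall w, X w = Y w} ->
  {ae P, forall w, step (tau i) (tau i.+1) X w = step (tau i) (tau i.+1) Y w}.
Proof.
move=> LX XY; have LY := Lp_ae_eq p1 sG LX XY.
exact: (step_value_unique (step_value_ae S Ti Ti1 LX XY (stepP LX)) (stepP LY)).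
Qed.

End one_step.

Lemma steps_Lp n i k X : (i + n = k)%N -> (k <= K)%N -> Lpt k X -> Lpt i (steps i n X).
Proof.
elim: n i => [|n IH] i; first by rewrite addn0 => ->.
move=> ik kK LX; have iK : (i < K)%N by apply: leq_trans kK; rewrite -ik -addSnnS leq_addr.
have LV := IH i.+1 (etrans (addSnnS i n) ik) kK LX.
by have [] := stepP iK LV.
Qed.

Lemma steps_monotone n i k X Y : (i + n = k)%N -> (k <= K)%N -> Lpt k X -> Lpt k Y ->
  {ae P, forall w, X w <= Y w} ->
  {ae P, forall w, steps i n X w <= steps i n Y w}.
Proof.
move=> + kK LX LY XY; elim: n i => [//|n IH] i ik.
have iK : (i < K)%N by apply: leq_trans kK; rewrite -ik -addSnnS leq_addr.
have ik' := etrans (addSnnS i n) ik.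
apply: step_monotone => //; [exact: steps_Lp LX|exact: steps_Lp LY|exact: IH].
Qed.

Lemma steps_ae n i k X Y : (i + n = k)%N -> (k <= K)%N -> Lpt k X ->
  {ae P, forall w, X w = Y w} ->
  {ae P, forall w, steps i n X w = steps i n Y w}.
Proof.
move=> + kK LX XY; elim: n i => [//|n IH] i ik.
have iK : (i < K)%N by apply: leq_trans kK; rewrite -ik -addSnnS leq_addr.
have ik' := etrans (addSnnS i n) ik.
by apply: step_ae => //; [exact: steps_Lp LX|exact: IH].
Qed.

Lemma steps_convex n i k (a : R) X Y : (i + n = k)%N -> (k <= K)%N ->
  Lpt k X -> Lpt k Y -> 0 <= a <= 1 ->
  {ae P, forall w, steps i n (a *: X + (1 - a) *: Y) w <=
    a * steps i n X w + (1 - a) * steps i n Y w}.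
Proof.
move=> + kK LX LY a01; have sGk := filtration_subsigma S (grid_tau kK).
have LXY : Lpt k (a *: X + (1 - a) *: Y).
  by apply: (Lp_linear p1 sGk) => //; exact: (LpZ p1 sGk).
elim: n i => [|n IH] i ik.
  by apply: aeW => w /=; rewrite lexx.
have iK : (i < K)%N by apply: leq_trans kK; rewrite -ik -addSnnS leq_addr.
have ik' := etrans (addSnnS i n) ik.
have sG := filtration_subsigma S (grid_tau iK).
have LVX := steps_Lp ik' kK LX; have LVY := steps_Lp ik' kK LY.
have LV := steps_Lp ik' kK LXY.
have LVV : Lpt i.+1 (a *: steps i.+1 n X + (1 - a) *: steps i.+1 n Y).
  by apply: (Lp_linear p1 sG) => //; exact: (LpZ p1 sG).
have h1 := step_monotone iK LV LVV (IH _ ik').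
have h2 := step_value_convex S (grid_tau (ltnW iK)) (grid_tau iK) a01 LVX LVY
  (stepP iK LVX) (stepP iK LVY) (stepP iK LVV).
by apply: filterS2 h1 h2 => w; exact: le_trans.
Qed.

Lemma steps_hom n i k A X : (i + n = k)%N -> (k <= K)%N -> Lpt k X -> F (tau i) A ->
  {ae P, forall w, steps i n (\1_A \* X) w = \1_A w * steps i n X w}.
Proof.
move=> + kK LX; elim: n i => [|n IH] i ik HA; first exact: aeW.
have iK : (i < K)%N by apply: leq_trans kK; rewrite -ik -addSnnS leq_addr.
have ik' := etrans (addSnnS i n) ik.
have HA1 : F (tau i.+1) A.
  exact: (filtration_le S (grid_tau (ltnW iK)) (grid_tau iK) (tau_le iK)).
have HAk : F (tau k) A.
  apply: (filtration_le S (grid_tau iK) (grid_tau kK)) => //.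
  by apply: tau_monotone => //; rewrite -ik' leq_addr.
have sG := filtration_subsigma S (grid_tau iK).
have sGk := filtration_subsigma S (grid_tau kK).
have LV := steps_Lp ik' kK LX.
have LAX := steps_Lp ik' kK (Lp_indicM p1 sGk HAk LX).
have LAV := Lp_indicM p1 sG HA1 LV.
have h1 := step_ae iK LAX (IH _ ik' HA1).
have h2 := step_value_hom S (grid_tau (ltnW iK)) (grid_tau iK) (tau_le iK) HA LV
  (stepP iK LV) (stepP iK LAV).
by apply: filterS2 h1 h2 => w; exact: etrans.
Qed.

Lemma steps_projection n i k X : (i + n = k)%N -> (k <= K)%N -> Lpt i X ->
  {ae P, forall w, steps i n X w = X w}.
Proof.
move=> + kK; elim: n i => [|n IH] i ik LX; first exact: aeW.
have iK : (i < K)%N by apply: leq_trans kK; rewrite -ik -addSnnS leq_addr.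
have ik' := etrans (addSnnS i n) ik.
have Ti := grid_tau (ltnW iK); have Ti1 := grid_tau iK.
have LX1 : Lpt i.+1 X by exact: (Lp_le S Ti Ti1 (tau_le iK)).
have LXk : Lpt k X.
  apply: (Lp_le S Ti1 (grid_tau kK)) => //.
  by apply: tau_monotone => //; rewrite -ik' leq_addr.
have h1 := step_ae iK (steps_Lp ik' kK LXk) (IH _ ik' LX1).
have h2 := step_value_projection S Ti Ti1 (tau_le iK) LX (stepP iK LX1).
by apply: filterS2 h1 h2 => w; exact: etrans.
Qed.

(** The inductive step applies the one-step sandwich to m(Z) and M(Y) taken at the intermediate
    time; weak time consistency has the required direction for both. For no step at all it reduces
    to m(Z) <= Z and Y <= M(Y). *)
Lemma steps_sandwich n i k X Y Z : (i + n = k)%N -> (k <= K)%N ->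
  Lpt k X -> Lp_ge0 P p (F (tau k)) Y -> Lp_ge0 P p (F (tau k)) Z ->
  {ae P, forall w, Z w + X w <= Y w} ->
  {ae P, forall w, m (tau i) (tau k) Z w + steps i n X w <= M (tau i) (tau k) Y w}.
Proof.
move=> + kK LX LY LZ h; have Tk := grid_tau kK; elim: n i => [|n IH] i ik.
  rewrite addn0 in ik; rewrite ik.
  apply: filterS3 h (m_refl_le S Tk LZ) (M_refl_ge S Tk LY) => w a b c /=; lra.
have iK : (i < K)%N by apply: leq_trans kK; rewrite -ik -addSnnS leq_addr.
have ik' := etrans (addSnnS i n) ik.
have Ti := grid_tau (ltnW iK); have Ti1 := grid_tau iK.
have le1 : tau i.+1 <= tau k by apply: tau_monotone => //; rewrite -ik' leq_addr.
have LV := steps_Lp ik' kK LX.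
have LmZ := (mM_operator_m (setting_mM S) Ti1 Tk le1).1 _ LZ.
have LMY := (mM_operator_M (setting_mM S) Ti1 Tk le1).1 _ LY.
have h1 := step_value_sandwich S Ti Ti1 (tau_le iK) LV LMY LmZ (IH _ ik') (stepP iK LV).
have h2 := mM_weak_time_consistent_m (setting_mM S) Ti Ti1 Tk (tau_le iK) le1 LZ.
have h3 := mM_weak_time_consistent_M (setting_mM S) Ti Ti1 Tk (tau_le iK) le1 LY.
by apply: filterS3 h1 h2 h3 => w /= a b c; lra.
Qed.

(** Starting in [L], the composition stays in [L] up to null sets, where the one-step value is [x];
    time consistency of [x] reassembles the steps. *)
Lemma steps_extends n i k X : time_consistent P (grid K tau) L x ->
  (i + n = k)%N -> (k <= K)%N -> L (tau k) X ->
  {ae P, forall w, steps i n X w = x (tau i) (tau k) X w}.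
Proof.
move=> x_tc + kK LX; have Tk := grid_tau kK; elim: n i => [|n IH] i ik.
  rewrite addn0 in ik; rewrite ik.
  have := star_projection (setting_star S) Tk Tk (lexx _) (L_Lp S Tk LX) LX.
  by apply: filterS => w /(_ Logic.I) ->.
have iK : (i < K)%N by apply: leq_trans kK; rewrite -ik -addSnnS leq_addr.
have ik' := etrans (addSnnS i n) ik.
have Ti := grid_tau (ltnW iK); have Ti1 := grid_tau iK.
have le1 : tau i.+1 <= tau k by apply: tau_monotone => //; rewrite -ik' leq_addr.
have [xL _] := star_operator (setting_star S) Ti1 Tk le1.
have LxX := xL _ LX.
have e : {ae P, forall w, x (tau i.+1) (tau k) X w = steps i.+1 n X w}.
  by apply: filterS (IH _ ik') => w ->.
have LV : L (tau i.+1) (steps i.+1 n X).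
  apply: (star_ae (setting_star S) Ti1 LxX).
  by apply: filterS e => w -> _.
have h1 := step_value_L S Ti Ti1 (tau_le iK) LV (stepP iK (L_Lp S Ti1 LV)).
have h2 : {ae P, forall w, x (tau i) (tau i.+1) (x (tau i.+1) (tau k) X) w =
    x (tau i) (tau i.+1) (steps i.+1 n X) w}.
  have [_ x_ae] := star_operator (setting_star S) Ti Ti1 (tau_le iK).
  apply/aeTP; apply: x_ae => //; exact/aeTP.
have h3 := x_tc _ _ _ _ Ti Ti1 Tk (tau_le iK) le1 LX.
apply: filterS3 h1 h2 h3 => w /= -> <- a.
by rewrite a.
Qed.

(** Split off the first step by time consistency of [xbar]; its monotonicity inserts the induction
    hypothesis, and one-step maximality replaces the remaining operator. *)
Lemma steps_max xbar n i k X :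
  sandwich_extension P p F (grid K tau) L x m M xbar ->
  (i + n = k)%N -> (k <= K)%N -> Lpt k X ->
  {ae P, forall w, xbar (tau i) (tau k) X w <= steps i n X w}.
Proof.
move=> xP + kK LX; have Tk := grid_tau kK; elim: n i => [|n IH] i ik.
  rewrite addn0 in ik; rewrite ik.
  have := ext_projection xP Tk Tk (lexx _) LX LX.
  by apply: filterS => w /(_ Logic.I) ->.
have iK : (i < K)%N by apply: leq_trans kK; rewrite -ik -addSnnS leq_addr.
have ik' := etrans (addSnnS i n) ik.
have Ti := grid_tau (ltnW iK); have Ti1 := grid_tau iK.
have le1 : tau i.+1 <= tau k by apply: tau_monotone => //; rewrite -ik' leq_addr.
have LV := steps_Lp ik' kK LX.
have LxX := (ext_operator xP Ti1 Tk le1).1 _ LX.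
have xe : step_extension P F p L x m M (tau i) (tau i.+1) (xbar (tau i) (tau i.+1)).
  split.
  - exact: (ext_operator xP Ti Ti1 (tau_le iK)).
  - exact: (ext_convex xP Ti Ti1 (tau_le iK)).
  - exact: (ext_sandwich xP Ti Ti1 (tau_le iK)).
  - exact: (ext_projection xP Ti Ti1 (tau_le iK)).
  - by move=> Y LY; exact: (ext_extends xP Ti Ti1 (tau_le iK) LY).
have h1 := step_value_max S Ti Ti1 (tau_le iK) xe LV (stepP iK LV).
have h2 := ext_monotone xP Ti Ti1 (tau_le iK) LxX LV (IH _ ik').
have h3 := ext_time_consistent xP Ti Ti1 Tk (tau_le iK) le1 LX.
apply: filterS3 h1 h2 h3 => w /= a b -> //.
exact: le_trans b a.
Qed.

(** * Dual representation over several steps *)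

Section dual.
Variables i j : nat.
Hypotheses (ij : (i <= j)%N) (jK : (j <= K)%N).

Let Tk k : (k <= j)%N -> grid K tau (tau k).
Proof. by move=> kj; apply: grid_tau; exact: leq_trans jK. Qed.

Let sG k (kj : (k <= j)%N) := filtration_subsigma S (Tk kj).

Let le_tau k l : (k <= l)%N -> (l <= j)%N -> tau k <= tau l.
Proof. by move=> kl lj; apply: tau_monotone => //; exact: leq_trans jK. Qed.

Let F_le k l : (k <= l)%N -> (l <= j)%N -> F (tau k) `<=` F (tau l).
Proof.
by move=> kl lj; exact: (filtration_le S (Tk (leq_trans kl lj)) (Tk lj) (le_tau kl lj)).
Qed.

Section density.
Variable g : nat -> Omega -> R.
Hypothesis Dg : forall l, (i <= l < j)%N -> DSe P p F m M (tau l) (tau l.+1) (g l.+1).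

(** The density process: 1 at time [i], the full product at [j], and a martingale by [N_martingale].
    The factor of the step from [l] to [l.+1] carries the index [l.+1]. *)
Let N l w := \prod_(i <= k < l) g k.+1 w.
Let a l := min_penalty P F L x (tau l) (tau l.+1) (g l.+1).

Let NS l w : (i <= l)%N -> N l.+1 w = N l w * g l.+1 w.
Proof. by move=> il; rewrite /N big_nat_recr. Qed.

Let N_Lq l : (i <= l <= j)%N -> Lp_ge0 P q (F (tau l)) (N l).
Proof.
move=> /andP[]; elim: l => [|l IH].
  rewrite leqn0 => /eqP i0 _.
  rewrite (_ : N 0 = cst 1); last by apply/funext => w; rewrite /N i0 big_nil.
  exact: Lp_ge0_cst.
rewrite leq_eqVlt => /predU1P[<- _|il lj].
  rewrite (_ : N i = cst 1); last by apply/funext => w; rewrite /N big_geq.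
  exact: Lp_ge0_cst.
rewrite ltnS in il; have lj' := ltnW lj.
have [LN N0] := IH il lj'.
have Dgl : DSe P p F m M (tau l) (tau l.+1) (g l.+1) by apply: Dg; rewrite il lj.
have sl := sG lj'; have sl1 := sG lj.
have N0' : {ae P, forall w, 0 <= N l.+1 w}.
  by apply: filterS2 N0 (Dse_gt0 Dgl) => w b c; rewrite NS// mulr_ge0// ltW.
have gN : gmf (F (tau l.+1)) (N l.+1).
  rewrite (_ : N l.+1 = N l \* g l.+1); last by apply/funext => w /=; rewrite NS.
  apply: measurable_funM; last by have [[]] := Dgl.
  apply: (gfun_le S (Tk lj') (Tk lj)); [exact: le_tau|by case: LN].
split => //.
(* The product is nonnegative only almost surely, whereas [converse_holder] asks for it everywhere;
   hence the absolute values throughout. *)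
apply: (@Lp_ae_eq _ _ _ _ _ _ q1 sl1 (fun w => `|N l.+1 w|)); last first.
  by apply: filterS N0' => w b; rewrite ger0_norm.
apply: (converse_holder p1 sl1).
- exact: measurableT_comp.
- by move=> w; exact: normr_ge0.
move=> X [LX X0].
have gX := Dse_itgM S (Tk lj) Dgl LX.
have LMX : Lp_ge0 P p (F (tau l)) (M (tau l) (tau l.+1) X).
  by apply: (mM_operator_M (setting_mM S) (Tk lj') (Tk lj) (le_tau (leqnSn l) lj)).1.
have MXi := Lp_itg p1 sl LMX.1.
have NMX : itg P (fun w => N l w * M (tau l) (tau l.+1) X w).
  rewrite (_ : (fun w => _) = fun w => M (tau l) (tau l.+1) X w * N l w); last first.
    by apply/funext => w; rewrite mulrC.
  apply: (holder_itg p1) => //.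
  - exact: (Lp_measurable sl LMX.1).
  - exact: (Lp_measurable sl LN).
  - by case: LMX => [[]].
  - by case: LN.
have gMX A : F (tau l) A -> Eon P A (fun w => `|g l.+1 w * X w|) <=
    Eon P A (fun w => `|M (tau l) (tau l.+1) X w|).
  move=> FA; have mA := gsetM sl FA.
  apply: (@le_trans _ _ (Eon P A (fun w => g l.+1 w * X w))).
    apply: Eon_ae_le => //; first exact: itg_norm.
    by apply: filterS2 X0 (Dse_gt0 Dgl) => w b c; rewrite ger0_norm// mulr_ge0// ltW.
  rewrite -(rceE sl gX FA); apply: Eon_ae_le => //; [exact: (rce_itg sl)|exact: itg_norm|].
  have := Dse_M S (Tk lj') (Tk lj) Dgl (conj LX X0).
  by apply: filterS => w b; apply: (le_trans b); exact: ler_norm.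
have gaN : gmf (F (tau l)) (fun w => `|N l w|) by apply: measurableT_comp => //; case: LN.
have NMXa : itg P (fun w => `|N l w| * `|M (tau l) (tau l.+1) X w|).
  rewrite (_ : (fun w => _) = fun w => `|N l w * M (tau l) (tau l.+1) X w|).
    exact: itg_norm.
  by apply/funext => w; rewrite normrM.
have [h _] := ge0_weighted_le_Eon sl (itg_norm gX) (itg_norm MXi) (fun w => normr_ge0 _)
  (fun w => normr_ge0 _) gMX gaN (fun w => normr_ge0 _) NMXa.
apply: (itg_ae_eq _ _ h).
  apply: measurable_funM; last exact: (Lp_measurable sl1 LX).
  by apply: measurableT_comp => //; exact: (gfun_measurable sl1).
by apply: filterS X0 => w b; rewrite NS// !normrM (ger0_norm b) mulrA.
Qed.

Let NX_itg l X : (i <= l <= j)%N -> Lpt l X -> itg P (fun w => N l w * X w).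
Proof.
move=> /[dup] ilj /andP[il lj] LX; have [LN _] := N_Lq ilj; have sl := sG lj.
rewrite (_ : (fun w => _) = fun w => X w * N l w); last first.
  by apply/funext => w; rewrite mulrC.
apply: (holder_itg p1).
- exact: (Lp_measurable sl LX).
- exact: (Lp_measurable sl LN).
- by case: LX.
- by case: LN.
Qed.

Let N_pull l X : (i <= l < j)%N -> Lpt l.+1 X ->
  itg P (fun w => N l w * rce P (F (tau l)) (fun w => g l.+1 w * X w) w) /\
  forall A, F (tau l) A -> Eon P A (fun w => N l.+1 w * X w) =
    Eon P A (fun w => N l w * rce P (F (tau l)) (fun w => g l.+1 w * X w) w).
Proof.
move=> /[dup] ilj /andP[il lj] LX.
have ilj' : (i <= l <= j)%N by rewrite il ltnW.
have ilj1 : (i <= l.+1 <= j)%N by rewrite (leqW il).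
have [LN N0] := N_Lq ilj'; have sl := sG (ltnW lj).
have gX := Dse_itgM S (Tk lj) (Dg ilj) LX.
have e : (fun w => N l.+1 w * X w) = fun w => N l w * (g l.+1 w * X w).
  by apply/funext => w; rewrite NS// mulrA.
have NgX := NX_itg ilj1 LX; rewrite e in NgX.
have [h1 h2] := rce_pull_out_ae sl gX LN.1 N0 NgX.
by split => // A FA; rewrite h2// e.
Qed.

Let N_itg l : (i <= l <= j)%N -> itg P (N l).
Proof.
move=> /[dup] ilj /andP[_ lj]; have [LN _] := N_Lq ilj.
exact: (Lp_itg q1 (sG lj) LN).
Qed.

Let N_martingale l k A : (i <= l)%N -> (l <= k)%N -> (k <= j)%N -> F (tau l) A ->
  Eon P A (N k) = Eon P A (N l).
Proof.
move=> il; elim: k => [|k IH]; first by rewrite leqn0 => /eqP ->.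
rewrite leq_eqVlt => /predU1P[->//|lk kj FA].
rewrite ltnS in lk; rewrite -(IH lk (ltnW kj) FA).
have ikj : (i <= k < j)%N by rewrite (leq_trans il lk).
have FkA : F (tau k) A by exact: (F_le lk (ltnW kj)).
have L1 : Lpt k.+1 (cst 1) by exact: Lp_cst.
have [h1 h2] := N_pull ikj L1.
have := h2 _ FkA.
rewrite (_ : (fun w => N k.+1 w * cst 1 w) = N k.+1); last by apply/funext => w /=; rewrite mulr1.
move=> ->; have sk := sG (ltnW kj).
have ikj' : (i <= k <= j)%N by rewrite (leq_trans il lk) ltnW.
apply: Eon_ae_eq; [exact: (gsetM sk)|exact: (itg_measurable h1)|exact: (itg_measurable (N_itg ikj'))|].
have := Dse_ce_known S (Tk (ltnW kj)) (Tk kj) (le_tau (leqnSn k) kj) (Dg ikj) (Lp_cst P (F (tau k)) p1 1).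
by apply: filterS => w ->; rewrite mulr1.
Qed.

Let ga l : (i <= l < j)%N -> gmf (F (tau l)) (a l).
Proof.
move=> /[dup] ilj /andP[_ lj].
apply: (penalty_gmf S (Tk (ltnW lj)) (Tk lj)); first exact: le_tau.
by move=> X LX; exact: (Dse_itgM S (Tk lj) (Dg ilj)).
Qed.

Let a0 l : (i <= l < j)%N -> {ae P, forall w, 0 <= a l w}%E.
Proof.
move=> /[dup] ilj /andP[_ lj].
apply: (penalty_ge0 S (Tk (ltnW lj)) (Tk lj)); first exact: le_tau.
by move=> X LX; exact: (Dse_itgM S (Tk lj) (Dg ilj)).
Qed.

Variable X : Omega -> R.
Hypothesis LX : Lpt j X.
Let V l := steps l (j - l) X.

Let V_Lp l : (l <= j)%N -> Lpt l (V l).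
Proof. by move=> lj; apply: (steps_Lp _ jK LX); rewrite subnKC. Qed.

Let VP l : (l < j)%N ->
  step_value P F p L x m M (tau l) (tau l.+1) (V l.+1) (V l).
Proof.
move=> lj.
have -> : V l = step (tau l) (tau l.+1) (V l.+1).
  rewrite /V -(subnSK lj); reflexivity.
exact: (stepP (leq_trans lj jK) (V_Lp lj)).
Qed.

(** The one-step dual expression at [g l.+1]. It is the drift of the value process under the new
    density: at most the penalty [a l], with equality for a maximizer. *)
Let c l w := rce P (F (tau l)) (fun w => g l.+1 w * V l.+1 w) w - V l w.

Let Nc_itg l : (i <= l < j)%N -> itg P (fun w => N l w * c l w).
Proof.
move=> /[dup] ilj /andP[il lj]; have [h _] := N_pull ilj (V_Lp lj).
have ilj' : (i <= l <= j)%N by rewrite il ltnW.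
have := itgB h (NX_itg ilj' (V_Lp (ltnW lj))).
by congr itg; apply/funext => w; rewrite -mulrBr.
Qed.

Let N_step l A : (i <= l < j)%N -> F (tau l) A ->
  Eon P A (fun w => N l.+1 w * V l.+1 w) =
  Eon P A (fun w => N l w * V l w) + Eon P A (fun w => N l w * c l w).
Proof.
move=> /[dup] ilj /andP[il lj] FA; have [h1 h2] := N_pull ilj (V_Lp lj).
have mA := gsetM (sG (ltnW lj)) FA.
have ilj' : (i <= l <= j)%N by rewrite il ltnW.
rewrite h2// -EonD//; [|exact: NX_itg (V_Lp (ltnW lj))|exact: Nc_itg].
by congr Eon; apply/funext => w; rewrite -mulrDr /c addrC subrK.
Qed.

Let mNa l : (i <= l < j)%N -> measurable_fun setT (fun w => (N l w)%:E * a l w)%E.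
Proof.
move=> /[dup] ilj /andP[il lj].
have ilj' : (i <= l <= j)%N by rewrite il ltnW.
apply: emeasurable_funM; last exact: (gfun_measurable (sG (ltnW lj)) (ga ilj)).
by apply/measurable_EFinP; exact: (itg_measurable (N_itg ilj')).
Qed.

Let Na0 l : (i <= l < j)%N -> {ae P, forall w, 0 <= (N l w)%:E * a l w}%E.
Proof.
move=> /[dup] ilj /andP[il lj].
have ilj' : (i <= l <= j)%N by rewrite il ltnW.
by apply: filterS2 (N_Lq ilj').2 (a0 ilj) => w b e; rewrite mule_ge0.
Qed.

Let N_step_le l A : (i <= l < j)%N -> F (tau l) A ->
  ((Eon P A (fun w => N l w * c l w))%:E <= \int[P]_(w in A) ((N l w)%:E * a l w))%E.
Proof.
move=> /[dup] ilj /andP[il lj] FA; have mA := gsetM (sG (ltnW lj)) FA.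
have ilj' : (i <= l <= j)%N by rewrite il ltnW.
apply: Eon_le_integral => //; [exact: Nc_itg|exact: mNa|exact: Na0|].
have [_ _ ub] := VP lj.
apply: filterS2 (ub _ (Dg ilj)) (N_Lq ilj').2 => w b N0.
by rewrite EFinM; apply: lee_wpmul2l.
Qed.

Let N_step_eq l A : (i <= l < j)%N -> F (tau l) A ->
  {ae P, forall w, a l w = (c l w)%:E} ->
  ((Eon P A (fun w => N l w * c l w))%:E = \int[P]_(w in A) ((N l w)%:E * a l w))%E.
Proof.
move=> /[dup] ilj /andP[il lj] FA e; have mA := gsetM (sG (ltnW lj)) FA.
have h := Nc_itg ilj; rewrite EonE//; apply: ae_eq_integral => //.
- by apply: measurable_funTS; apply/measurable_EFinP; exact: (itg_measurable h).
- by apply: measurable_funTS; exact: mNa.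
- by apply: filterS e => w -> _; rewrite EFinM.
Qed.

Let V_i A : Eon P A (fun w => N i w * V i w) = Eon P A (V i).
Proof. by congr Eon; apply/funext => w; rewrite /N big_geq// mul1r. Qed.

Let V_j A : Eon P A (fun w => N j w * V j w) = Eon P A (fun w => N j w * X w).
Proof. by rewrite /V subnn. Qed.

Let total A := (\sum_(i <= l < j) \int[P]_(w in A) ((N l w)%:E * a l w))%E.

Let telescope A : F (tau i) A ->
  Eon P A (fun w => N j w * X w) =
  Eon P A (V i) + \sum_(i <= l < j) Eon P A (fun w => N l w * c l w).
Proof.
move=> FA; rewrite -V_j -(V_i A).
have : forall n, (i + n <= j)%N -> Eon P A (fun w => N (i + n) w * V (i + n) w) =
    Eon P A (fun w => N i w * V i w) +
    \sum_(i <= l < i + n) Eon P A (fun w => N l w * c l w).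
  elim=> [|n IH]; first by rewrite addn0 big_geq// addr0.
  rewrite addnS => inj; have iln : (i <= i + n < j)%N by rewrite leq_addr.
  rewrite N_step//; last exact: (F_le (leq_addr n i) (ltnW inj)).
  by rewrite IH 1?ltnW// big_nat_recr ?leq_addr//= addrA.
by move=> /(_ (j - i)%N); rewrite subnKC// => ->.
Qed.

Let dual_le A : F (tau i) A ->
  ((Eon P A (fun w => N j w * X w) - Eon P A (V i))%:E <= total A)%E.
Proof.
move=> FA; rewrite telescope// addrAC subrr add0r -sumEFin.
rewrite /total big_seq [leRHS]big_seq; apply: lee_sum => l.
rewrite mem_index_iota => ilj; apply: N_step_le => //.
by have /andP[il lj] := ilj; exact: (F_le il (ltnW lj)).
Qed.

Let dual_eq A : F (tau i) A ->
  (forall l, (i <= l < j)%N -> {ae P, forall w, a l w = (c l w)%:E}) ->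
  ((Eon P A (fun w => N j w * X w) - Eon P A (V i))%:E = total A)%E.
Proof.
move=> FA e; rewrite telescope// addrAC subrr add0r -sumEFin.
rewrite /total big_seq [RHS]big_seq; apply: eq_bigr => l.
rewrite mem_index_iota => ilj; apply: N_step_eq => //; last exact: e.
by have /andP[il lj] := ilj; exact: (F_le il (ltnW lj)).
Qed.

Lemma density_Lq : Lp_ge0 P q (F (tau j)) (N j).
Proof. by apply: N_Lq; rewrite ij leqnn. Qed.

(** On events of [F (tau i)] the outer conditional expectation disappears, and the martingale
    property replaces the weight [f] by [N l] in front of the penalty known at time l. This is where
    the weight in the definition of [penalty] matches the telescoping sum. *)
Let penaltyP f : Lp_ge0 P q (F (tau j)) f -> {ae P, forall w, f w = N j w} ->
  [/\ gmf (F (tau i)) (penalty P F L x tau i j f g),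
      {ae P, forall w, 0 <= penalty P F L x tau i j f g w}%E &
      forall A, F (tau i) A ->
        (\int[P]_(w in A) penalty P F L x tau i j f g w)%E = total A].
Proof.
move=> [Lf f0] fN; have si := sG ij.
have fi := Lp_itg q1 (sG (leqnn j)) Lf.
pose Y l w := ((f w)%:E * a l w)%E.
have CP l : (i <= l < j)%N ->
    [/\ gmf (F (tau i)) (cond_exp P (F (tau i)) (Y l)),
    {ae P, forall w, 0 <= cond_exp P (F (tau i)) (Y l) w}%E &
    forall A, F (tau i) A -> (\int[P]_(w in A) cond_exp P (F (tau i)) (Y l) w =
      \int[P]_(w in A) ((N l w)%:E * a l w))%E].
  move=> /[dup] ilj /andP[il lj]; have ma := gfun_measurable (sG (ltnW lj)) (ga ilj).
  have ilj' : (i <= l <= j)%N by rewrite il ltnW.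
  have iljj : (i <= j <= j)%N by rewrite ij leqnn.
  have mY : measurable_fun setT (Y l).
    by apply: emeasurable_funM => //; apply/measurable_EFinP; exact: (itg_measurable fi).
  have Y0 : {ae P, forall w, 0 <= Y l w}%E.
    by apply: filterS2 f0 (a0 ilj) => w b e; rewrite mule_ge0.
  have [h1 h2 h3] := ge0_cond_expP si mY Y0; split => // A FA.
  rewrite h3// /Y; have FlA : F (tau l) A by exact: (F_le il (ltnW lj)).
  apply: (weighted_integral_eq (sG (ltnW lj)) fi (N_itg ilj') f0 (N_Lq ilj').2 _ (ga ilj) (a0 ilj) FlA).
  move=> B FB; rewrite -(N_martingale il (ltnW lj) (leqnn j) FB).
  apply: Eon_ae_eq => //; first exact: (gsetM (sG (ltnW lj))).
  - exact: (itg_measurable fi).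
  - exact: (itg_measurable (N_itg iljj)).
have mem l : l \in index_iota i j -> (i <= l < j)%N by rewrite mem_index_iota.
have penE : penalty P F L x tau i j f g = fun w =>
    (\sum_(l <- index_iota i j) cond_exp P (F (tau i)) (Y l) w)%E by [].
rewrite penE; split.
- suff gS r : {subset r <= index_iota i j} ->
      gmf (F (tau i)) (fun w => \sum_(l <- r) cond_exp P (F (tau i)) (Y l) w)%E.
    by apply: gS.
  elim: r => [_|l r IH rs].
    rewrite (_ : (fun w => _) = cst 0%E); last by apply/funext => w; rewrite big_nil.
    exact: measurable_cst.
  rewrite (_ : (fun w => _) = (fun w => cond_exp P (F (tau i)) (Y l) w +
      \sum_(l <- r) cond_exp P (F (tau i)) (Y l) w)%E); last first.
    by apply/funext => w; rewrite big_cons.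
  apply: emeasurable_funD.
    by have [] := CP l (mem _ (rs _ (mem_head _ _))).
  by apply: IH => k kr; apply: rs; rewrite in_cons kr orbT.
- suff S0 r : {subset r <= index_iota i j} ->
      {ae P, forall w, 0 <= \sum_(l <- r) cond_exp P (F (tau i)) (Y l) w}%E.
    by apply: S0.
  elim: r => [_|l r IH rs]; first by apply: aeW => w; rewrite big_nil.
  have [_ C0 _] := CP l (mem _ (rs _ (mem_head _ _))).
  have S0 : {ae P, forall w, 0 <= \sum_(l <- r) cond_exp P (F (tau i)) (Y l) w}%E.
    by apply: IH => k kr; apply: rs; rewrite in_cons kr orbT.
  by apply: filterS2 C0 S0 => w b e; rewrite big_cons adde_ge0.
- move=> A FA; rewrite ae_ge0_integral_sum.
  + rewrite /total big_seq [RHS]big_seq; apply: eq_bigr => l /mem ilj.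
    by have [_ _ h] := CP l ilj; exact: h.
  + exact: (gsetM si).
  + by move=> l /mem ilj; have [h _ _] := CP l ilj; exact: (gfun_measurable si).
  + by move=> l /mem ilj; have [_ h _] := CP l ilj.
Qed.

Let fX_eq f A : Lp_ge0 P q (F (tau j)) f -> {ae P, forall w, f w = N j w} ->
  F (tau i) A -> itg P (fun w => f w * X w) /\
  Eon P A (fun w => f w * X w) = Eon P A (fun w => N j w * X w).
Proof.
move=> [Lf f0] fN FA; have sj := sG (leqnn j).
have iljj : (i <= j <= j)%N by rewrite ij leqnn.
have NX := NX_itg iljj LX.
have mf := Lp_measurable sj Lf; have mX := Lp_measurable sj LX.
have e : {ae P, forall w, N j w * X w = f w * X w} by apply: filterS fN => w ->.
have fX : itg P (fun w => f w * X w).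
  by apply: (itg_ae_eq _ e NX); exact: measurable_funM.
split => //; apply: Eon_ae_eq.
- exact: (gsetM (sG ij)).
- exact: (itg_measurable fX).
- exact: (itg_measurable NX).
- by apply: filterS e => w ->.
Qed.

(** The inequality is obtained for integrals over events of [F (tau i)] and then localized. Where
    the penalty is infinite the left side is -oo. *)
Lemma dual_upper_bound f : Lp_ge0 P q (F (tau j)) f -> {ae P, forall w, f w = N j w} ->
  {ae P, forall w, (cond_exp P (F (tau i)) (EFin \o (f \* X)%R) w -
     penalty P F L x tau i j f g w <= (V i w)%:E)%E}.
Proof.
move=> Lf fN; have si := sG ij.
have [gp p0 pE] := penaltyP Lf fN.
have [fX _] := fX_eq Lf fN (gsetT si).
have LV := V_Lp ij; have Vi := Lp_itg p1 si LV.
have [gr ri rE ce] := rceP si fX.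
have h : {ae P, forall w, (rce P (F (tau i)) (fun w => f w * X w) w - V i w)%:E <=
    penalty P F L x tau i j f g w}%E.
  apply: (ae_le_Eon_integral si) => //.
  - by apply: measurable_funB => //; case: LV.
  - exact: itgB.
  - move=> A FA; have mA := gsetM si FA; rewrite pE// EonB// rE//.
    by have [_ ->] := fX_eq Lf fN FA; exact: dual_le.
apply: filterS3 ce h p0 => w c1 c2 c3.
rewrite (_ : cond_exp _ _ _ w = (rce P (F (tau i)) (fun w => f w * X w) w)%:E)//.
move: c2 c3; case: (penalty _ _ _ _ _ _ _ _ _ _) => [r|_ _|//].
  by rewrite -EFinB !lee_fin => c2 _; lra.
exact: leNye.
Qed.

Lemma dual_maximizer :
  (forall l, (i <= l < j)%N -> {ae P, forall w, a l w = (c l w)%:E}) ->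
  {ae P, forall w, (cond_exp P (F (tau i)) (EFin \o (N j \* X)%R) w -
     penalty P F L x tau i j (N j) g w = (V i w)%:E)%E}.
Proof.
move=> opt; have si := sG ij.
have iljj : (i <= j <= j)%N by rewrite ij leqnn.
have Lf := N_Lq iljj; have fN : {ae P, forall w, N j w = N j w} by exact: aeW.
have [gp p0 pE] := penaltyP Lf fN.
have [fX _] := fX_eq Lf fN (gsetT si).
have LV := V_Lp ij; have Vi := Lp_itg p1 si LV.
have [gr ri rE ce] := rceP si fX.
have h : {ae P, forall w, (rce P (F (tau i)) (fun w => N j w * X w) w - V i w)%:E =
    penalty P F L x tau i j (N j) g w}%E.
  apply: (ae_eq_Eon_integral si) => //.
  - by apply: measurable_funB => //; case: LV.
  - exact: itgB.
  - by move=> A FA; have mA := gsetM si FA; rewrite pE// EonB// rE// dual_eq.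
apply: filterS2 ce h => w c1 c2.
rewrite (_ : cond_exp _ _ _ w = (rce P (F (tau i)) (fun w => N j w * X w) w)%:E)//.
by rewrite -c2 -EFinB; congr EFin; rewrite opprB addrC subrK.
Qed.

Lemma dual_total A : F (tau i) A ->
  ((Eon P A (fun w => N j w * X w) - Eon P A (V i))%:E <= total A)%E.
Proof. exact: dual_le. Qed.

Lemma dual_total_eq A : F (tau i) A ->
  (forall l, (i <= l < j)%N -> {ae P, forall w, a l w = (c l w)%:E}) ->
  ((Eon P A (fun w => N j w * X w) - Eon P A (V i))%:E = total A)%E.
Proof. exact: dual_eq. Qed.

End density.

Let optimal_factors X : Lpt j X -> exists g : nat -> Omega -> R,
  (forall l, (i <= l < j)%N -> DSe P p F m M (tau l) (tau l.+1) (g l.+1)) /\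
  (forall l, (i <= l < j)%N -> {ae P, forall w,
    min_penalty P F L x (tau l) (tau l.+1) (g l.+1) w =
    (rce P (F (tau l)) (fun w => g l.+1 w * steps l.+1 (j - l.+1) X w) w
     - steps l (j - l) X w)%:E}).
Proof.
move=> LX.
have /choice[h hP] : forall l, exists f, (i <= l < j)%N ->
    DSe P p F m M (tau l) (tau l.+1) f /\ {ae P, forall w,
    min_penalty P F L x (tau l) (tau l.+1) f w =
    (rce P (F (tau l)) (fun w => f w * steps l.+1 (j - l.+1) X w) w
     - steps l (j - l) X w)%:E}.
  move=> l; have [ilj|] := boolP (i <= l < j)%N; last by exists (cst 0).
  have /andP[_ lj] := ilj.
  have LV : Lpt l.+1 (steps l.+1 (j - l.+1) X).
    by apply: (steps_Lp _ jK LX); rewrite subnKC.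
  have [_ [f Df af] _] := stepP (leq_trans lj jK) LV.
  exists f => _; split => //; rewrite -(subnSK lj); exact: af.
(* Factors are indexed by the end of their step, the chosen maximizers by its beginning. *)
by exists (fun l => h l.-1); split => l ilj; have [] := hP l ilj.
Qed.

(** The composition bounds every member of the family, and it is the least such bound because the
    product of optimal factors attains it. *)
Lemma xhat_idx_steps X : Lpt j X ->
  {ae P, forall w, xhat_idx P p F L x m M tau i j X w = (steps i (j - i) X w)%:E}.
Proof.
move=> LX; have sj := filtration_subsigma S (grid_tau jK).
have LV : Lpt i (steps i (j - i) X) by apply: (steps_Lp _ jK LX); rewrite subnKC.
have si := filtration_subsigma S (grid_tau (leq_trans ij jK)).
have [g [Dg opt]] := optimal_factors LX.
set D := [set Y | exists f g, [/\ Q P p F m M tau i j f, factorization P p F m M tau i j f g &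
    Y = (fun w => cond_exp P (F (tau i)) (EFin \o (f \* X)%R) w
                  - penalty P F L x tau i j f g w)%E]].
have VP : is_ess_sup_family P D (EFin \o steps i (j - i) X).
  split.
  - by apply/measurable_EFinP; exact: (Lp_measurable si LV).
  - move=> _ [f [h [[Lf _] [Dh fh] ->]]].
    apply: (dual_upper_bound Dh LX Lf).
    by apply/aeTP.
  - move=> Z' mZ' hZ'.
    have LN := density_Lq Dg.
    have mx := dual_maximizer Dg LX opt.
    have fac : factorization P p F m M tau i j (fun w => \prod_(i <= k < j) g k.+1 w) g.
      by split => //; apply/aeTP; exact: aeW.
    have := hZ' _ (ex_intro _ _ (ex_intro _ g (And3 (conj LN (ex_intro _ g fac)) fac erefl))).
    by move: mx; apply: filterS2 => w; rewrite [(EFin \o _) w]/= => ->.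
apply: (is_ess_sup_family_unique _ VP).
exact: (xgetPex (cst -oo%E) (ex_intro _ _ VP)).
Qed.

(** The optimal product for [X] is also admissible for [Y], with the same total penalty, which
    cancels in the difference. This supplies the continuous affine minorants behind lower
    semicontinuity. *)
Lemma steps_subgradient X : Lpt j X -> exists2 f, Lp_ge0 P q (F (tau j)) f &
  forall Y A, Lpt j Y -> F (tau i) A ->
    Eon P A (fun w => f w * Y w) - Eon P A (fun w => f w * X w) <=
    Eon P A (steps i (j - i) Y) - Eon P A (steps i (j - i) X).
Proof.
move=> LX; have [g [Dg opt]] := optimal_factors LX.
exists (fun w => \prod_(i <= k < j) g k.+1 w).
  exact: (density_Lq Dg).
move=> Y A LY FA.
have h1 := dual_total Dg LY FA.
have h2 := dual_total_eq Dg LX FA opt.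
by rewrite -h2 lee_fin in h1; lra.
Qed.

End dual.

(** Suppose E[1_A V(X)] exceeds E[1_A Z] by 2e for some A known at time i. Choose (X', Z') in the
    epigraph, with X' close to X for the functional 1_A f and Z' close to Z for 1_A, both within e.
    The subgradient inequality gives E[1_A Z'] >= E[1_A V(X')] > E[1_A V(X)] - e = E[1_A Z] + e, a
    contradiction. *)
Lemma steps_lower_semicontinuous i j : (i <= j)%N -> (j <= K)%N ->
  op_lower_semicontinuous P p (F (tau j)) (F (tau i)) (steps i (j - i)).
Proof.
move=> ij jK X Z LX LZ H; set V := steps i (j - i).
have Ti := grid_tau (leq_trans ij jK); have Tj := grid_tau jK.
have si := filtration_subsigma S Ti; have sj := filtration_subsigma S Tj.
have ijT : tau i <= tau j by exact: tau_monotone.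
have LVY Y : Lpt j Y -> Lpt i (V Y).
  by move=> LY; apply: (steps_Lp _ jK LY); rewrite subnKC.
have Zi := Lp_itg p1 si LZ; have Vi := Lp_itg p1 si (LVY _ LX).
have [f [Lf f0] sub] := steps_subgradient ij jK LX.
apply: (ae_le_Eon si) => //; [by have [] := LVY _ LX|by case: LZ|].
move=> A FA; have mA := gsetM si FA.
have FjA : F (tau j) A by exact: (filtration_le S Ti Tj).
rewrite leNgt; apply/negP => lt.
pose e := (Eon P A (V X) - Eon P A Z) / 2.
have e0 : 0 < e by rewrite divr_gt0// subr_gt0.
have LAf : Lp P q (F (tau j)) (\1_A \* f) := Lp_indicM q1 sj FjA Lf.
have LA : Lp P q (F (tau i)) \1_A := Lp_indic q1 si FA.
have [X' [Z' [[LX' UX'] [LZ' UZ'] le']]] :=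
  H _ _ (Lp_nbhs_Eon p1 sj LAf LX e0) (Lp_nbhs_Eon p1 si LA LZ e0).
have fY Y : Lpt j Y -> itg P (fun w => f w * Y w).
  move=> LY; rewrite (_ : (fun w => _) = fun w => Y w * f w); last first.
    by apply/funext => w; rewrite mulrC.
  apply: (holder_itg p1); [exact: (Lp_measurable sj LY)|exact: (Lp_measurable sj Lf)|by case: LY|by case: Lf].
have {}UX' : `|Eon P A (fun w => f w * X' w) - Eon P A (fun w => f w * X w)| < e.
  have := UX' LX'; rewrite -EonB//; [|exact: fY|exact: fY].
  rewrite -(EonT_indic P A).
  congr (`|Eon P _ _| < _); apply/funext => w /=; ring.
have {}UZ' : `|Eon P A Z' - Eon P A Z| < e.
  have := UZ' LZ'; rewrite -EonB//; last exact: (Lp_itg p1 si).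
  by rewrite -(EonT_indic P A).
have h1 := sub _ _ LX' FA.
have h2 : Eon P A (V X') <= Eon P A Z'.
  by apply: Eon_ae_le => //; [exact: (Lp_itg p1 si (LVY _ LX'))|exact: (Lp_itg p1 si)].
rewrite ltr_norml in UX'; rewrite ltr_norml in UZ'.
have /andP[u1 u2] := UX'; have /andP[u3 u4] := UZ'.
have e2 : 2 * e = Eon P A (V X) - Eon P A Z by rewrite /e mulrC divfK.
move: h1 h2 u1 u4 e2; rewrite -/V.
move: (Eon P A (V X')) (Eon P A (V X)) (Eon P A Z) (Eon P A Z').
move: (Eon P A (fun w => f w * X' w)) (Eon P A (fun w => f w * X w)) => a b c1 c2 c3 c4.
by lra.
Qed.

(** [grid_index] returns the first index carrying the time, which for repeated grid points may be
    smaller than [i]. *)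
Lemma grid_index_le i : (i <= K)%N ->
  (grid_index K tau (tau i) <= i)%N /\ tau (grid_index K tau (tau i)) = tau i.
Proof.
move=> iK; rewrite /grid_index; set a := fun k => tau k == tau i.
have ha : has a (iota 0 K.+1).
  by apply/hasP; exists i; [rewrite mem_iota add0n ltnS|exact: eqxx].
have := nth_find 0%N ha; rewrite nth_iota ?add0n; last first.
  by move: ha; rewrite has_find size_iota.
move=> /eqP e; split => //; rewrite leqNgt; apply/negP => /(before_find 0%N).
by rewrite nth_iota ?ltnS// add0n /a eqxx.
Qed.

(** Steps between indices denoting the same time act as the identity almost surely, by
    [steps_projection], so passing to first indices changes nothing. *)
Lemma xhat_steps i j X : (i <= j)%N -> (j <= K)%N -> Lpt j X ->
  {ae P, forall w, xh (tau i) (tau j) X w = steps i (j - i) X w}.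
Proof.
move=> ij jK LX; have iK := leq_trans ij jK.
rewrite /xhat; case: ifPn => [/eqP e|ne].
  have LX' : Lpt i X by rewrite e.
  have := steps_projection (subnKC ij) jK LX'.
  by apply: filterS => w ->.
have [gi gie] := grid_index_le iK; have [gj gje] := grid_index_le jK.
set gI := grid_index K tau (tau i) in gi gie *.
set gJ := grid_index K tau (tau j) in gj gje *.
have igj : (i <= gJ)%N.
  rewrite leqNgt; apply/negP => gji; move/negP: ne; apply.
  rewrite eq_le (tau_monotone ij jK)/= -gje.
  exact: (tau_monotone (ltnW gji) iK).
have LXg : Lpt gJ X by rewrite gje.
have gIJ := leq_trans gi igj; have gJK := leq_trans gj jK.
have h1 := xhat_idx_steps gIJ gJK LXg.
have LVg : Lpt i (steps i (j - i) X).
  by apply: (steps_Lp _ jK LX); rewrite subnKC.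
have LVgI : Lpt gI (steps i (j - i) X) by rewrite gie.
have h2 : {ae P, forall w, steps gI (i - gI) (steps i (j - i) X) w = steps i (j - i) X w}.
  exact: (steps_projection (subnKC gi) iK LVgI).
have h3 : {ae P, forall w, steps gJ (j - gJ) X w = X w}.
  exact: (steps_projection (subnKC gj) jK LXg).
have LW : Lpt gJ (steps gJ (j - gJ) X).
  by apply: (steps_Lp _ jK LX); rewrite subnKC.
have h4 := steps_ae (subnKC gIJ) gJK LW h3.
(* The composition from [j] down to the first index [gI] is split in two ways, at [i] and at [gJ];
   in each splitting one piece is trivial. *)
have e1 : steps gI (j - gI) X = steps gI (i - gI) (steps i (j - i) X).
  have := steps_cat P F p L x m M tau gI (i - gI) (j - i) X.
  by rewrite subnKC// addnC addnBA// subnK.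
have e2 : steps gI (j - gI) X = steps gI (gJ - gI) (steps gJ (j - gJ) X).
  have := steps_cat P F p L x m M tau gI (gJ - gI) (j - gJ) X.
  by rewrite subnKC// addnC addnBA// subnK.
rewrite -e2 e1 in h4.
apply: filterS3 h1 h2 h4 => w a b c.
by rewrite /= a /= -c b.
Qed.

(** When the indices come in the wrong order, monotonicity of the grid forces the two times to
    coincide, and one index serves for both. *)
Lemma grid_le s t : grid K tau s -> grid K tau t -> s <= t ->
  exists i j, [/\ (i <= j)%N, (j <= K)%N, s = tau i & t = tau j].
Proof.
move=> [i iK ->] [j jK ->] st; have [ij|ji] := leqP i j; first by exists i, j.
exists j, j; split => //; apply/eqP; rewrite eq_le st.
exact: (tau_monotone (ltnW ji) iK).
Qed.

Lemma grid_le3 s t u : grid K tau s -> grid K tau t -> grid K tau u -> s <= t -> t <= u ->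
  exists i j k, [/\ (i <= j)%N, (j <= k)%N, (k <= K)%N & [/\ s = tau i, t = tau j & u = tau k]].
Proof.
move=> Ts Tt [k kK ->] st tu; have [i [j [ij jK es et]]] := grid_le Ts Tt st.
have [jk|kj] := leqP j k; first by exists i, j, k.
exists i, j, j; split => //; split => //; apply/eqP; rewrite -et eq_le tu andbT.
by rewrite et; exact: (tau_monotone (ltnW kj) jK).
Qed.

Lemma xhat_sandwich_extension : time_consistent P (grid K tau) L x ->
  sandwich_extension P p F (grid K tau) L x m M xh.
Proof.
move=> x_tc.
have xh_Lp i j X : (i <= j)%N -> (j <= K)%N -> Lpt j X -> Lpt i (xh (tau i) (tau j) X).
  move=> ij jK LX; have si := filtration_subsigma S (grid_tau (leq_trans ij jK)).
  apply: (@Lp_ae_eq _ _ _ _ _ _ p1 si (steps i (j - i) X)).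
    by apply: (steps_Lp _ jK LX); rewrite subnKC.
  by apply: filterS (xhat_steps ij jK LX) => w ->.
split.
- move=> s t Ts Tt /(grid_le Ts Tt)[i [j [ij jK -> ->]]]; split => [X LX|X Y LX LY /aeTP XY].
    exact: xh_Lp.
  apply/aeTP; have h := steps_ae (subnKC ij) jK LX XY.
  by apply: filterS3 h (xhat_steps ij jK LX) (xhat_steps ij jK LY) => w a -> ->.
- move=> s t X Ts Tt /(grid_le Ts Tt)[i [j [ij jK -> ->]]] LX; apply/aeTP.
  have LpX := L_Lp S (grid_tau jK) LX.
  have h := steps_extends x_tc (subnKC ij) jK LX.
  by apply: filterS2 h (xhat_steps ij jK LpX) => w a ->.
- move=> s t Ts Tt /(grid_le Ts Tt)[i [j [ij jK -> ->]]] X Y a LX LY a01.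
  have sj := filtration_subsigma S (grid_tau jK).
  have LXY : Lpt j (a *: X + (1 - a) *: Y).
    by apply: (Lp_linear p1 sj) => //; exact: (LpZ p1 sj).
  have h := steps_convex (subnKC ij) jK LX LY a01.
  apply: filterS3 h (xhat_steps ij jK LXY)
    (filterI (xhat_steps ij jK LX) (xhat_steps ij jK LY)) => w b -> [-> ->].
  exact: b.
- move=> s t Ts Tt /(grid_le Ts Tt)[i [j [ij jK -> ->]]] X Y LX LY XY.
  have h := steps_monotone (subnKC ij) jK LX LY XY.
  by apply: filterS3 h (xhat_steps ij jK LX) (xhat_steps ij jK LY) => w a -> ->.
- move=> s t Ts Tt /(grid_le Ts Tt)[i [j [ij jK -> ->]]] X Z LX LZ H.
  have h : {ae P, forall w, steps i (j - i) X w <= Z w}.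
    apply: (steps_lower_semicontinuous ij jK LX LZ) => U V nU nV.
    have [X' [Z' [[LX' UX'] LZ' le']]] := H U V nU nV.
    exists X', Z'; split => //.
    by apply: filterS2 le' (xhat_steps ij jK LX') => w + <-.
  by apply: filterS2 h (xhat_steps ij jK LX) => w a ->.
- move=> s t Ts Tt /(grid_le Ts Tt)[i [j [ij jK -> ->]]] A X FA LX LAX; apply/aeTP.
  have h := steps_hom (subnKC ij) jK LX FA.
  by apply: filterS3 h (xhat_steps ij jK LX) (xhat_steps ij jK LAX) => w a b -> /=; rewrite b.
- move=> s t Ts Tt /(grid_le Ts Tt)[i [j [ij jK -> ->]]] X LX LjX; apply/aeTP.
  have h := steps_projection (subnKC ij) jK LX.
  by apply: filterS2 h (xhat_steps ij jK LjX) => w a ->.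
- move=> s t Ts Tt /(grid_le Ts Tt)[i [j [ij jK -> ->]]] X Y Z LX LY LZ h.
  have := steps_sandwich (subnKC ij) jK LX LY LZ h.
  by apply: filterS2 (xhat_steps ij jK LX) => w ->.
- move=> s t u X Ts Tt Tu st tu.
  have [i [j [k [ij jk kK [-> -> ->]]]]] := grid_le3 Ts Tt Tu st tu.
  move=> LX; apply/aeTP; have jK := leq_trans jk kK.
  have LV : Lpt j (steps j (k - j) X).
    by apply: (steps_Lp _ kK LX); rewrite subnKC.
  have h1 := xhat_steps (leq_trans ij jk) kK LX.
  have h2 := xhat_steps ij jK (xh_Lp _ _ _ jk kK LX).
  have h3 : {ae P, forall w, steps j (k - j) X w = xh (tau j) (tau k) X w}.
    by apply: filterS (xhat_steps jk kK LX) => w ->.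
  have h4 := steps_ae (subnKC ij) jK LV h3.
  have e : steps i (k - i) X = steps i (j - i) (steps j (k - j) X).
    have := steps_cat P F p L x m M tau i (j - i) (k - j) X.
    by rewrite subnKC// addnC addnBA// subnK.
  rewrite e in h1.
  by apply: filterS3 h1 h2 h4 => w -> -> ->.
Qed.

Lemma xhat_maximal xbar i j X : sandwich_extension P p F (grid K tau) L x m M xbar ->
  (i <= j)%N -> (j <= K)%N -> Lpt j X ->
  {ae P, forall w, xbar (tau i) (tau j) X w <= xh (tau i) (tau j) X w}.
Proof.
move=> xP ij jK LX; have h := steps_max xP (subnKC ij) jK LX.
by apply: filterS2 h (xhat_steps ij jK LX) => w a ->.
Qed.

End grid_operators.

(* The first conclusion says that the essential supremum defining the extension
   is almost surely finite and, when grid points are repeated, does not depend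
   on the indices chosen to denote the times. *)
Theorem proposition4p1
  (d : measure_display) (Omega : measurableType d) (R : realType)
  (P : probability Omega R) (P_complete : measure_is_complete P)
  (T : R) (T_gt0 : 0 < T)
  (F : R -> set (set Omega)) (F_filtration : augmented_filtration P T F)
  (p : \bar R) (p_ge1 : (1 <= p)%E)
  (K : nat) (tau : nat -> R) (tau0 : tau 0%N = 0) (tauK : tau K = T)
  (tau_le : forall k, (k < K)%N -> tau k <= tau k.+1)
  (L : R -> set (Omega -> R))
  (x m M : R -> R -> (Omega -> R) -> Omega -> R)
  (x_star : star_system P p T F (grid K tau) L x)
  (x_tc : time_consistent P (grid K tau) L x)
  (mM : mM_condition P p T F (grid K tau) m M)
  (x_sandwich : sandwich_condition P p F (grid K tau) L x m M) :
  let xh := xhat P p F L x m M K tau in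
  [/\ forall i j X, (i < j <= K)%N -> Lp P p (F (tau j)) X ->
        EFin \o xh (tau i) (tau j) X
          = xhat_idx P p F L x m M tau i j X %[ae P],
      sandwich_extension P p F (grid K tau) L x m M xh &
      forall xbar : R -> R -> (Omega -> R) -> Omega -> R,
        sandwich_extension P p F (grid K tau) L x m M xbar ->
        forall i j X, (i < j <= K)%N -> Lp P p (F (tau j)) X ->
          {ae P, forall w,
            xbar (tau i) (tau j) X w <= xh (tau i) (tau j) X w}].
Proof.
have S : sandwich_setting P T F p (grid K tau) L x m M.
  split => //.
  - by move=> _ [k kK ->]; rewrite -tau0 -tauK !(tau_monotone tau_le).
  - by exists 0%N.
  - by exists K.
move=> xh; split.
- move=> i j X /andP[ij jK] LX; apply/aeTP; have ij' := ltnW ij.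
  have h := xhat_idx_steps tau_le S ij' jK LX.
  by apply: filterS2 (xhat_steps tau_le S ij' jK LX) h => w /= <- ->.
- exact: (xhat_sandwich_extension tau_le S x_tc).
- move=> xbar xP i j X /andP[ij jK] LX.
  exact: (xhat_maximal tau_le S xP (ltnW ij) jK LX).
Qed.
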